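(* Let $n\ge2$. A heap of type $\widetilde{B}_{n+1}$ (resp. $\widetilde{D}_{n+2}$) is fully commutative if and only if it belongs to one of the five families $X_{\widetilde B}=\bigcup_{H\in X}\Delta_t(H)$ (resp. $X_{\widetilde D}=\bigcup_{H\in X}\Delta_{t,u}(H)$), where $X$ runs over the families (ALT), (ZZ), (LP), (RP), (LRP) of heaps of type $\widetilde{C}_n$.
   Context: Coxeter graphs. $\widetilde{C}_n$: path $t,s_1,\dots,s_{n-1},u$ with $m_{ts_1}=m_{s_{n-1}u}=4$, other edges labeled $3$. $\widetilde{B}_{n+1}$: same, except that $t$ is replaced by two commuting vertices $t_1,t_2$, each joined to $s_1$ only, with label $3$. $\widetilde{D}_{n+2}$: in addition $u$ is replaced by two commuting vertices $u_1,u_2$, each joined to $s_{n-1}$ only, with label $3$. An element of a Coxeter group is fully commutative (FC) if any of its reduced expressions can be obtained from any other one using only commutation relations. Heaps. Let $\Gamma$ be a finite graph with vertex set $S$. A $\Gamma$-heap is a finite poset $(H,\le)$ with a labeling $\epsilon:H\to S$ such that (a) for each vertex $s$ and edge $\{s,s'\}$, the subposets $H_s=\epsilon^{-1}(\{s\})$ and $H_{\{s,s'\}}=\epsilon^{-1}(\{s,s'\})$ are totally ordered; (b) $\le$ is the transitive closure of the relations given by these chains. Heaps are considered up to label-preserving isomorphism. $H_I$ is the subposet of elements with labels in $I$; an $s$-element is an element labeled $s$. For a word $\mathbf w=s_{a_1}\cdots s_{a_l}$, $\operatorname{Heap}(\mathbf w)$ is the poset on $\{1,\dots,l\}$ with order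 the transitive closure of $i\prec j$ for $i<j$ and $s_{a_i},s_{a_j}$ equal or adjacent, labeled by $i\mapsto s_{a_i}$. A heap is FC if it is $\operatorname{Heap}(\mathbf w)$ for a reduced word $\mathbf w$ of an FC element. A heap (or a restriction $H_I$) is alternating if for each edge $\{s,s'\}$ (within $I$) the labels of the chain $H_{\{s,s'\}}$ alternate. Families of heaps of type $\widetilde{C}_n$. Let $P_{\rightarrow}(s_i)=\operatorname{Heap}(s_i\cdots s_{n-1}us_{n-1}\cdots s_i)$, $P_{\leftarrow}(s_i)=\operatorname{Heap}(s_i\cdots s_1ts_1\cdots s_i)$; $H_{\{\leftarrow s_i\}}$ (resp. $H_{\{s_i\rightarrow\}}$) is the restriction of $H$ to labels $\{t,s_1,\dots,s_i\}$ (resp. $\{s_i,\dots,s_{n-1},u\}$). (ALT): $H$ is alternating. (ZZ): $H=\operatorname{Heap}(\mathbf w)$ with $\mathbf w$ a finite factor of $(ts_1\cdots s_{n-1}us_{n-1}\cdots s_1)^\infty$ such that $|H_{s_i}|\ge3$ for some $i\in\{1,\dots,n-1\}$. (LP): for some $j\in\{1,\dots,n-1\}$: LP(1) $H_{\{\leftarrow s_j\}}=P_{\leftarrow}(s_j)$; LP(2) no $s_{j+1}$-element (if $j\ne n-1$), resp. no $u$-element (if $j=n-1$), lies between the two $s_j$-elements; LP(3) $H_{\{s_j\rightarrow\}}$ is alternating when one $s_j$-element is deleted. (RP): for some $k\in\{1,\dots,n-1\}$: RP(1) $H_{\{s_k\rightarrow\}}=P_{\rightarrow}(s_k)$; RP(2)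 no $s_{k-1}$-element (if $k\ne1$), resp. no $t$-element (if $k=1$), lies between the two $s_k$-elements; RP(3) $H_{\{\leftarrow s_k\}}$ is alternating when one $s_k$-element is deleted. (LRP): for some $1\le j<k\le n-1$: LP(1), LP(2), RP(1), RP(2) hold and $H_{\{s_j,\dots,s_k\}}$ is alternating when both an $s_j$- and an $s_k$-element are deleted. Substitution $\Delta_t$. Let $H=\operatorname{Heap}(\mathbf w)$ belong to one of these families (the result does not depend on the chosen $\mathbf w$). $\Delta_t(H)$ is the following set of heaps of type $\widetilde{B}_{n+1}$. - $H\in$ (LP) or (LRP): there is a unique $t$-element; $\Delta_t(H)$ consists of the single heap obtained by replacing $t$ by $t_1t_2$ in $\mathbf w$. - $H\in$ (ZZ): ($\mathbf w$ is then unique) replace every $t$ by $t_1t_2$, except that an occurrence of $t$ which is the first or the last letter of $\mathbf w$ may be replaced by any of $t_1t_2$, $t_1$, $t_2$ (independent choices); $\Delta_t(H)$ is the set of all resulting heaps. - $H\in$ (ALT) or (RP): if $H$ has no $t$-element, $\Delta_t(H)=\{H\}$; if it has exactly one, $\Delta_t(H)$ consists of the three heaps obtained by replacing $t$ by $t_1t_2$, by $t_1$, or by $t_2$; if it has more than one, $\Delta_t(H)$ consists of the two heaps obtained by replacing the occurrences of $t$, from first to last, alternately by $t_1$ and $t_2$, starting with $t_1$ or starting with $t_2$. Special case: for $H=\operatorname{Heap}(ts_1\cdots s_{n-1}us_{n-1}\cdots s_1t)$, each of the two $t$-elements may instead be replaced independently by $t_1$, $t_2$ or $t_1t_2$. Substitution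 $\Delta_{t,u}$. Let $H=\operatorname{Heap}(\mathbf w)$ belong to one of the five families. $\Delta_{t,u}(H)$ is the set of heaps of type $\widetilde{D}_{n+2}$ obtained from $\mathbf w$ by replacing the $t$-elements and, independently, the $u$-elements, according to the following rules. Rules for $t$-elements: - $H\in$ (LP) or (LRP): the unique $t$ is replaced by $t_1t_2$. - $H\in$ (ZZ): every $t$ is replaced by $t_1t_2$, except that an occurrence of $t$ which is the first or the last letter of $\mathbf w$ may be replaced by any of $t_1t_2$, $t_1$, $t_2$ (independent choices). - $H\in$ (ALT) or (RP): if there is no $t$-element, nothing is replaced; if there is exactly one, it is replaced by $t_1t_2$, $t_1$ or $t_2$; if there is more than one, the occurrences of $t$ are replaced, from first to last, alternately by $t_1$ and $t_2$, starting with $t_1$ or starting with $t_2$. Special case: for $H=\operatorname{Heap}(ts_1\cdots s_{n-1}us_{n-1}\cdots s_1t)$, each of the two $t$-elements may instead be replaced independently by $t_1$, $t_2$ or $t_1t_2$. Rules for $u$-elements (mirror images of the rules for $t$-elements): - $H\in$ (RP) or (LRP): the unique $u$ is replaced by $u_1u_2$. - $H\in$ (ZZ): every $u$ is replaced by $u_1u_2$, except that an occurrence of $u$ which is the first or the last letter of $\mathbf w$ may be replaced by any of $u_1u_2$, $u_1$, $u_2$ (independent choices). - $H\in$ (ALT) or (LP): if there is no $u$-element, nothing is replaced; if there is exactly one, it is replaced by $u_1u_2$, $u_1$ or $u_2$; if there is more than one, the occurrences of $u$ are replaced, from first to last, alternately by $u_1$ and $u_2$, starting with $u_1$ or starting with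 $u_2$. Special case: for $H=\operatorname{Heap}(us_{n-1}\cdots s_1ts_1\cdots s_{n-1}u)$, each of the two $u$-elements may instead be replaced independently by $u_1$, $u_2$ or $u_1u_2$. *)

(* Defs.v *)
From Stdlib Require Import Relations.
From HB Require Import structures.
From mathcomp Require Import all_boot all_order.

Set Implicit Arguments.
Unset Strict Implicit.
Unset Printing Implicit Defensive.

Import Order.TTheory.
Local Open Scope nat_scope.

(** * Coxeter groups *)

(* A Coxeter matrix is given by its entries [m s t]; all the matrices below
   have finite entries, so there is no encoding of infinity.  Elements of the
   Coxeter group are represented by words in the generators. *)
Section CoxeterGroups.
Variables (S : finType) (m : S -> S -> nat).

Definition edge : rel S := fun s t => 2 < m s t.

Inductive relator_step : relation (seq S) :=
  RelatorStep (u v : seq S) (s t : S) :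
    relator_step (u ++ flatten (nseq (m s t) [:: s; t]) ++ v) (u ++ v).

(* Since m s s = 1, every generator is its own inverse: the monoid presented by
   the relators (s t)^(m s t) is the Coxeter group, and this congruence is
   equality of the group elements represented by two words. *)
Definition same_element : relation (seq S) :=
  clos_refl_sym_trans (seq S) relator_step.

Inductive commutation_step : relation (seq S) :=
  CommutationStep (u v : seq S) (s t : S) of m s t = 2 :
    commutation_step (u ++ [:: s; t] ++ v) (u ++ [:: t; s] ++ v).

Definition commutation_equiv : relation (seq S) :=
  clos_refl_sym_trans (seq S) commutation_step.

Definition reduced (w : seq S) : Prop :=
  forall w', same_element w w' -> size w <= size w'.

(* The group element represented by w is fully commutative. *)
Definition fully_commutative (w : seq S) : Prop :=
  forall w1 w2, same_element w w1 -> same_element w w2 ->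
    reduced w1 -> reduced w2 -> commutation_equiv w1 w2.

End CoxeterGroups.

(** * Heaps *)

Fact heap_display : Order.disp_t. Proof. exact: Order.Disp tt tt. Qed.

Record lposet (S : Type) := LPoset {
  carrier :> finPOrderType heap_display;
  label : carrier -> S
}.

Definition lposet_iso (S : Type) (H K : lposet S) : Prop :=
  exists f : H -> K,
    [/\ bijective f, {mono f : x y / (x <= y)%O}
      & forall x, label (f x) = label x].

(* [connect] is the reflexive transitive closure; reflexivity is already part
   of the order on each chain. *)
Definition is_heap (S : finType) (e : rel S) (H : lposet S) : Prop :=
  (forall (s s' : S) (x y : H), (s == s') || e s s' ->
     label x \in [:: s; s'] -> label y \in [:: s; s'] -> (x >=< y)%O)
  /\
  (forall x y : H,
     (x <= y)%O =
     connect (fun a b : H => (a <= b)%O &&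
                ((label a == label b) || e (label a) (label b))) x y).

Record heap (S : finType) (e : rel S) := MkHeap {
  heap_lposet :> lposet S;
  heapP : is_heap e heap_lposet
}.

HB.instance Definition _ (T : finPOrderType heap_display) (A : {set T}) :=
  [SubChoice_isSubPOrder of {x : T | x \in A} by <: with heap_display].

Definition subposet (S : Type) (H : lposet S) (A : {set H}) : lposet S :=
  @LPoset S {x : H | x \in A} (fun x => label (val x)).

(* H_I *)
Definition restriction (S : finType) (H : lposet S) (I : {set S}) : lposet S :=
  subposet [set x : H | label x \in I].

Section WordHeap.
Variables (S : finType) (e : rel S) (w : seq S).

(* Alias of 'I_(size w) that does not carry the usual order of ordinals. *)
Definition word_pos := 'I_(size w).
HB.instance Definition _ := Finite.copy word_pos 'I_(size w).

Definition word_label (i : word_pos) : S := tnth (in_tuple w) i.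

Definition word_prec : rel word_pos := fun i j =>
  ((i : nat) < j) && ((word_label i == word_label j) ||
                      e (word_label i) (word_label j)).

Definition word_le : rel word_pos := connect word_prec.

Fact word_le_leq (i j : word_pos) : word_le i j -> (i : nat) <= j.
Proof.
case/connectP => p; elim: p i => [|k p IHp] i /= => [_ -> //|].
by case/andP => /andP[/ltnW ik _] kp /(IHp _ kp); apply: leq_trans.
Qed.

Fact word_le_refl : reflexive word_le.
Proof. exact: connect0. Qed.

Fact word_le_anti : antisymmetric word_le.
Proof.
move=> i j /andP[/word_le_leq ij /word_le_leq ji].
by apply: val_inj; apply/eqP; rewrite eqn_leq ij ji.
Qed.

Fact word_le_trans : transitive word_le.
Proof. exact: connect_trans. Qed.

HB.instance Definition _ := Order.Le_isPOrder.Build heap_display word_pos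
  word_le_refl word_le_anti word_le_trans.

(* Heap(w) *)
Definition heap_of_word : lposet S := @LPoset S word_pos word_label.

Fact heap_of_wordP : symmetric e -> is_heap e heap_of_word.
Proof.
move=> esym; split=> [s s' i j es|i j].
  move=> li lj.
  have comp : (label i == label j) || e (label i) (label j).
    move: es li lj; rewrite !inE => /orP[/eqP<-|es].
      by rewrite !orbb => /eqP-> /eqP->; rewrite eqxx.
    by case/orP=> /eqP-> /orP[] /eqP->; rewrite ?eqxx ?es ?orbT // esym es orbT.
  have comp' : (label j == label i) || e (label j) (label i).
    by rewrite eq_sym esym.
  rewrite /Order.comparable; case: (ltngtP (i : nat) j) => ij.
  - by apply/orP; left; apply: connect1; rewrite /word_prec ij.
  - by apply/orP; right; apply: connect1; rewrite /word_prec ij.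
  - by rewrite (val_inj ij : i = j) lexx.
apply/idP/idP; last first.
  case/connectP=> p; elim: p i => [|k p IHp] i /=.
    by move=> _ ->; exact: lexx.
  by case/andP=> /andP[ik _] kp jp; apply: le_trans ik (IHp _ kp jp).
apply: connect_sub => {}i {}j ij; apply: connect1; apply/andP; split.
  exact: connect1.
by case/andP: ij.
Qed.

End WordHeap.

Definition fc_heap (S : finType) (m : S -> S -> nat) (H : lposet S) : Prop :=
  exists w : seq S, [/\ reduced m w, fully_commutative m w
                      & lposet_iso H (heap_of_word (edge m) w)].

(* The labels of H_{s,s'} alternate for every edge {s,s'} with both ends in I:
   consecutive elements of this chain have distinct labels. *)
Definition alternating_on (S : finType) (e : rel S) (I : {set S})
    (H : lposet S) : Prop :=
  forall s s' : S, s \in I -> s' \in I -> e s s' ->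
  forall x y : H, label x \in [:: s; s'] -> label y \in [:: s; s'] ->
    (x < y)%O ->
    (forall z : H, label z \in [:: s; s'] -> ~~ (x < z < y)%O) ->
  label x != label y.

(** * The Coxeter graphs *)

(* The vertices are placed along a path: left end(s) at position 0, s_i at
   position i for 0 < i < n, right end(s) at position n.  The index of s_i in
   'I_n.-1 is i - 1. *)
Definition vertex (L R : finType) (n : nat) : finType := (L + 'I_n.-1 + R)%type.

Definition sv (L R : finType) (n : nat) (i : 'I_n.-1) : vertex L R n :=
  inl (inr i).

Definition pos (L R : finType) (n : nat) (v : vertex L R n) : nat :=
  match v with
  | inl (inl _) => 0
  | inl (inr i) => i.+1
  | inr _ => n
  end.

(* a and b label the edges between s_1 and the left end(s) and between s_(n-1)
   and the right end(s); two distinct left (or right) ends commute. *)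
Definition path_matrix (L R : finType) (n a b : nat) (v w : vertex L R n) :
    nat :=
  if v == w then 1
  else if (pos v == (pos w).+1) || (pos w == (pos v).+1) then
    match v, w with
    | inl (inl _), _ | _, inl (inl _) => a
    | inr _, _ | _, inr _ => b
    | _, _ => 3
    end
  else 2.

Definition Ctype (n : nat) : finType := vertex unit unit n.
Definition Btype (n : nat) : finType := vertex bool unit n.
Definition Dtype (n : nat) : finType := vertex bool bool n.

(* Affine C_n, B_(n+1) and D_(n+2). *)
Definition cox_C (n : nat) : Ctype n -> Ctype n -> nat := path_matrix 4 4.
Definition cox_B (n : nat) : Btype n -> Btype n -> nat := path_matrix 3 4.
Definition cox_D (n : nat) : Dtype n -> Dtype n -> nat := path_matrix 3 3.

(** * The families of heaps of type affine C_n *)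

Section Families.
Variable n : nat.

Definition tC : Ctype n := inl (inl tt).
Definition uC : Ctype n := inr tt.
Definition sC (i : 'I_n.-1) : Ctype n := sv unit unit i.

Notation heap_of_Cword := (heap_of_word (edge (@cox_C n))).

(* s_i ... s_(n-1), and its reverse *)
Definition s_up_from (i : 'I_n.-1) : seq (Ctype n) :=
  [seq sC k | k : 'I_n.-1 <- enum 'I_n.-1 & i <= k].
Definition s_down_to (i : 'I_n.-1) : seq (Ctype n) := rev (s_up_from i).

(* s_1 ... s_i, and its reverse *)
Definition s_up_to (i : 'I_n.-1) : seq (Ctype n) :=
  [seq sC k | k : 'I_n.-1 <- enum 'I_n.-1 & k <= i].
Definition s_down_from (i : 'I_n.-1) : seq (Ctype n) := rev (s_up_to i).

(* s_1 ... s_(n-1), and its reverse *)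
Definition s_up : seq (Ctype n) := [seq sC k | k <- enum 'I_n.-1].
Definition s_down : seq (Ctype n) := rev s_up.

Definition P_right (i : 'I_n.-1) : lposet (Ctype n) :=
  heap_of_Cword (s_up_from i ++ [:: uC] ++ s_down_to i).
Definition P_left (i : 'I_n.-1) : lposet (Ctype n) :=
  heap_of_Cword (s_down_from i ++ [:: tC] ++ s_up_to i).

Definition labels_between (a b : nat) : {set Ctype n} :=
  [set v | a <= pos v <= b].

Definition alternating_between (a b : nat) (H : lposet (Ctype n)) : Prop :=
  alternating_on (edge (@cox_C n)) (labels_between a b) H.

(* No element whose label has position p lies between two s_i-elements. *)
Definition none_between (H : lposet (Ctype n)) (i : 'I_n.-1) (p : nat) : Prop :=
  forall x y z : H, label x = sC i -> label y = sC i -> pos (label z) = p ->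
    ~~ (x < z < y)%O.

Definition delete (H : lposet (Ctype n)) (A : {set H}) : lposet (Ctype n) :=
  subposet (~: A).

Definition is_ALT (H : lposet (Ctype n)) : Prop :=
  alternating_on (edge (@cox_C n)) [set: Ctype n] H.

Definition zigzag : seq (Ctype n) := [:: tC] ++ s_up ++ [:: uC] ++ s_down.

(* The finite factors of the infinite word zigzag^oo are those of its finite
   powers. *)
Definition zigzag_factor (w : seq (Ctype n)) : Prop :=
  exists N : nat, infix w (flatten (nseq N zigzag)).

Definition is_ZZ (H : lposet (Ctype n)) : Prop :=
  (exists w, zigzag_factor w /\ lposet_iso H (heap_of_Cword w)) /\
  (exists i : 'I_n.-1, 3 <= #|[set x : H | label x == sC i]|).

(* Positions pos (s_j) + 1 and pos (s_k) - 1 are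
   those of s_(j+1) or u, and of s_(k-1) or t. *)
Definition LP1 (H : lposet (Ctype n)) (j : 'I_n.-1) : Prop :=
  lposet_iso (restriction H (labels_between 0 (pos (sC j)))) (P_left j).
Definition LP2 (H : lposet (Ctype n)) (j : 'I_n.-1) : Prop :=
  none_between H j (pos (sC j)).+1.
Definition RP1 (H : lposet (Ctype n)) (k : 'I_n.-1) : Prop :=
  lposet_iso (restriction H (labels_between (pos (sC k)) n)) (P_right k).
Definition RP2 (H : lposet (Ctype n)) (k : 'I_n.-1) : Prop :=
  none_between H k (pos (sC k)).-1.

Definition is_LP (H : lposet (Ctype n)) : Prop :=
  exists j : 'I_n.-1,
    [/\ LP1 H j, LP2 H j
      & exists x : H, label x = sC j /\
          alternating_between (pos (sC j)) n (delete [set x])].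

Definition is_RP (H : lposet (Ctype n)) : Prop :=
  exists k : 'I_n.-1,
    [/\ RP1 H k, RP2 H k
      & exists x : H, label x = sC k /\
          alternating_between 0 (pos (sC k)) (delete [set x])].

Definition is_LRP (H : lposet (Ctype n)) : Prop :=
  exists j k : 'I_n.-1, [/\ j < k, LP1 H j /\ LP2 H j, RP1 H k /\ RP2 H k
    & exists x y : H, [/\ label x = sC j, label y = sC k
        & alternating_between (pos (sC j)) (pos (sC k)) (delete [set x; y])]].

Inductive heap_family := ALT | ZZ | LP | RP | LRP.

Definition in_family (X : heap_family) : lposet (Ctype n) -> Prop :=
  match X with
  | ALT => is_ALT | ZZ => is_ZZ | LP => is_LP | RP => is_RP | LRP => is_LRP
  end.

(* Left-right symmetry of the graph exchanges LP and RP. *)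
Definition mirror (X : heap_family) : heap_family :=
  match X with LP => RP | RP => LP | _ => X end.

(** * The substitutions *)

(* What an occurrence of an end x (t or u) is replaced by: [One false] is x_1,
   [One true] is x_2 and [Both] is x_1 x_2. *)
Inductive end_split := One of bool | Both.

(* Rules for the replacements r of the successive occurrences of the end x in
   the word w, where H = Heap(w) is in X.  They are phrased for x = t; for x = u
   they are used with the mirror image of X.  [special] is the word of the
   special case. *)
Definition end_rule (x : Ctype n) (special : seq (Ctype n)) (X : heap_family)
    (w : seq (Ctype n)) (r : seq end_split) : Prop :=
  size r = count_mem x w /\
  match X with
  | LP | LRP => r = [:: Both]
  | ZZ => forall i, i < size r ->
      [\/ nth Both r i = Both,
          i = 0 /\ (exists w', w = x :: w')
        | i = (size r).-1 /\ (exists w', w = rcons w' x)]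
  | ALT | RP =>
      [\/ size r <= 1,
          exists b : bool, r = mkseq (fun i => One (b (+) odd i)) (size r)
        | lposet_iso (heap_of_Cword w) (heap_of_Cword special)]
  end.

Definition t_rule (X : heap_family) : seq (Ctype n) -> seq end_split -> Prop :=
  end_rule tC (zigzag ++ [:: tC]) X.

Definition u_rule (X : heap_family) : seq (Ctype n) -> seq end_split -> Prop :=
  end_rule uC ([:: uC] ++ s_down ++ [:: tC] ++ s_up ++ [:: uC]) (mirror X).

Definition split_word (V : Type) (f : bool -> V) (c : end_split) : seq V :=
  match c with One b => [:: f b] | Both => [:: f false; f true] end.

(* Replaces the successive occurrences of t by the words of rt, and those of u
   by the words of ru. *)
Fixpoint substitute (L R : finType) (rt ru : seq (seq (vertex L R n)))
    (w : seq (Ctype n)) : seq (vertex L R n) :=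
  match w with
  | [::] => [::]
  | inl (inl _) :: w' => head [::] rt ++ substitute (behead rt) ru w'
  | inl (inr i) :: w' => sv L R i :: substitute rt ru w'
  | inr _ :: w' => head [::] ru ++ substitute rt (behead ru) w'
  end.

Definition tB (b : bool) : Btype n := inl (inl b).
Definition uB : Btype n := inr tt.
Definition tD (b : bool) : Dtype n := inl (inl b).
Definition uD (b : bool) : Dtype n := inr b.

(* K is in Delta_t(H), where H is in X. *)
Definition Delta_t (X : heap_family) (H : lposet (Ctype n))
    (K : lposet (Btype n)) : Prop :=
  exists (w : seq (Ctype n)) (rt : seq end_split),
    [/\ lposet_iso H (heap_of_Cword w), t_rule X w rt
      & lposet_iso K (heap_of_word (edge (@cox_B n))
          (substitute (map (split_word tB) rt)
             (nseq (count_mem uC w) [:: uB]) w))].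

(* K is in Delta_{t,u}(H), where H is in X. *)
Definition Delta_tu (X : heap_family) (H : lposet (Ctype n))
    (K : lposet (Dtype n)) : Prop :=
  exists (w : seq (Ctype n)) (rt ru : seq end_split),
    [/\ lposet_iso H (heap_of_Cword w), t_rule X w rt, u_rule X w ru
      & lposet_iso K (heap_of_word (edge (@cox_D n))
          (substitute (map (split_word tD) rt) (map (split_word uD) ru) w))].

(* K is in X_B, resp. X_D. *)
Definition family_B (X : heap_family) (K : lposet (Btype n)) : Prop :=
  exists H : heap (edge (@cox_C n)), in_family X H /\ Delta_t X H K.

Definition family_D (X : heap_family) (K : lposet (Dtype n)) : Prop :=
  exists H : heap (edge (@cox_C n)), in_family X H /\ Delta_tu X H K.

End Families.

(* Main.v *)
Require Import Defs.
From Stdlib Require Import Relations.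
From HB Require Import structures.
From mathcomp Require Import all_boot all_order all_algebra.
From mathcomp Require Import boolp zify ring.

(** A word represents a reduced expression of a fully commutative element if and
only if it is braid-free: no word of its commutation class contains a square
[s s] or a braid [s t s ...] of length [m s t > 2] (lemma [stembridge]; it rests on
Matsumoto's theorem, obtained here from the exchange property, and on the
fact that the product of two generators has the expected order). So both
statements describe the heaps of the braid-free words.

In type affine D, a braid-free word is up to commutation the expansion of a
decorated word: a word in the positions 0, ..., n in which each end letter
carries a decoration [One b] or [Both], the two copies of an end being merged
whenever no neighbour separates them ([collapse_D]). Since all labels are 2 or 3,
braid-freeness only concerns the gap between two consecutive occurrences of
the same generator: it has to contain two neighbours of this generator. In
terms of decorated words this is the predicate [stable] ([braid_free_stable],
[stable_braid_free]). In type affine B the right end u has a single copy and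
an edge labelled 4. The words u s u are then allowed, but not u s u s. The
u-letters are decorated with alternating [One b] along the patterns u s u, and
with [Both] elsewhere; with this choice braid-freeness is stability again
([braid_free_stable_B], [stable_braid_free_B]). The two types are thus reduced
to the same combinatorial problem.

Stable words are classified by [stable_shape]. If a word is not alternating
along an edge, two consecutive letters of the same position i have no letter
of position i + 1, say, between them; the gap condition, applied downwards
to i - 1, i - 2, ..., forces the letters of position less than i in this gap to
form the peak i - 1, ..., 1, 0, 1, ..., i - 1 with a double letter 0
([peak_shape]). Either no further letter of position at most i occurs in the word,
and the peak is isolated, as in the families LP, RP and LRP; or the word
contains a complete turn i ... 0 ... n ... i, after which each letter is forced
by the preceding ones, in both directions, so that the whole word is a factor of the infinite
zigzag ([peak_next], [loop_zigzag]).

It remains to compare with the definitions of the families: a stable word of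
a given shape has a heap of type affine C in the corresponding family and
obeys the substitution rules ([shape_family], [rule_t], [rule_u]), and
conversely a word substituted in a heap of a family following these rules
is stable ([family_stable]). Heaps are read off words through linear
extensions; different words only have to be compared for peaks and zigzags,
whose heaps are chains and so determine the word ([chain_iso_eq]). *)

Set Implicit Arguments.
Unset Strict Implicit.
Unset Printing Implicit Defensive.

Local Open Scope nat_scope.

(** * Reduced words and full commutativity *)

Fixpoint alt (T : Type) (s t : T) (k : nat) : seq T :=
  if k is k'.+1 then s :: alt t s k' else [::].

Lemma size_alt (T : Type) (s t : T) k : size (alt s t k) = k.
Proof. by elim: k s t => //= k IH s t; rewrite IH. Qed.

Lemma alt_cat (T : Type) (s t : T) k l :
  alt s t (k.*2 + l) = flatten (nseq k [:: s; t]) ++ alt s t l.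
Proof. by elim: k => //= k IH; rewrite IH. Qed.

Lemma rev_alt_cat (T : Type) (s t : T) k l :
  alt s t (k + l) = alt s t k ++ (if odd k then alt t s l else alt s t l).
Proof. by elim: k s t => //= k IH s t; rewrite IH; case: (odd k). Qed.

Lemma alt_rcons (T : Type) (s t : T) k :
  alt s t k.+1 = rcons (alt s t k) (if odd k then t else s).
Proof. by rewrite -addn1 rev_alt_cat -cats1; case: (odd k). Qed.

Lemma alt_revC (T : Type) (s t : T) k :
  alt s t k ++ rev (alt t s k) = flatten (nseq k [:: s; t]).
Proof.
suff H l (a b : T) : rev (alt b a l) = if odd l then alt b a l else alt a b l.
  rewrite H; transitivity (alt s t (k + k)).
    by rewrite rev_alt_cat; case: (odd k).
  by rewrite addnn -[k.*2]addn0 alt_cat /= cats0.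
elim: l a b => //= l IH a b; rewrite rev_cons IH.
have := @alt_rcons _ b a l; have := @alt_rcons _ a b l.
by rewrite /=; case: (odd l) => /= H1 H2; rewrite ?H1 ?H2.
Qed.

Section CoxeterWords.
Variables (S : finType) (m : S -> S -> nat).
Hypothesis m1 : forall s, m s s = 1.
Hypothesis mC : forall s t, m s t = m t s.
Hypothesis m_gt0 : forall s t, 0 < m s t.

Notation "u ~~ v" := (same_element m u v) (at level 70).
Notation "u === v" := (commutation_equiv m u v) (at level 70).

Lemma same_refl u : u ~~ u. Proof. exact: rst_refl. Qed.
Lemma same_sym u v : u ~~ v -> v ~~ u. Proof. exact: rst_sym. Qed.
Lemma same_trans v u w : u ~~ v -> v ~~ w -> u ~~ w.
Proof. exact: rst_trans. Qed.

Hint Resolve same_refl : core.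

Lemma rst_cat (R : relation (seq S)) (a c : seq S) :
  (forall u v, R u v -> R (a ++ u ++ c) (a ++ v ++ c)) ->
  forall u v, clos_refl_sym_trans _ R u v ->
    clos_refl_sym_trans _ R (a ++ u ++ c) (a ++ v ++ c).
Proof.
move=> HR u v; elim=> {u v} [u v /HR|u|u v _|u v w _ + _].
- exact: rst_step.
- exact: rst_refl.
- exact: rst_sym.
- exact: rst_trans.
Qed.

Lemma same_ctx a c u v : u ~~ v -> a ++ u ++ c ~~ a ++ v ++ c.
Proof.
apply: rst_cat => _ _ [x y s t]; rewrite -!catA (catA a) [in X in _ _ X]catA.
exact: RelatorStep.
Qed.

Lemma same_cat u u' v v' : u ~~ u' -> v ~~ v' -> u ++ v ~~ u' ++ v'.
Proof.
move=> /(@same_ctx [::] v) H /(@same_ctx u' [::]); rewrite !cats0.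
exact: same_trans.
Qed.

Lemma same_cons s u v : u ~~ v -> s :: u ~~ s :: v.
Proof. by move=> H; apply: (@same_cat [:: s] [:: s]). Qed.

Lemma same_relator s t : flatten (nseq (m s t) [:: s; t]) ~~ [::].
Proof. by have := RelatorStep m [::] [::] s t; rewrite cats0; exact: rst_step. Qed.

Lemma same_ss s u : s :: s :: u ~~ u.
Proof.
by have /(@same_cat _ _ u u) := same_relator s s; rewrite m1 /=; apply.
Qed.

Lemma same_revr w : w ++ rev w ~~ [::].
Proof.
elim: w => //= s w IH; rewrite rev_cons -cats1 catA.
apply: same_trans (same_ss s [::]); apply: same_cons.
exact: (@same_cat _ [::] [:: s] [:: s]).
Qed.

Lemma same_revl w : rev w ++ w ~~ [::].
Proof. by have := same_revr (rev w); rewrite revK. Qed.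

Lemma same_cancel a u v : a ++ u ~~ a ++ v -> u ~~ v.
Proof.
move=> H; have : rev a ++ a ++ u ~~ rev a ++ a ++ v by apply: same_cat.
rewrite !catA => H'.
apply: same_trans (same_trans H' _).
  by apply: same_sym; apply: (@same_cat _ [::] u u) => //; apply: same_revl.
by apply: (@same_cat _ [::] v v) => //; apply: same_revl.
Qed.

Lemma same_move a b u v : u ~~ a ++ v ++ rev b -> u ++ b ~~ a ++ v.
Proof.
move=> H; have := same_cat H (same_refl b); rewrite -!catA => /same_trans; apply.
rewrite -{2}[v]cats0; do 2![apply: same_cat => //]; exact: same_revl.
Qed.

Lemma same_rev u v : u ~~ v -> rev u ~~ rev v.
Proof.
move=> H; apply: (@same_cancel v).
apply: same_trans (same_sym (same_revr v)).
apply: same_trans (same_revr u).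
by apply: same_cat => //; exact: same_sym.
Qed.

Lemma same_alt s t : alt s t (m s t) ~~ alt t s (m s t).
Proof.
have := @same_move [::] (alt t s (m s t)) (alt s t (m s t)) [::].
have H : alt s t (m s t) ++ rev (alt t s (m s t)) ~~ [::].
  by rewrite alt_revC; exact: same_relator.
move=> _; apply: same_trans (same_cat H (same_refl (alt t s (m s t)))).
rewrite -catA -{1}[alt s t _]cats0.
by apply: same_cat => //; apply: same_sym; exact: same_revl.
Qed.

(** Deleting one letter x from w = a x b multiplies the element on the left by the
reflection a x a^-1; these are those reflections, in the order of the letters. *)
Fixpoint reflections (w : seq S) : seq (seq S) :=
  if w is s :: w' then [:: s] :: [seq s :: rcons r s | r <- reflections w'] else [::].

Definition conjugate (a r : seq S) := a ++ r ++ rev a.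

Lemma refls_cat a b : reflections (a ++ b) = reflections a ++ map (conjugate a) (reflections b).
Proof.
elim: a => [|s a IH] /=.
  by rewrite /conjugate /=; apply/esym/map_id_in => r _; rewrite cats0.
congr cons; rewrite IH map_cat -map_comp; congr cat; apply: eq_map => r /=.
by rewrite /conjugate /= rev_cons -!cats1 !catA.
Qed.

Lemma size_refls w : size (reflections w) = size w.
Proof. by elim: w => //= s w IH; rewrite size_map IH. Qed.

Lemma mem_refls w r : r \in reflections w ->
  exists a x b, w = a ++ x :: b /\ r = a ++ x :: rev a.
Proof.
elim: w r => //= s w IH r; rewrite in_cons => /predU1P[->|].
  by exists [::], s, w.
case/mapP => r' /IH[a [x [b [-> ->]]]] ->.
by exists (s :: a), x, b; split => //; rewrite rev_cons rcons_cat.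
Qed.

Lemma refls_alt s t k : reflections (alt s t k) = mkseq (fun i => alt s t i.*2.+1) k.
Proof.
elim: k s t => //= k IH s t; rewrite IH /mkseq /= -[1]addn0 iotaDl -!map_comp.
congr cons; apply: eq_map => i /=.
by have := @alt_rcons _ s t i.*2.+2; rewrite /= odd_double /= => ->.
Qed.

(** Words are compared as group elements through a chosen representative of
their class, which makes membership and uniqueness decidable. *)
Definition class_repr (u : seq S) : seq S := choose (fun v => `[< u ~~ v >]) u.

Lemma canonP u : u ~~ class_repr u.
Proof.
apply/asboolP; apply: (@chooseP _ (fun v => `[< u ~~ v >]) u).
exact/asboolP.
Qed.

Lemma canon_eq u v : class_repr u = class_repr v <-> u ~~ v.
Proof.
split=> [H|H].
  by apply: same_trans (canonP u) _; rewrite H; apply: same_sym; exact: canonP.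
rewrite /class_repr; transitivity (choose (fun x => `[< v ~~ x >]) u).
  by apply: eq_choose => x; apply/asboolP/asboolP; apply: same_trans => //;
     exact: same_sym.
by apply: choose_id; apply/asboolP => //; exact: same_sym.
Qed.

Definition inversions w := map class_repr (reflections w).

(** The reflections of (s t)^m are two copies of the same list, since (s t)^m is
trivial. *)
Lemma parity_relator s t r :
  ~~ odd (count_mem r (map class_repr (reflections (flatten (nseq (m s t) [:: s; t]))))).
Proof.
have -> : flatten (nseq (m s t) [:: s; t]) = alt s t (m s t).*2.
  by rewrite -[_.*2]addn0 alt_cat cats0.
rewrite refls_alt /mkseq -addnn iotaD add0n !map_cat count_cat.
have -> : iota (m s t) (m s t) = map (addn (m s t)) (iota 0 (m s t)).
  by rewrite -iotaDl addn0.
rewrite -!map_comp; set l1 := map _ _; set l2 := map _ _; suff -> : l2 = l1 by rewrite addnn odd_double.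
apply: eq_map => i; apply/canon_eq.
have -> : (m s t + i).*2.+1 = (m s t).*2 + i.*2.+1 by rewrite doubleD addnS.
rewrite alt_cat -[X in _ ~~ X]cat0s; apply: same_cat => //.
exact: same_relator.
Qed.

Lemma conjK a r : conjugate (rev a) (conjugate a r) ~~ r.
Proof.
rewrite /conjugate revK -!catA catA -[X in _ ~~ X]cat0s.
apply: same_cat; first exact: same_revl.
by rewrite -[X in _ ~~ X]cats0; apply: same_cat => //; exact: same_revl.
Qed.

Lemma same_conj a r r' : conjugate a r ~~ r' <-> r ~~ conjugate (rev a) r'.
Proof.
split=> H; first exact: same_trans (same_sym (conjK a r)) (same_ctx _ _ H).
apply: same_trans (same_ctx _ _ H) _.
by have := conjK (rev a) r'; rewrite revK.
Qed.

(** By [parity_relator], inserting a relator changes each multiplicity by an even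
number. Hence the parities only depend on the element. *)
Lemma inversions_invariant u v : u ~~ v ->
  forall r, odd (count_mem r (inversions u)) = odd (count_mem r (inversions v)).
Proof.
elim=> {u v} [_ _ [u v s t]|u|u v _ IH|u v w _ IH1 _ IH2] r; last first.
- by rewrite IH1.
- by rewrite IH.
- by [].
rewrite /inversions !refls_cat !map_cat !count_cat !oddD -!map_comp.
set X := odd (count_mem r (map _ (reflections (flatten _)))).
have -> : X = false; last first.
  rewrite addFb; congr (_ (+) odd _); congr count; apply: eq_map => x /=.
  apply/canon_eq; apply: same_ctx; rewrite /conjugate -[X in _ ~~ X]cat0s.
  apply: same_cat; first exact: same_relator.
  rewrite -[X in _ ~~ X]cats0; apply: same_cat => //.
  exact: (same_rev (same_relator s t)).
apply/negbTE; rewrite /X; have [[x _ <-]|Hno] := pselect (exists2 x, True & class_repr x = r).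
  have := parity_relator s t (class_repr (conjugate (rev u) x)).
  rewrite !count_map; congr (~~ odd _); apply: eq_count => y /=.
  by apply/eqP/eqP => /canon_eq/same_conj H; apply/canon_eq; rewrite ?revK in H.
rewrite (_ : count _ _ = 0) //; apply/eqP; rewrite -leqn0 leqNgt -has_count.
by apply/hasP => -[y /mapP[z _ ->] /eqP E]; apply: Hno; exists (conjugate u z).
Qed.

(** Each reflection of a word with distinct reflections has odd multiplicity, so
occurs in every other word of the same element. *)
Lemma uniq_reduced w : uniq (inversions w) -> reduced m w.
Proof.
move=> Uw w' Hw; rewrite -(size_refls w) -(size_refls w') -(size_map class_repr).
rewrite -[X in _ <= X](size_map class_repr); apply: uniq_leq_size => // r rw.
have := inversions_invariant Hw r; rewrite (count_uniq_mem _ Uw) rw /=.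
by move=> H; rewrite -has_pred1 has_count; case: count H.
Qed.

Lemma inversions_cons s w :
  inversions (s :: w) = class_repr [:: s] :: [seq class_repr (s :: rcons r s) | r <- reflections w].
Proof. by rewrite /inversions /= -map_comp. Qed.

Lemma uniq_inversions_cons s w : uniq (inversions w) ->
  ~~ uniq (inversions (s :: w)) ->
  exists a x b, w = a ++ x :: b /\ s :: a ~~ a ++ [:: x].
Proof.
move=> Uw; rewrite inversions_cons cons_uniq negb_and => /orP[|].
  rewrite negbK => /mapP[r /mem_refls[a [x [b [-> ->]]]]].
  move=> /canon_eq H; exists a, x, b; split=> //.
  have H1 : [:: s] ~~ a ++ x :: rev a.
    apply: (@same_cancel [:: s]); apply: same_trans (same_ss s [::]) _.
    have := same_cat H (same_refl [:: s]).
    move/(same_trans (same_sym (same_ss s [::])))/same_trans; apply.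
    rewrite -cats1 /=; apply: same_cons.
    by rewrite -catA /= -[X in _ ~~ X]cats0; apply: same_cat => //; exact: same_ss.
  exact: (@same_move a a [:: s] [:: x] H1).
have -> : [seq class_repr (s :: rcons r s) | r <- reflections w] =
    map (fun r => class_repr (s :: rcons r s)) (map class_repr (reflections w)).
  rewrite -map_comp; apply: eq_map => r /=; apply/canon_eq; rewrite -!cats1.
  by apply: same_cons; apply: same_cat => //; exact: canonP.
have inj : {in map class_repr (reflections w) &,
    injective (fun r => class_repr (s :: rcons r s))}.
  move=> x y /mapP[x' _ ->] /mapP[y' _ ->] /canon_eq H; apply/canon_eq.
  have {}H : rcons (class_repr x') s ~~ rcons (class_repr y') s by exact: (@same_cancel [:: s]).
  have E z : z ~~ rcons (rcons (class_repr z) s) s.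
    rewrite -!cats1 -catA -{1}[z]cats0; apply: same_cat; first exact: canonP.
    by apply: same_sym; exact: same_ss.
  apply: same_trans (E x') (same_trans _ (same_sym (E y'))).
  by rewrite -![rcons (rcons _ s) s]cats1; apply: same_cat.
by rewrite map_inj_in_uniq // Uw.
Qed.

Lemma reduced_cat a b : reduced m (a ++ b) -> reduced m b.
Proof.
move=> R b' Hb; have := R (a ++ b') (same_cat (same_refl a) Hb).
by rewrite !size_cat leq_add2l.
Qed.

(** When two reflections coincide, both letters can be deleted. *)
Lemma reduced_uniq w : reduced m w -> uniq (inversions w).
Proof.
elim: w => // s w IH R; apply: contrapT => /negP nU.
have Uw := IH (@reduced_cat [:: s] w R).
have [a [x [b [Ew Hx]]]] := uniq_inversions_cons Uw nU.
have /R : s :: w ~~ a ++ b.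
  rewrite Ew -cat_cons; apply: same_trans (same_cat Hx (same_refl (x :: b))) _.
  by rewrite -catA; apply: same_cat => //; exact: same_ss.
by rewrite Ew /= !size_cat /=; lia.
Qed.

Lemma exchange s w : reduced m w -> ~ reduced m (s :: w) ->
  exists a x b, w = a ++ x :: b /\ s :: a ~~ a ++ [:: x].
Proof.
move=> R nR; apply: uniq_inversions_cons (reduced_uniq R) _.
by apply/negP => /uniq_reduced.
Qed.

Lemma same_reduced u v : u ~~ v -> size u = size v -> reduced m u -> reduced m v.
Proof. by move=> H E R w Hw; rewrite -E; apply: R; apply: same_trans Hw. Qed.

Inductive braid_step : relation (seq S) :=
  BraidStep a c s t of s != t :
    braid_step (a ++ alt s t (m s t) ++ c) (a ++ alt t s (m s t) ++ c).
Definition braid_equiv : relation (seq S) := clos_refl_sym_trans _ braid_step.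

Lemma braid_cons s u v : braid_equiv u v -> braid_equiv (s :: u) (s :: v).
Proof.
move=> H; have := @rst_cat braid_step [:: s] [::] _ u v H; rewrite !cats0; apply.
move=> _ _ [a c x y xy]; rewrite !cats0 /= -!cat_cons; exact: BraidStep.
Qed.

Hypothesis m_order : forall s t k, s != t -> 0 < k < m s t ->
  ~ flatten (nseq k [:: s; t]) ~~ [::].

(** If both s and t can be put in front of w, the exchange property produces longer
and longer alternating prefixes: this stops at m s t only, and before that
[m_order] prevents the deleted letter from lying in the alternating prefix. *)
Lemma dihedral_prefix s t w u u' : s != t -> reduced m w ->
  w ~~ s :: u -> w ~~ t :: u' -> (size u).+1 = size w -> (size u').+1 = size w ->
  exists x, w ~~ alt s t (m s t) ++ x /\ m s t + size x = size w.
Proof.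
move=> st Rw Hs Ht Es Et.
have H l : 0 < l <= m s t -> exists (b : bool) x,
   w ~~ (if b then alt s t l else alt t s l) ++ x /\ l + size x = size w.
  elim: l => // -[_ _|l IH /andP[_ lm]]; first by exists true, u.
  have [|b [x [Hx Ex]]] := IH; first by rewrite /= ltnW.
  have {Hs Ht Es Et IH} [a [c [Eac ac Em [v Hc Ev]]]] : exists a c : S,
      [/\ (if b then alt s t l.+1 else alt t s l.+1) = alt a c l.+1,
        a != c, (a, c) = (if b then (s, t) else (t, s))
        & exists2 v : seq S, w ~~ c :: v & (size v).+1 = size w].
    case: (b); [exists s, t|exists t, s]; split => //; last 2 first.
    - by rewrite eq_sym.
    - by exists u.
    - by exists u'.
  have Emm : m a c = m s t by case: (b) Em => -[-> ->] //; rewrite mC.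
  rewrite {}Eac in Hx; move Edef: (alt a c l.+1 ++ x) Hx => y Hx.
  have Ey : size y = size w by rewrite -Edef size_cat size_alt.
  have Ry : reduced m y by exact: same_reduced Rw.
  have nR : ~ reduced m (c :: y).
    move=> R; have /R : c :: y ~~ v.
      apply: same_trans (same_ss c v); apply: same_cons.
      exact: same_trans (same_sym Hx) Hc.
    by rewrite /= Ey -Ev; lia.
  have [p [z [q [Eq Hz]]]] := exchange Ry nR.
  have Hy : y ~~ c :: (p ++ q).
    apply: same_sym; rewrite -cat_cons; apply: same_trans (same_cat Hz (same_refl q)) _.
    by rewrite -catA Eq.
  have := Eq; rewrite -Edef => Epq.
  have [lp|lp] := ltnP (size p) l.+1.
    have Ep : p = alt a c (size p).
      move: Epq => /(congr1 (take (size p))); rewrite take_cat size_alt lp take_size_cat //.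
      move=> <-; have := @rev_alt_cat _ a c (size p) (l.+1 - size p).
      by rewrite subnKC 1?ltnW // => ->; rewrite take_size_cat ?size_alt.
    have Ez : z = if odd (size p) then c else a.
      move: Epq => /(congr1 (fun s => nth a s (size p))).
      rewrite nth_cat size_alt lp nth_cat ltnn subnn => H; rewrite -[z]/(nth a (z :: q) 0) -{}H.
      have := @rev_alt_cat _ a c (size p).+1 (l.+1 - (size p).+1).
      rewrite subnKC // [alt a c (size p).+1]alt_rcons => ->; rewrite cat_rcons nth_cat size_alt ltnn subnn.
      by [].
    case: (@m_order a c (size p).+1 ac); first by rewrite Emm /=; lia.
    rewrite -alt_revC; apply: same_trans (same_revr (alt c a (size p).+1)).
    apply: same_cat => //; rewrite alt_rcons -cats1 -Ez -Ep; apply: same_sym.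
    by rewrite /= -Ep.
  have Ep : p = alt a c l.+1 ++ drop l.+1 p.
    have := congr1 (take l.+1) Epq; rewrite take_size_cat ?size_alt // take_cat.
    rewrite ltn_neqAle lp andbT; case: eqVneq => [E|_ ->]; last by rewrite cat_take_drop.
    by rewrite E subnn take0 cats0 drop_size cats0.
  exists (~~ b), (drop l.+1 p ++ q); split.
    apply: same_trans Hx (same_trans Hy _).
    rewrite {1}Ep -catA; have -> : (if ~~ b then alt s t l.+2 else alt t s l.+2) = alt c a l.+2.
      by case: (b) Em => -[-> ->].
    by [].
  have := congr1 size Eq; rewrite Ey !size_cat size_drop /= => ->.
  by have := congr1 size Ep; rewrite size_cat size_alt size_drop; lia.
have [|[] [x [Hx Ex]]] := H (m s t); first by rewrite m_gt0 leqnn.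
  by exists x.
exists x; split=> //; apply: same_trans Hx _; apply: same_cat => //.
by apply: same_sym; exact: same_alt.
Qed.

(** Induction on the length. When w and w' start with distinct letters s and t, they
are compared through the two words that start with the alternating
words of [dihedral_prefix]. *)
Lemma matsumoto w w' : reduced m w -> reduced m w' -> w ~~ w' -> braid_equiv w w'.
Proof.
move En : (size w) => k; elim: k w w' En => [|k IH] w w' Ew Rw Rw' Hw.
  have /size0nil-> : size w' = 0.
    by apply/eqP; rewrite -leqn0 -Ew; apply: Rw'; exact: same_sym.
  by rewrite (size0nil Ew); exact: rst_refl.
have Ew' : size w' = k.+1.
  by apply/eqP; rewrite -Ew eqn_leq Rw //= Rw' //; exact: same_sym.
have same_head s u u' : size u = k -> reduced m (s :: u) -> reduced m (s :: u') ->
    s :: u ~~ s :: u' -> braid_equiv (s :: u) (s :: u').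
  move=> Eu R R' H; apply: braid_cons; apply: IH => //.
  - exact: (@reduced_cat [:: s]).
  - exact: (@reduced_cat [:: s]).
  - exact: (@same_cancel [:: s]).
case: w Ew Rw Hw => // s u [Eu] Rw Hw; case: w' Ew' Rw' Hw => // t u' [Eu'] Rw' Hw.
have [E|st] := eqVneq s t; first by subst t; exact: same_head.
have [x [Hx Ex]] := dihedral_prefix st Rw (same_refl _) Hw (erefl _) (etrans (congr1 _ Eu')
  (congr1 _ (esym Eu))).
have E1 := size_alt s t (m s t); have E2 := size_alt t s (m s t).
have Hm := same_alt s t.
have Hb : braid_equiv (alt s t (m s t) ++ x) (alt t s (m s t) ++ x).
  exact/rst_step/(BraidStep [::] x st).
have Hx2 : t :: u' ~~ alt t s (m s t) ++ x.
  apply: same_trans (same_sym Hw) (same_trans Hx _); exact: same_cat.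
have R1 := same_reduced Hx _ Rw; have R2 := same_reduced Hx2 _ Rw'.
rewrite size_cat E1 Ex in R1; rewrite size_cat E2 Ex /= Eu Eu' in R2.
move: Hx Hx2 Hb Ex {R1 R2 E1 E2 Hm}(R1 erefl) (R2 erefl); rewrite /= Eu.
case: (m s t) (m_gt0 s t) => // l _ /= Hx Hx2 Hb Ex R1 R2.
apply: rst_trans (rst_trans _ _ _ _ _ Hb _).
  exact: same_head.
by apply: rst_sym; apply: same_head.
Qed.

(** Labels at most 2 are left out of the second condition because the corresponding move is
a commutation, already accounted for by v'. *)
Definition braid_free v := forall v', v === v' -> forall a c s t,
  v' <> a ++ [:: s; s] ++ c /\ (2 < m s t -> v' <> a ++ alt s t (m s t) ++ c).

Hypothesis m_neq : forall s t, s != t -> 1 < m s t.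

Lemma commutation_same u v : u === v -> u ~~ v.
Proof.
elim=> {u v} [_ _ [u v s t H]|u|u v _|u v w _ + _].
- by apply: same_ctx; have := same_alt s t; rewrite H.
- exact: rst_refl.
- exact: rst_sym.
- exact: rst_trans.
Qed.

Lemma commutation_size u v : u === v -> size u = size v.
Proof.
elim=> {u v} [_ _ [u v s t H]|u|u v _|u v w _ + _] //; last exact: etrans.
by rewrite !size_cat.
Qed.

Lemma commutation_cat a b u v : u === v -> a ++ u ++ b === a ++ v ++ b.
Proof.
apply: rst_cat => _ _ [x y s t st]; rewrite -!catA (catA a) [in X in _ _ X]catA.
exact: CommutationStep.
Qed.

(** Two letters that do not commute keep their relative order. *)
Lemma commutation_filter s t u v : s != t -> m s t != 2 -> u === v ->
  filter (pred2 s t) u = filter (pred2 s t) v.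
Proof.
move=> st mst; elim=> {u v} [_ _ [u v x y H]|u|u v _|u v w _ -> _ ->] //.
rewrite !filter_cat /=; congr (_ ++ (_ ++ _)).
case: (eqVneq x s) => [?|xs] /=; case: (eqVneq y s) => [?|ys] /=;
  case: (eqVneq x t) => [?|xt] /=; case: (eqVneq y t) => [?|yt] //=; subst => //.
all: try by rewrite ?eqxx in st.
all: try by rewrite H in mst.
by rewrite mC H in mst.
Qed.

Lemma braid_free_cons s u : braid_free (s :: u) -> braid_free u.
Proof.
move=> H v Hv a c x y.
have Hsv : s :: u === s :: v.
  by have := commutation_cat [:: s] [::] Hv; rewrite !cats0.
have [H1 H2] := H _ Hsv (s :: a) c x y.
by split=> [E|xy E]; [apply: H1|apply: (H2 xy)]; rewrite E.
Qed.

Lemma braid_free_commutation u v : braid_free u -> u === v -> braid_free v.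
Proof. by move=> B H v' Hv; apply: B; apply: rst_trans Hv. Qed.

Lemma braid_free_step u v : braid_free u -> braid_step u v \/ braid_step v u -> u === v.
Proof.
move=> Bu H.
have {H} [a [c [s [t [st Eu ->]]]]] : exists a c s t,
   [/\ s != t, u = a ++ alt s t (m s t) ++ c & v = a ++ alt t s (m s t) ++ c].
  case: H Bu => -[a c s t st] Bu; first by exists a, c, s, t.
  by exists a, c, t, s; rewrite eq_sym mC.
have [E|ne] := eqVneq (m s t) 2.
  by rewrite Eu E /=; apply: rst_step; exact: CommutationStep.
have [_ H] := Bu u (rst_refl _ _ _) a c s t; case: (H _ Eu).
by rewrite ltn_neqAle eq_sym ne m_neq.
Qed.

(** The only braid moves available on a braid-free word are commutations, which
preserve braid-freeness. *)
Lemma braid_free_braid u v : braid_equiv u v -> braid_free u \/ braid_free v -> u === v.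
Proof.
elim=> {u v} [u v H|u|u v _ IH|u v w _ IH1 _ IH2] B.
- case: B => B; first by apply: braid_free_step; [|left].
  by apply: rst_sym; apply: (braid_free_step B); right.
- exact: rst_refl.
- by apply: rst_sym; apply: IH; case: B; [right|left].
- case: B => B.
    have H := IH1 (or_introl B).
    apply: (rst_trans _ _ _ _ _ H); apply: IH2; left.
    exact: braid_free_commutation H.
  have H := IH2 (or_intror B).
  apply: (rst_trans _ _ _ _ _ _ H); apply: IH1; right.
  by apply: (braid_free_commutation B); exact: rst_sym.
Qed.

(** For a shortest non-reduced suffix s u, the exchange property gives a reduced word of
u that starts with s. By Matsumoto's theorem it is reached from u by
commutations only, and the square s s appears. *)
Lemma braid_free_reduced v : braid_free v -> reduced m v.
Proof.
elim: v => [_ w _ //|s u IH B].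
have Bu := braid_free_cons B; have Ru := IH Bu.
apply: contrapT => nR; have [a [x [b [Eu Hx]]]] := exchange Ru nR.
have Hu : u ~~ s :: a ++ b.
  rewrite Eu -cat_cons; apply: same_sym.
  apply: same_trans (same_cat Hx (same_refl b)) _.
  by rewrite -catA.
have Hsz : size u = size (s :: a ++ b) by rewrite Eu /= !size_cat /= addnS.
have Hc : u === s :: a ++ b.
  apply: braid_free_braid (or_introl Bu); apply: matsumoto => //.
  exact: same_reduced Ru.
have /B/(_ [::] (a ++ b) s s)[] : s :: u === s :: s :: a ++ b.
  by have := commutation_cat [:: s] [::] Hc; rewrite !cats0.
by [].
Qed.

Lemma stembridge v : braid_free v <-> reduced m v /\ fully_commutative m v.
Proof.
split=> [B|[R FC] v' Hv a c s t].
  have R := braid_free_reduced B; split=> //.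
  have H w : v ~~ w -> reduced m w -> v === w.
    move=> Hw Rw; apply: braid_free_braid (or_introl B); exact: matsumoto.
  move=> w1 w2 H1 H2 R1 R2.
  exact: (rst_trans _ _ _ _ _ (rst_sym _ _ _ _ (H _ H1 R1)) (H _ H2 R2)).
have Hs := commutation_same Hv; have Ev := commutation_size Hv.
have R' := same_reduced Hs Ev R; split=> [E|mst E].
  have /R' : v' ~~ a ++ c.
    by rewrite E; apply: same_cat => //; exact: same_ss.
  by rewrite E !size_cat /= addnS; lia.
have Hb : v' ~~ a ++ alt t s (m s t) ++ c.
  by rewrite E; apply: same_ctx; exact: same_alt.
have Eb : size v' = size (a ++ alt t s (m s t) ++ c).
  by rewrite E !size_cat !size_alt.
have := FC _ _ Hs (same_trans Hs Hb) R' (same_reduced Hb Eb R').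
have st : s != t by apply: contraTneq mst => ->; rewrite m1.
move=> /(commutation_filter st); rewrite (gtn_eqF mst) => /(_ isT).
rewrite E !filter_cat => /eqP; rewrite eqseq_cat // eqxx /= => /eqP.
case: (m s t) mst => //= k _; rewrite !eqxx orbT /= => -[Est].
by rewrite Est eqxx in st.
Qed.
End CoxeterWords.

(** * The order of a product of two generators *)

(** The generators act on functions S -> int by the numbers game of the generalized
Cartan matrix with entries - c s t. *)
Section NumbersGame.
Import GRing.Theory.
Variables (S : finType) (m : S -> S -> nat) (c : S -> S -> int).
Hypothesis m1 : forall s, m s s = 1.
Hypothesis css : forall s, c s s = (-2)%R.
Hypothesis cst : forall s t, s != t ->
  [\/ [/\ m s t = 2, c s t = 0 & c t s = 0]%R,
      [/\ m s t = 3, c s t = 1 & c t s = 1]%R,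
      [/\ m s t = 4, c s t = 1 & c t s = 2]%R |
      [/\ m s t = 4, c s t = 2 & c t s = 1]%R].

Definition fire (s : S) (f : S -> int) : S -> int := fun x => (f x + c s x * f s)%R.
Definition fire_word (w : seq S) (f : S -> int) := foldr fire f w.

Lemma fire_word_cat u v f : fire_word (u ++ v) f = fire_word u (fire_word v f).
Proof. by rewrite /fire_word foldr_cat. Qed.

Lemma fire_ext s f g : f =1 g -> fire s f =1 fire s g.
Proof. by move=> H x; rewrite /fire !H. Qed.

Lemma fire_word_ext w f g : f =1 g -> fire_word w f =1 fire_word w g.
Proof. by move=> H; elim: w => //= s w; exact: fire_ext. Qed.

Lemma fire_relator s t f : fire_word (flatten (nseq (m s t) [:: s; t])) f =1 f.
Proof.
move=> x; have [<-|st] := eqVneq s t.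
  by rewrite m1 /= /fire !css; ring.
have Hs := css s; have Ht := css t.
by case: (cst st) => -[-> Est Ets] /=; rewrite /fire ?Est ?Ets ?Hs ?Ht; ring.
Qed.

Lemma fire_word_same u v : same_element m u v -> forall f, fire_word u f =1 fire_word v f.
Proof.
elim=> {u v} [_ _ [u v s t]|u|u v _ IH|u v w _ IH1 _ IH2] f x.
- by rewrite !fire_word_cat; apply: fire_word_ext => y; exact: fire_relator.
- by [].
- by rewrite IH.
- by rewrite IH1 IH2.
Qed.

Lemma coxeter_order s t k : s != t -> 0 < k < m s t ->
  ~ same_element m (flatten (nseq k [:: s; t])) [::].
Proof.
(* the coordinates s and t of the image of the indicator of s already separate the powers *)
move=> st k_bd /fire_word_same/(_ (fun x => (x == s)%:R)%R) H.
have := H s; have {H} := H t; have Hs := css s; have Ht := css t.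
case: (cst st) k_bd => -[-> Est Ets]; case: k => // -[|[|[|k]]] //= _;
  by rewrite /fire ?Est ?Ets ?Hs ?Ht eqxx (eq_sym t s) (negPf st) /=; lia.
Qed.
End NumbersGame.

(** * Decorated words and their gaps *)

Lemma filter_cons_split (T : Type) (p : pred T) (b s : seq T) x :
  filter p b = x :: s -> exists b1 b2,
    [/\ b = b1 ++ x :: b2, filter p b1 = [::], filter p b2 = s & p x].
Proof.
elim: b => //= y b IH; case: ifP => py; first by case=> <- <-; exists [::], b.
by move=> /IH[b1 [b2 [-> E1 E2 px]]]; exists (y :: b1), b2; rewrite /= py E1.
Qed.

(** A position between 0 and n with a decoration, which is meaningful at the ends. *)
Notation letter := (nat * end_split)%type.

(** A letter [(i, c)] stands for one generator of position i, or for both copies of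
an end when c is [Both]. *)
Definition weight1 (x : letter) : nat := if x.2 is Both then 2 else 1.
Definition avoids (i : nat) (b : seq letter) := all (fun x => x.1 != i) b.
Definition count_at (i : nat) (b : seq letter) := count (fun x => x.1 == i) b.
Definition weight (i : nat) (b : seq letter) := sumn [seq weight1 x | x <- b & x.1 == i].

Lemma wt_gt0 x : 0 < weight1 x. Proof. by rewrite /weight1; case: x.2. Qed.

Lemma weight_cat i a b : weight i (a ++ b) = weight i a + weight i b.
Proof. by rewrite /weight filter_cat map_cat sumn_cat. Qed.
Lemma weight_cons i x b : weight i (x :: b) = (x.1 == i) * weight1 x + weight i b.
Proof. by rewrite /weight /=; case: eqP => //= _; rewrite mul1n. Qed.
Lemma weight_rev i b : weight i (rev b) = weight i b.
Proof. by rewrite /weight filter_rev map_rev sumn_rev. Qed.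
Lemma weight_nil i : weight i [::] = 0. Proof. by []. Qed.
Lemma count_at_cat i a b : count_at i (a ++ b) = count_at i a + count_at i b.
Proof. exact: count_cat. Qed.
Lemma count_at_cons i x b : count_at i (x :: b) = (x.1 == i) + count_at i b.
Proof. by []. Qed.
Lemma count_at_rev i b : count_at i (rev b) = count_at i b.
Proof. exact: count_rev. Qed.
Lemma avoids_cat i a b : avoids i (a ++ b) = avoids i a && avoids i b.
Proof. exact: all_cat. Qed.
Lemma avoids_cons i x b : avoids i (x :: b) = (x.1 != i) && avoids i b.
Proof. by []. Qed.
Lemma avoids_rev i b : avoids i (rev b) = avoids i b.
Proof. exact: all_rev. Qed.

Lemma count_at_leW i b : count_at i b <= weight i b.
Proof.
elim: b => // x b IH; rewrite weight_cons count_at_cons; apply: leq_add => //.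
by have := wt_gt0 x; case: eqP => //= _; rewrite mul1n.
Qed.
Lemma avoids_weight i b : avoids i b -> weight i b = 0.
Proof.
by elim: b => //= x b IH /andP[xi /IH E]; rewrite weight_cons E (negPf xi).
Qed.
Lemma avoids_count_at i b : avoids i b = (count_at i b == 0).
Proof. by elim: b => //= x b ->; case: eqP. Qed.
Lemma avoids_mem i b : avoids i b = (i \notin map fst b).
Proof. by elim: b => //= x b ->; rewrite inE negb_or eq_sym. Qed.

Lemma has_split i b : ~~ avoids i b -> exists e z f, [/\ b = e ++ z :: f, z.1 = i & avoids i e].
Proof.
elim: b => //= x b IH; case: (eqVneq x.1 i) => [E _|ne /IH[e [z [f [-> Ez Ne]]]]].
  by exists [::], x, b.
by exists (x :: e), z, f; rewrite avoids_cons ne.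
Qed.

Definition low i (b : seq letter) := filter (fun x : letter => x.1 < i) b.

(** The word i ... 1 0 1 ... i with a double letter 0. *)
Fixpoint LPeak (i : nat) : seq letter :=
  if i is i'.+1 then (i, One false) :: rcons (LPeak i') (i, One false)
  else [:: (0, Both)].

Lemma rev_LPeak i : rev (LPeak i) = LPeak i.
Proof. by elim: i => //= i IH; rewrite rev_cons rev_rcons IH. Qed.

Lemma filter_nil_avoids i b : filter (fun x : letter => x.1 == i) b = [::] -> avoids i b.
Proof. by elim: b => //= x b IH; case: eqP => //= _ /IH. Qed.

Lemma low_nil i b : low i b = [::] -> all (fun x => i <= x.1) b.
Proof. by elim: b => //= x b IH; case: ltnP => //= H /IH ->. Qed.

Lemma all_low_nil i b : all (fun x => i <= x.1) b -> low i b = [::].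
Proof. by elim: b => //= x b IH; rewrite ltnNge => /andP[-> /IH]. Qed.

Lemma all_avoids i j b : all (fun x : letter => i <= x.1) b -> j < i -> avoids j b.
Proof. by move=> H ji; apply: sub_all H => x /=; lia. Qed.

Lemma low_cat i a b : low i (a ++ b) = low i a ++ low i b.
Proof. exact: filter_cat. Qed.

Lemma low_S i b : avoids i b -> low i.+1 b = low i b.
Proof.
elim: b => //= x b IH /andP[xi /IH ->]; rewrite ltnS leq_eqVlt (negPf xi) /=.
by [].
Qed.

Lemma avoids_low i k b : i < k -> avoids i (low k b) = avoids i b.
Proof.
move=> ik; elim: b => //= x b IH; case: ltnP => /= [_|kx]; first by rewrite IH.
by rewrite IH (_ : x.1 != i) //; lia.
Qed.

Lemma avoids_LPeak j k : j < k -> avoids k (LPeak j).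
Proof. by elim: j => [|j IH] jk /=; rewrite ?andbT -?cats1 ?avoids_cat /= ?IH /=; lia. Qed.

Definition up a m : seq letter := [seq (k, One false) | k <- iota a m].

Lemma up_cat a m1 m2 : up a (m1 + m2) = up a m1 ++ up (a + m1) m2.
Proof. by rewrite /up iotaD map_cat. Qed.

Lemma upS a m : up a m.+1 = rcons (up a m) (a + m, One false).
Proof. by rewrite -addn1 up_cat cats1. Qed.

Lemma weight_up i a m : weight i (up a m) = (a <= i < a + m).
Proof.
elim: m => [|m IH]; first by rewrite /weight /=; lia.
rewrite upS -cats1 weight_cat IH weight_cons /weight1 /= muln1 weight_nil.
case: (ltngtP i (a + m)) => ?; lia.
Qed.

Lemma count_at_up i a m : count_at i (up a m) = (a <= i < a + m).
Proof.
elim: m => [|m IH]; first by rewrite /count_at /=; lia.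
rewrite upS -cats1 count_at_cat IH count_at_cons /=; case: (ltngtP i (a + m)) => ?; lia.
Qed.

Lemma LPeak_up i : LPeak i = rev (up 1 i) ++ (0, Both) :: up 1 i.
Proof.
elim: i => // i IH; rewrite upS rev_rcons add1n.
have -> : LPeak i.+1 = (i.+1, One false) :: rcons (LPeak i) (i.+1, One false) by [].
by rewrite IH rcons_cat.
Qed.

Lemma count_at_LPeak i j : count_at i (LPeak j) = if i == 0 then 1 else (i <= j).*2.
Proof.
rewrite LPeak_up count_at_cat count_at_rev count_at_cons count_at_up /=.
by case: i => [|i] /=; lia.
Qed.

Lemma count_at_low i k d : i < k -> count_at i (low k d) = count_at i d.
Proof.
move=> ik; elim: d => // x d IH; rewrite count_at_cons -IH /low /= -/(low k d).
by case: ltnP => [|kx]; rewrite ?count_at_cons // gtn_eqF // (leq_trans ik).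
Qed.

Lemma LPeak_gap j A x B y C k : LPeak j = A ++ x :: B ++ y :: C -> 0 < k -> x.1 = k ->
  y.1 = k -> avoids k B -> B = LPeak k.-1.
Proof.
elim: j A C => [|j IH] A C; first by case: A => [|? []] //= [<-] /=; lia.
have -> : LPeak j.+1 = (j.+1, One false) :: rcons (LPeak j) (j.+1, One false) by [].
case: A => [|a0 A].
  move=> /= -[<-] E k0 <- /= yk NB.
  case/lastP: C E => [|C z]; first by rewrite cats1 => /rcons_inj[->].
  rewrite -rcons_cons -rcons_cat => /rcons_inj[E _].
  by have := avoids_LPeak (ltnSn j); rewrite E avoids_cat avoids_cons yk eqxx andbF.
move=> -[_ E] k0 xk yk NB; case/lastP: C E => [|C z].
  rewrite cats1 -rcons_cons -rcons_cat => /rcons_inj[E Ey].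
  by have := avoids_LPeak (ltnSn j); rewrite E avoids_cat avoids_cons xk -yk -Ey eqxx andbF.
rewrite -rcons_cons -rcons_cat -rcons_cons -rcons_cat => /rcons_inj[E _].
exact: IH E k0 xk yk NB.
Qed.

Lemma all_LPeak j k : j < k -> all (fun z => z.1 < k) (LPeak j).
Proof. by elim: j => [|j IH] jk /=; rewrite ?andbT // -cats1 all_cat IH /=; lia. Qed.

Lemma not_sorted (T : Type) (r : rel T) s : ~~ sorted r s ->
  exists a x y c, s = a ++ x :: y :: c /\ ~~ r x y.
Proof.
elim: s => // x [|y s] IH //=; case: (boolP (r x y)) => [_ /IH[a [u [v [c [-> ?]]]]]|ne _].
  by exists (x :: a), u, v, c.
by exists [::], x, y, s.
Qed.

Lemma filter_cat_split (T : Type) (p : pred T) (b s t : seq T) :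
  filter p b = s ++ t -> exists b1 b2,
    [/\ b = b1 ++ b2, filter p b1 = s & filter p b2 = t].
Proof.
elim: s b => [|x s IH] b /=; first by exists [::], b.
move=> H; have [b1 [b2 [-> E1 /IH[b3 [b4 [-> E3 E4]]] px]]] := filter_cons_split H.
exists (b1 ++ x :: b3), b4; split=> //; first by rewrite -catA.
by rewrite filter_cat E1 /= px E3.
Qed.

(** All the gaps of a peak are smaller peaks. *)
Lemma isolated_left_gap j d a x b y c k : low j.+1 d = LPeak j -> d = a ++ x :: b ++ y :: c ->
  0 < k <= j -> x.1 = k -> y.1 = k -> avoids k b -> low k b = LPeak k.-1.
Proof.
move=> L E /andP[k0 kj] xk yk Nb.
have E' : LPeak j = low j.+1 a ++ x :: low j.+1 b ++ y :: low j.+1 c.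
  by rewrite -L E low_cat /= xk ltnS kj low_cat /= yk ltnS kj.
have := LPeak_gap E' k0 xk yk; rewrite avoids_low // => /(_ Nb) H.
have -> : low k b = low k (low j.+1 b).
  by rewrite /low -filter_predI; apply: eq_filter => z /=; lia.
by rewrite H; apply/all_filterP/all_LPeak; lia.
Qed.

Section Stable.
Variable n : nat.
Hypothesis n2 : 2 <= n.

(** Interior letters get the conventional decoration [One false], so that equal
positions mean equal letters. *)
Definition letter_ok (x : letter) : bool :=
  (x.1 <= n) && ((0 < x.1 < n) ==> (if x.2 is One false then true else false)).

Lemma letter_okP x : letter_ok x -> 0 < x.1 < n -> x = (x.1, One false).
Proof. by case: x => i [[]|] //= /andP[/= _ /implyP H] /H. Qed.

(** What braid-freeness requires of two consecutive letters x and y of the same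
position separated by b. At an end a single neighbour is enough when x and y are
distinct copies of this end, for then no generator is repeated across b. *)
Definition gap_ok (x : letter) (b : seq letter) (y : letter) : Prop :=
  if 0 < x.1 < n then is_true (2 <= weight x.1.-1 b + weight x.1.+1 b)
  else let c := count_at (if x.1 == 0 then 1 else n.-1) b in
    0 < c /\ (c = 1 -> exists z, x.2 = One z /\ y.2 = One (~~ z)).

Definition stable (d : seq letter) : Prop := all letter_ok d /\
  forall a x b y c, d = a ++ x :: b ++ y :: c -> y.1 = x.1 -> avoids x.1 b ->
    gap_ok x b y.

Lemma stable_catr a d : stable (a ++ d) -> stable d.
Proof.
rewrite /stable all_cat => -[/andP[_ Od] H]; split=> // a' x b y c E; apply: H.
by rewrite E !catA.
Qed.

Lemma stable_catl a d : stable (a ++ d) -> stable a.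
Proof.
rewrite /stable all_cat => -[/andP[Oa _] H]; split=> // a' x b y c E.
apply: (H a' x b y (c ++ d)).
by rewrite E -!catA /= -catA.
Qed.

Lemma stable_rev d : stable d -> stable (rev d).
Proof.
move=> [Od H]; split; first by rewrite all_rev.
move=> a x b y c /(congr1 rev); rewrite revK rev_cat rev_cons rev_cat rev_cons.
rewrite -!cats1 -!catA /= => E xy Nb.
have := H _ _ _ _ _ E (esym xy); rewrite avoids_rev xy => /(_ Nb).
rewrite /gap_ok xy !weight_rev count_at_rev; case: ifP => // _ [c0 c1]; split=> // /c1[z [-> ->]].
by exists (~~ z); rewrite negbK.
Qed.

Definition flipx (x : letter) : letter := (n - x.1, x.2).
Definition flip (d : seq letter) := map flipx d.

Lemma flip_cons x d : flip (x :: d) = flipx x :: flip d. Proof. by []. Qed.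
Lemma flip_cat a d : flip (a ++ d) = flip a ++ flip d. Proof. exact: map_cat. Qed.

Lemma flipxK x : letter_ok x -> flipx (flipx x) = x.
Proof. by case: x => i c /andP[/= H _]; rewrite /flipx /= subKn. Qed.

Lemma flipK d : all letter_ok d -> flip (flip d) = d.
Proof. by elim: d => //= x d IH /andP[/flipxK-> /IH ->]. Qed.

Lemma letter_ok_flip x : letter_ok x -> letter_ok (flipx x).
Proof.
rewrite /letter_ok /= leq_subr /= => /andP[xn /implyP H]; apply/implyP => H1.
by apply: H; lia.
Qed.

Lemma ok_flip d : all letter_ok d -> all letter_ok (flip d).
Proof. by elim: d => //= x d IH /andP[/letter_ok_flip-> /IH]. Qed.

Lemma count_at_flip i b : all letter_ok b -> i <= n -> count_at i (flip b) = count_at (n - i) b.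
Proof.
move=> Ob ni; elim: b Ob => // x b IH /andP[/andP[xn _] /IH E].
rewrite flip_cons !count_at_cons E /=; congr addn; congr nat_of_bool; lia.
Qed.

Lemma weight_flip i b : all letter_ok b -> i <= n -> weight i (flip b) = weight (n - i) b.
Proof.
move=> Ob ni; elim: b Ob => // x b IH /andP[/andP[xn _] /IH E].
rewrite flip_cons !weight_cons E /=; congr addn; congr muln; lia.
Qed.

Lemma avoids_flip i b : all letter_ok b -> i <= n -> avoids i (flip b) = avoids (n - i) b.
Proof. by move=> Ob ni; rewrite !avoids_count_at count_at_flip. Qed.

Lemma gap_ok_flip x b y : letter_ok x -> all letter_ok b -> y.1 = x.1 ->
  gap_ok x b y -> gap_ok (flipx x) (flip b) (flipx y).
Proof.
move=> Ox Ob xy; have xn : x.1 <= n by case/andP: Ox.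
rewrite /gap_ok /=.
case: (posnP x.1) => [->|x0] /=.
  have -> : (n - 0 == 0) = false by lia.
  rewrite subn0 ltnn andbF count_at_flip ?leq_pred //.
  by have -> : n - n.-1 = 1 by lia.
case: (ltnP x.1 n) => [xln|nx].
  have -> : 0 < n - x.1 < n by lia.
  rewrite !weight_flip //; last 2 first. lia. lia.
  have -> : n - (n - x.1).-1 = x.1.+1 by lia.
  have -> : n - (n - x.1).+1 = x.1.-1 by lia.
  by rewrite addnC.
have -> : x.1 = n by lia.
by rewrite subnn /= count_at_flip ?subn1 // ltnW.
Qed.

Lemma stable_flip d : stable d -> stable (flip d).
Proof.
move=> [Od H]; split; first exact: ok_flip.
move=> a x b y c E xy Nb.
have Ofd := ok_flip Od.
have E' := congr1 flip E; rewrite (flipK Od) !(flip_cat, flip_cons) in E'.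
have := Ofd; rewrite E all_cat /= all_cat /= => /and5P[_ Ox Ob Oy _].
have xn : x.1 <= n by case/andP: Ox.
have := H _ _ _ _ _ E' _ _; rewrite /= xy => /(_ erefl).
rewrite avoids_flip ?leq_subr // subKn // => /(_ Nb) G.
have := gap_ok_flip (letter_ok_flip Ox) (ok_flip Ob) _ G; rewrite /= xy => /(_ erefl).
by rewrite !flipxK // flipK.
Qed.

Lemma weight_int i b : all letter_ok b -> 0 < i < n -> weight i b = count_at i b.
Proof.
move=> + Hi; elim: b => // x b IH /andP[xo /IH E]; rewrite weight_cons count_at_cons E.
case: eqP => //= xi; rewrite (letter_okP xo) ?xi //.
Qed.

Lemma gap0 a x b y c : stable (a ++ x :: b ++ y :: c) -> x.1 = 0 -> y.1 = 0 ->
  avoids 0 b -> 0 < count_at 1 b /\ (count_at 1 b = 1 -> exists z, x.2 = One z /\ y.2 = One (~~ z)).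
Proof. by move=> [_ /(_ _ _ _ _ _ erefl)]; rewrite /gap_ok => + x0 y0; rewrite x0 y0 /=; apply. Qed.

Lemma gapi a x b y c i : stable (a ++ x :: b ++ y :: c) -> 0 < i < n ->
  x.1 = i -> y.1 = i -> avoids i b -> 2 <= weight i.-1 b + weight i.+1 b.
Proof.
by move=> [_ /(_ _ _ _ _ _ erefl)]; rewrite /gap_ok => + Hi xi yi; rewrite xi yi Hi; apply.
Qed.

Lemma all_ltS i (c : seq letter) :
  avoids i c -> all (fun z => i <= z.1) c -> all (fun z => i < z.1) c.
Proof.
by elim: c => //= x c IH /andP[xi /IH H] /andP[ix /H ->]; rewrite ltn_neqAle eq_sym xi ix.
Qed.

Lemma stable_ok d : stable d -> all letter_ok d. Proof. by case. Qed.

(** Induction on j. For j = 0, a letter 0 in c would close a gap of the double letter 0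
with a single letter 1. Otherwise the first letter j in c would close a gap
whose only neighbour is y, the smaller positions being excluded by induction
applied to the inner peak; without letters j, the induction also covers the
rest of c. *)
Lemma above_after_peak j x b y c : j.+1 < n -> stable (x :: b ++ y :: c) ->
  x.1 = j.+1 -> y.1 = j.+1 -> avoids j.+1 b -> low j.+1 b = LPeak j -> avoids j.+1 c ->
  all (fun z => j.+1 < z.1) c.
Proof.
elim: j x b y c => [|j IH] x b y c jn St xj yj Nb Eb Nc; apply: all_ltS => //.
  apply: all_ltS; last by elim: (c).
  apply/contraT => /has_split[e [z [f [Ec z0 Ne]]]].
  have [b1 [b2 [Eb' /low_nil N1 /low_nil N2 _]]] := filter_cons_split Eb.
  have St' : stable ((x :: b1) ++ (0, Both) :: (b2 ++ y :: e) ++ z :: f).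
    by move: St; rewrite Eb' Ec /= -?catA /= -?catA /= -?catA.
  have [] := gap0 St' erefl z0.
    by rewrite avoids_cat avoids_cons Ne yj (all_avoids N2).
  move: Nb Nc; rewrite Eb' Ec !avoids_cat !avoids_cons => /and3P[_ _ N1b] /andP[N1e _].
  rewrite count_at_cat count_at_cons yj eqxx.
  move: N1b N1e; rewrite !avoids_count_at => /eqP-> /eqP->.
  by move=> _ /(_ erefl)[? []].
have [b1 [b2 [Eb' /low_nil N1 E2 _]]] := filter_cons_split Eb.
have [b3 [b4 [Eb2 E3 E4 _]]] : exists b3 b4, [/\ b2 = b3 ++ (j.+1, One false) :: b4,
     low j.+2 b3 = LPeak j, low j.+2 b4 = [::] & true].
  have E2' : filter (fun z : letter => z.1 < j.+2) (rev b2) = (j.+1, One false) :: LPeak j.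
    by rewrite filter_rev E2 rev_rcons rev_LPeak.
  have [f1 [f2 [Ef F1 F2 _]]] := filter_cons_split E2'.
  exists (rev f2), (rev f1); split=> //; last 2 first.
  - by rewrite /low filter_rev F2 rev_LPeak.
  - by rewrite /low filter_rev F1.
  - by rewrite -[b2]revK Ef rev_cat rev_cons cat_rcons.
have N4 := low_nil E4.

have N3 : avoids j.+1 b3 by rewrite -(@avoids_low _ j.+2) // E3 avoids_LPeak.
have N3' : low j.+1 b3 = LPeak j by rewrite -low_S.
have Eb3 : b = b1 ++ (j.+1, One false) :: b3 ++ (j.+1, One false) :: b4.
  by rewrite Eb' Eb2.
have Nb4 : avoids j.+2 b4 by move: Nb; rewrite Eb3 !avoids_cat !avoids_cons avoids_cat => /and5P[_ _ _ _ ].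
have [N1c|/has_split[e [z [f [Ec z0 Ne]]]]] := boolP (avoids j.+1 c).
  have St' : stable ((j.+1, One false) :: b3 ++ (j.+1, One false) :: b4 ++ y :: c).
    apply: (@stable_catr (x :: b1)); move: St.
    by rewrite Eb3 -!catA /= -!catA /= -?catA.
  have : all (fun z => j.+1 < z.1) (b4 ++ y :: c).
    apply: IH St' erefl erefl N3 N3' _; first exact: ltnW.
    by rewrite avoids_cat avoids_cons yj N1c (all_avoids N4) //; lia.
  by rewrite all_cat /= => /and3P[].
exfalso.
have St' : stable (((j.+1, One false) :: b3) ++ (j.+1, One false) :: (b4 ++ y :: e) ++ z :: f).
  apply: (@stable_catr (x :: b1)); move: St.
  by rewrite Eb3 Ec -!catA /= -!catA /= -?catA.
have Ny : avoids j.+1 (b4 ++ y :: e).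
  by rewrite avoids_cat avoids_cons yj Ne (all_avoids N4) //; lia.
have St'' : stable ((j.+1, One false) :: b3 ++ (j.+1, One false) :: b4 ++ y :: e).
  apply: (@stable_catl _ (z :: f)); move: St'.
  by rewrite /= -?catA /= -?catA /= -?catA.
have Hall := IH _ _ _ _ (ltnW jn) St'' erefl erefl N3 N3' Ny.
have := gapi St' _ erefl z0 Ny => /(_ (ltnW jn)).
rewrite avoids_weight /=; last by apply: all_avoids Hall _.
have Oy : letter_ok y.
  by have := stable_ok St; rewrite /= all_cat /= => /and4P[].
rewrite weight_cat weight_cons (avoids_weight Nb4) yj eqxx (letter_okP Oy) ?yj //= avoids_weight //.
by move: Nc; rewrite Ec avoids_cat => /andP[].
Qed.

(** The gap contains no neighbour on the right, so it needs two on the left, and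
not more than two: these are again consecutive with none of the right
neighbours between them, which gives the inductive step. For i = 0 they
are a single letter 0 decorated with [Both]. *)
Lemma peak_shape i x b y : i.+1 < n -> stable (x :: b ++ [:: y]) ->
  x.1 = i.+1 -> y.1 = i.+1 -> avoids i.+1 b -> avoids i.+2 b -> low i.+1 b = LPeak i.
Proof.
elim: i x b y => [|i IH] x b y i_n St xi yi N1 N2.
  have E0 : low 1 b = filter (fun z : letter => z.1 == 0) b.
    by apply: eq_filter => z; lia.
  have := @gapi [::] x b y [::] 1 St; rewrite (avoids_weight N2) addn0 /=.
  move=> /(_ i_n xi yi N1); rewrite E0 /weight.
  case E: (filter _ b) => [//|z s] /=.
  have [b1 [b2 [Eb F1 F2 /eqP z0]]] := filter_cons_split E.
  case: s E F2 => [|z' s] E F2.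
    by rewrite addn0 /weight1; case: z z0 {E Eb} => ? [] //= ->.
  have [b3 [b4 [Eb2 F3 F4 /eqP z'0]]] := filter_cons_split F2.
  exfalso; have St' : stable ((x :: b1) ++ z :: b3 ++ z' :: (b4 ++ [:: y])).
    by move: St; rewrite Eb Eb2 /= -?catA /= -?catA.
  have [] := gap0 St' z0 z'0 (filter_nil_avoids F3).
  move: N1; rewrite Eb Eb2 avoids_cat avoids_cons avoids_cat => /and4P[_ _ + _].
  by rewrite avoids_count_at => /eqP->.
have := @gapi [::] x b y [::] i.+2 St; rewrite (avoids_weight N2) addn0 /=.
move=> /(_ i_n xi yi N1); rewrite weight_int; last 2 first.
- by have := stable_ok St; rewrite /= all_cat => /and3P[].
- by rewrite /= ltnW.
rewrite /count_at -size_filter.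
case E: (filter _ b) => [//|x' [//|y' s]] _.
have [b0 [b12 [Eb F0 F12 /eqP x'i]]] := filter_cons_split E.
have [b1 [b2 [Eb12 F1 F2 /eqP y'i]]] := filter_cons_split F12.
have N11 := filter_nil_avoids F1; have N10 := filter_nil_avoids F0.
have Eb' : b = b0 ++ x' :: b1 ++ y' :: b2 by rewrite Eb Eb12.
have /and5P[No0 _ No1 _ No2] : [&& avoids i.+2 b0, x'.1 != i.+2, avoids i.+2 b1, y'.1 != i.+2 & avoids i.+2 b2].
  by move: N1; rewrite Eb' avoids_cat avoids_cons avoids_cat avoids_cons.
have i_n' : i.+1 < n by exact: ltnW.
have St1 : stable (x' :: b1 ++ [:: y']).
  apply: (@stable_catl _ (b2 ++ [:: y])); apply: (@stable_catr (x :: b0)).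
  by move: St; rewrite Eb' /= -?catA /= -?catA /= -?catA.
have L1 := IH _ _ _ i_n' St1 x'i y'i N11 No1.
have Nb2 : avoids i.+1 b2.
  apply/contraT => /has_split[c0 [z [c1 [Ec z0 Nc0]]]].
  have St2 : stable (y' :: c0 ++ [:: z]).
    apply: (@stable_catl _ (c1 ++ [:: y])); apply: (@stable_catr (x :: b0 ++ x' :: b1)).
    by move: St; rewrite Eb' Ec /= -?catA /= -?catA /= -?catA /= -?catA.
  have := IH _ _ _ i_n' St2 y'i z0 Nc0.
  have -> : avoids i.+2 c0 by move: No2; rewrite Ec avoids_cat => /andP[].
  move/(_ isT).
  have St3 : stable (x' :: b1 ++ y' :: c0).
    apply: (@stable_catl _ (z :: c1 ++ [:: y])); apply: (@stable_catr (x :: b0)).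
    by move: St; rewrite Eb' Ec /= -?catA /= -?catA /= -?catA /= -?catA.
  have H := above_after_peak i_n' St3 x'i y'i N11 L1 Nc0.
  have -> : low i.+1 c0 = [::].
    by apply: all_low_nil; apply: sub_all H => w /=; lia.
  by case: (i).
have H2 : all (fun z => i.+1 < z.1) b2.
  apply: (above_after_peak i_n' _ x'i y'i N11 L1 Nb2).
  apply: (@stable_catl _ [:: y]); apply: (@stable_catr (x :: b0)).
  by move: St; rewrite Eb' /= -?catA /= -?catA /= -?catA /= -?catA.
have H0 : all (fun z => i.+1 < z.1) (rev b0).
  apply: (@above_after_peak i y' (rev b1) x' (rev b0)) => //.
  - apply: (@stable_catl _ [:: x]); apply: (@stable_catr (y :: rev b2)).
    have := stable_rev St.
    rewrite Eb' rev_cons rev_cat /= rev_cat rev_cons rev_cat rev_cons -!cats1.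
    by rewrite -?catA /= -?catA /= -?catA /= -?catA.
  - by rewrite avoids_rev.
  - by rewrite /low filter_rev -/(low _ _) L1 rev_LPeak.
  - by rewrite avoids_rev.
rewrite all_rev in H0.
rewrite Eb' low_cat (all_low_nil H0) /= x'i leqnn low_cat low_S // L1.
rewrite /low /= y'i leqnn -/(low _ _) (all_low_nil H2) cats1.
have := stable_ok St1; rewrite /= all_cat /= andbT => /and3P[Ox _ Oy].
have ok1 : 0 < i.+1 < n by [].
by rewrite (letter_okP Ox) ?x'i // (letter_okP Oy) ?y'i.
Qed.

(** * Non-isolated peaks force zigzags *)

Lemma rev_flip d : rev (flip d) = flip (rev d).
Proof. by rewrite /flip map_rev. Qed.

Lemma flip_up a m : a + m <= n.+1 -> flip (up a m) = rev (up (n.+1 - (a + m)) m).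
Proof.
elim: m => // m IH mn; rewrite upS -cats1 flip_cat IH; last by lia.
have -> : up (n.+1 - (a + m.+1)) m.+1 = (n.+1 - (a + m.+1), One false) :: up (n.+1 - (a + m)) m.
  by rewrite /up /= (_ : (n.+1 - (a + m.+1)).+1 = n.+1 - (a + m)) //; lia.
by rewrite rev_cons -cats1 addnS subSS.
Qed.

Lemma flip_LPeak i : i < n -> flip (LPeak i) = up (n - i) i ++ (n, Both) :: rev (up (n - i) i).
Proof.
move=> i_n; rewrite LPeak_up flip_cat flip_cons -rev_flip flip_up //; last by lia.
by rewrite revK /flipx subn0 add1n subSS.
Qed.

(** Three consecutive positions of a path that turns back only at the ends. *)
Definition turn_at_end p q r := (p = q.+1 \/ q = p.+1) /\ (q = r.+1 \/ r = q.+1) /\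
  (p = r -> q = 0 \/ q = n).
Definition zigzag_word (w : seq nat) := forall k, k.+2 < size w ->
  turn_at_end (nth 0 w k) (nth 0 w k.+1) (nth 0 w k.+2).
Definition next p q :=
  if q == 0 then 1 else if q == n then n.-1 else if p < q then q.+1 else q.-1.

(** The last two letters of d have positions p and q, and every position y other than
q and the continuation [next p q] of the zigzag is blocked: the gap that would be closed
by a letter y is too poor for stability. *)
Definition forced d p q := exists pre cp cq,
  [/\ d = pre ++ [:: (p, cp); (q, cq)], p = q.+1 \/ q = p.+1 &
  forall y, y <= n -> y <> q -> y <> next p q -> exists a c e,
    [/\ d = a ++ (y, c) :: e, avoids y e &
      if 0 < y < n then is_true (weight y.-1 e + weight y.+1 e <= 1)
      else count_at (if y == 0 then 1 else n.-1) e <= 1 /\ c = Both]].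

Lemma forced_next d p q x : forced d p q -> stable (d ++ [:: x]) -> x.1 = next p q.
Proof.
move=> [pre [cp [cq [Ed pq H]]]] St; apply: contrapT => xne.
have xn : x.1 <= n.
  by have := stable_ok St; rewrite all_cat /= andbT => /andP[_ /andP[]].
have [xq|xq] := eqVneq x.1 q.
  have := St; rewrite Ed -catA -[[:: _; _] ++ _]cat1s catA => -[_].
  move=> /(_ _ (q, cq) [::] x [::] erefl xq isT); rewrite /gap_ok /=.
  by case: ifP => // _ [].
have [a [c [e [Ea Ne H']]]] := H x.1 xn (elimN eqP xq) xne.
have := St; rewrite Ea -catA => -[_].
move=> /(_ _ (x.1, c) e x [::] erefl erefl Ne); rewrite /gap_ok /=.
case: ifP H' => _; first by move=> H1 H2; have := leq_trans H2 H1.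
move=> [H1 ->] [H2 H3]; suff /H3[? []] : count_at (if x.1 == 0 then 1 else n.-1) e = 1 by [].
by apply/eqP; rewrite eqn_leq H1.
Qed.

(** Appending the continuation x blocks the position q, the gap after it containing x
as only neighbour, and does not touch the gaps of the other blocked positions. *)
Lemma forced_extend d p q x : forced d p q -> stable (d ++ [:: x]) -> x.1 = next p q ->
  forced (d ++ [:: x]) q x.1.
Proof.
move=> [pre [cp [cq [Ed pq H]]]] St Ex.
have Ox : letter_ok x by have := stable_ok St; rewrite all_cat /= andbT => /andP[].
have [Op Oq] : p <= n /\ q <= n.
  have := stable_ok St; rewrite Ed !all_cat /= => /andP[/andP[_]].
  by case/and3P => /andP[/= -> _] /andP[/= -> _].
exists (pre ++ [:: (p, cp)]), cq, x.2; split.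
- by rewrite Ed -!catA; case: (x).
- by rewrite Ex /next; do ?case: eqP => ?; do ?case: ltnP => ?; lia.
move=> y yn yx yx'; have [yq|yq] := eqVneq y q; last first.
  have [a [c [e [Ea Ne H']]]] := H y yn (elimN eqP yq) (fun E => yx (etrans E (esym Ex))).
  exists a, c, (e ++ [:: x]); split; first by rewrite Ea -catA.
    by rewrite avoids_cat Ne /= andbT eq_sym; apply/eqP.
  have Hn z : z = y.+1 \/ y = z.+1 -> z <= n -> (x.1 == z) = false.
    move=> yz zn; apply/eqP => E; move: yx yx' yq Ex; rewrite E /next.
    by do ?case: eqP => ?; do ?case: ltnP => ?; do ?case: eqP => ?;
      do ?case: ltnP => ?; lia.
  case: ifP H' => Hy.
    rewrite !weight_cat !weight_cons !Hn //; last 4 first. lia. lia. lia. lia.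
    by rewrite /weight /= !addn0.
  by move=> [H1 ->]; rewrite count_at_cat count_at_cons Hn ?addn0 //; case: eqP => ?; lia.
subst y; exists (pre ++ [:: (p, cp)]), cq, [:: x]; split.
- by rewrite Ed -!catA.
- by rewrite /= andbT eq_sym; apply/eqP.
case: ifP => Hq.
  have x0 : 0 < x.1 < n.
    by move: Ex yx'; rewrite /next; do ?case: eqP => ?; do ?case: ltnP => ?; lia.
  rewrite !weight_cons /weight /= (letter_okP Ox x0) /weight1 /= !muln1 !addn0.
  by do 2!case: eqP => ? //; lia.
split; first by rewrite count_at_cons addn0 leq_b1.
have Ep : 0 < p < n by lia.
have Exp : x.1 = p by move: Ex; rewrite /next; do ?case: eqP => ?; lia.
have := @gapi pre (p, cp) [:: (q, cq)] x [::] p.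
rewrite Ed -catA in St; move=> /(_ St Ep erefl Exp).
have -> : avoids p [:: (q, cq)] by rewrite /= andbT; apply/eqP; lia.
move=> /(_ isT); rewrite !weight_cons /weight /= !addn0 /weight1 /=.
by case: (cq) => // b; do 2!case: eqP => ? //; lia.
Qed.

Lemma forced_zigzag d p q c : forced d p q -> stable (d ++ c) ->
  forall k, size d <= k.+2 -> k.+2 < size (d ++ c) ->
  turn_at_end (nth 0 (map fst (d ++ c)) k) (nth 0 (map fst (d ++ c)) k.+1)
     (nth 0 (map fst (d ++ c)) k.+2).
Proof.
elim: c d p q => [|x c IH] d p q I St k dk kc.
  by rewrite cats0 ltnNge dk in kc.
have E : d ++ x :: c = (d ++ [:: x]) ++ c by rewrite -catA.
have St1 : stable (d ++ [:: x]) by apply: (@stable_catl _ c); rewrite -E.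
have Ex := forced_next I St1.
have I' := forced_extend I St1 Ex.
have [dk'|] := ltnP (size d) k.+2.
  rewrite E; apply: (IH _ _ _ I'); rewrite -?E //.
  by rewrite size_cat addn1.
move=> kd; have Ek : size d = k.+2 by apply/eqP; rewrite eqn_leq dk.
move: I Ex => [pre [cp [cq [Ed pq H]]]] Ex.
have Epre : size pre = k by move: Ek; rewrite Ed size_cat /=; lia.
have xn : x.1 <= n.
  by have := stable_ok St1; rewrite all_cat /= andbT => /andP[_ /andP[]].
have [Op Oq] : p <= n /\ q <= n.
  have := stable_ok St; rewrite Ed !all_cat /= => /andP[/andP[_]].
  by case/and3P => /andP[/= -> _] /andP[/= -> _].
rewrite Ed -catA map_cat !nth_cat size_map Epre ltnn !ltnNge !leqW // subnn.
rewrite subSn // subSn 1?leqW // subSn // subnn /= Ex /turn_at_end /next.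
by do ?case: eqP => ?; do ?case: ltnP => ?; lia.
Qed.

(** The part 0 1 ... n ... j + 1 j of a turn: enough of the past to block all
positions except the next one. *)
Definition core j : seq letter :=
  (0, Both) :: up 1 n.-1 ++ (n, Both) :: rev (up j (n - j)).

Lemma core_forced a j : 0 < j < n -> forced (a ++ core j) j.+1 j.
Proof.
move=> /andP[j0 jn].
have Ej : exists pre cp cq, a ++ core j = pre ++ [:: (j.+1, cp); (j, cq)].
  rewrite /core; have [m Em] : exists m, n - j = m.+1 by exists (n - j).-1; lia.
  rewrite Em -[up j m.+1]cat1s; case: m Em => [|m] Em.
    exists (a ++ (0, Both) :: up 1 n.-1), Both, (One false).
    by rewrite -catA /=; have -> : n = j.+1 by lia.
  exists (a ++ (0, Both) :: up 1 n.-1 ++ (n, Both) :: rev (up j.+2 m)), (One false), (One false).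
  by rewrite /= !rev_cons -!cats1 -?catA /= -?catA.
move: Ej => [pre [cp [cq Ed]]]; exists pre, cp, cq; split=> //; first by left.
move=> y yn yj; rewrite /next (gtn_eqF j0) (ltn_eqF jn).
have -> : (j.+1 < j) = false by lia.
move=> yj1.
have [jy|jy] := ltnP j y.
  have [->|yn'] := eqVneq y n.
    exists (a ++ (0, Both) :: up 1 n.-1), Both, (rev (up j (n - j))); split.
    - by rewrite /core -?catA /= -?catA.
    - by rewrite avoids_rev avoids_count_at count_at_up; lia.
    - rewrite ltnn andbF; split=> //; rewrite count_at_rev count_at_up; exact: leq_b1.
  exists (a ++ (0, Both) :: up 1 n.-1 ++ (n, Both) :: rev (up y.+1 (n - y.+1))),
    (One false), (rev (up j (y - j))); split.
  - rewrite /core; have -> : n - j = (y - j) + (1 + (n - y.+1)) by lia.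
    rewrite !up_cat !rev_cat; have -> : j + (y - j) = y by lia.
    by rewrite addn1 -?catA /= -?catA /= -?catA.
  - by rewrite avoids_rev avoids_count_at count_at_up; lia.
  - by rewrite ifT ?weight_rev ?weight_up; lia.
have [->|y0] := posnP y.
  exists a, Both, (up 1 n.-1 ++ (n, Both) :: rev (up j (n - j))); split => //.
    by rewrite avoids_cat avoids_cons avoids_rev !avoids_count_at !count_at_up /=; lia.
  by split=> //; rewrite /= count_at_cat count_at_cons count_at_rev !count_at_up /=; lia.
exists (a ++ (0, Both) :: up 1 y.-1), (One false),
  (up y.+1 (n - y.+1) ++ (n, Both) :: rev (up j (n - j))); split.
- rewrite /core; have -> : n.-1 = y.-1 + (1 + (n - y.+1)) by lia.
  rewrite !up_cat; have -> : 1 + y.-1 = y by lia.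
  by rewrite addn1 -?catA /= -?catA /= -?catA.
- by rewrite avoids_cat avoids_cons avoids_rev !avoids_count_at !count_at_up /=; lia.
rewrite ifT; last by lia.
rewrite !weight_cat !weight_cons !weight_rev !weight_up /=; have -> : (n == y.-1) = false by lia.
have -> : (n == y.+1) = false by lia.
lia.
Qed.

(** A complete turn j ... 0 ... n ... j. *)
Definition loop j : seq letter := rev (up 1 j) ++ core j.

Lemma loop_LPeak j : 0 < j < n -> loop j =
  (j, One false) :: LPeak j.-1 ++ (j, One false) :: flip (LPeak (n - j.+1)) ++ [:: (j, One false)].
Proof.
move=> /andP[j0 jn]; rewrite flip_LPeak; last by lia.
have -> : n - (n - j.+1) = j.+1 by lia.
rewrite /loop /core LPeak_up; case: j j0 jn => // j _ jn /=.
rewrite upS rev_rcons /= -catA /= add1n; congr (_ :: (_ ++ _ :: _)).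
have -> : n.-1 = j + (1 + (n - j.+2)) by lia.
have -> : n - j.+1 = 1 + (n - j.+2) by lia.
by rewrite !up_cat rev_cat add1n addn1 -?catA /= -?catA /= -?catA.
Qed.

Lemma rev_flip_loop j : 0 < j < n -> rev (flip (loop j)) = loop (n - j).
Proof.
move=> Hj; rewrite !loop_LPeak //; last by lia.
rewrite !(flip_cat, flip_cons) !(rev_cat, rev_cons) !rev_flip !rev_LPeak -!cats1.
rewrite flipK; last first.
  have : forall i, i < n -> all letter_ok (LPeak i).
    elim=> [|i IH] /= i_n; first by rewrite /letter_ok.
    by rewrite -cats1 all_cat IH ?(ltnW i_n) //= andbT /letter_ok /=; lia.
  by apply; lia.
rewrite /= -?catA /= -?catA /=.
have -> : (n - j).-1 = n - j.+1 by lia.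
by have -> : n - (n - j).+1 = j.-1 by lia.
Qed.

Definition turn_at_end_window w k := turn_at_end (nth 0 w k) (nth 0 w k.+1) (nth 0 w k.+2).

Lemma map_up a m : map fst (up a m) = iota a m.
Proof. by rewrite /up -map_comp map_id. Qed.

Lemma loop_word j : 0 < j < n ->
  map fst (loop j) = rev (iota 1 j) ++ iota 0 n.+1 ++ rev (iota j (n - j)).
Proof.
move=> Hj; rewrite /loop /core map_cat map_rev map_up /= map_cat map_up /= map_rev map_up.
have -> : iota 1 n = iota 1 n.-1 ++ [:: n].
  by case: (n) n2 => // l _; rewrite -[l.+1]addn1 iotaD /= addn1 add1n.
by rewrite -?catA /= -?catA.
Qed.

Lemma loop_zigzag_word j : 0 < j < n -> zigzag_word (map fst (loop j)).
Proof.
move=> Hj; rewrite loop_word // => k.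
rewrite !size_cat !size_rev !size_iota => Hk.
have N i : i < 2 * n + 1 -> nth 0 (rev (iota 1 j) ++ iota 0 n.+1 ++ rev (iota j (n - j))) i =
    if i < j then j - i else if i <= j + n then i - j else (2 * n + j) - i.
  move=> Hi; rewrite !nth_cat size_rev !size_iota.
  case: ltnP => Hij; first by rewrite nth_rev size_iota // nth_iota; lia.
  case: ltnP => H1; first by rewrite nth_iota // ifT; lia.
  by rewrite nth_rev size_iota ?nth_iota ?ifF; lia.
rewrite !N; try lia.
by rewrite /turn_at_end; do ?case: ltnP => ?; do ?case: leqP => ?; lia.
Qed.

Lemma turn_at_end_window_flip w k : all (fun i => i <= n) w -> k.+2 < size w ->
  turn_at_end_window (map (subn n) w) k -> turn_at_end_window w k.
Proof.
move=> Hw kw; rewrite /turn_at_end_window !(nth_map 0) //; try lia.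
have H i : i < size w -> nth 0 w i <= n by move=> iw; apply: (allP Hw); rewrite mem_nth.
move: (H _ kw) (H _ (ltnW kw)) (H _ (ltnW (ltnW kw))).
move: (nth _ _ _) (nth _ _ _) (nth _ _ _) => p q r; rewrite /turn_at_end; lia.
Qed.

Lemma turn_at_end_window_rev w k : k.+2 < size w -> turn_at_end_window (rev w) k -> turn_at_end_window w (size w - k.+3).
Proof.
move=> kw; rewrite /turn_at_end_window !nth_rev; try lia.
have -> : (size w - k.+3).+1 = size w - k.+2 by lia.
have -> : (size w - k.+2).+1 = size w - k.+1 by lia.
by rewrite /turn_at_end; lia.
Qed.

Lemma ok_word d : all letter_ok d -> all (fun i => i <= n) (map fst d).
Proof. by elim: d => //= x d IH /andP[/andP[-> _] /IH]. Qed.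

(** Three letters of one interior position mean that the path visits both ends in
between. *)
Definition zigzag_deco d := zigzag_word (map fst d) /\ exists i, 0 < i < n /\ 3 <= count_at i d.

Lemma zigzag_deco_rev d : zigzag_deco d -> zigzag_deco (rev d).
Proof.
move=> [Z [i [Hi H3]]]; split; last by exists i; rewrite count_at_rev.
move=> k; rewrite map_rev size_rev => kw.
rewrite -[k](_ : size (rev (map fst d)) - (size (map fst d) - k.+3).+3 = k).
  apply: turn_at_end_window_rev; rewrite ?size_rev ?revK; first by lia.
  by apply: Z; lia.
by rewrite size_rev; lia.
Qed.

Lemma zigzag_deco_flip d : all letter_ok d -> zigzag_deco (flip d) -> zigzag_deco d.
Proof.
move=> Od [Z [i [Hi H3]]]; split; last first.
  by exists (n - i); rewrite -count_at_flip //; lia.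
move=> k kd; apply: turn_at_end_window_flip => //; first exact: ok_word.
have E : map fst (flip d) = map (subn n) (map fst d) by rewrite /flip -!map_comp.
by rewrite -E; apply: Z; rewrite E size_map.
Qed.

(** To the right of the turn each letter is forced by [core_forced]; to the left the same
holds for the reversed and mirrored word, which contains the mirror image of the turn. *)
Lemma loop_zigzag a c j : 0 < j < n -> stable (a ++ loop j ++ c) ->
  zigzag_deco (a ++ loop j ++ c).
Proof.
move=> Hj St.
have Hright a' c' i : 0 < i < n -> stable (a' ++ loop i ++ c') -> forall k,
   size (a' ++ loop i) <= k.+2 -> k.+2 < size (a' ++ loop i ++ c') ->
   turn_at_end_window (map fst (a' ++ loop i ++ c')) k.
  move=> Hi; rewrite /loop !catA => St' k kd kc.
  apply: (forced_zigzag _ St' kd kc); exact: core_forced.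
have sl i : 0 < i < n -> size (loop i) = 2 * n + 1.
  move=> Hi; rewrite -(size_map fst) loop_word // !size_cat !size_rev !size_iota; lia.
split; last first.
  exists j; split=> //; rewrite !count_at_cat /core count_at_rev count_at_cons count_at_cat count_at_cons count_at_rev.
  by rewrite !count_at_up; lia.
move=> k kd; rewrite -/(turn_at_end_window _ k).
have [kr|kr] := leqP (size (a ++ loop j)) k.+2.
  by apply: Hright => //; rewrite size_map in kd.
have slj := sl j Hj.
have {}kd : k.+2 < size a + (2 * n + 1 + size c) by rewrite -slj -!size_cat -(size_map fst).
have {}kr : k.+2 < size a + (2 * n + 1) by rewrite -slj -!size_cat.
have [ka|ka] := leqP (size a) k.
  have := @loop_zigzag_word j Hj (k - size a); rewrite size_map sl //.
  move: (sl j Hj); rewrite -(size_map fst) /turn_at_end_window map_cat [map fst (loop j ++ c)]map_cat.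
  move: (map fst (loop j)) => z sz; rewrite !nth_cat !size_map sz.
  have -> : k.+1 - size a = (k - size a).+1 by lia.
  have -> : k.+2 - size a = (k - size a).+2 by lia.
  rewrite (_ : (k < size a) = false) 1?(_ : (k.+1 < size a) = false)
    1?(_ : (k.+2 < size a) = false); try lia.
  rewrite (_ : (k - size a < 2 * n + 1) = true) 1?(_ : ((k - size a).+1 < 2 * n + 1) = true)
    1?(_ : ((k - size a).+2 < 2 * n + 1) = true); try lia.
  by move=> H; apply: H.
have Od := stable_ok St.
set d := a ++ loop j ++ c in Od St *.
have Ed : rev (flip d) = rev (flip c) ++ loop (n - j) ++ rev (flip a).
  by rewrite /d [flip _]flip_cat [flip (loop j ++ _)]flip_cat rev_cat [rev (_ ++ flip c)]rev_cat rev_flip_loop // catA.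
have St' : stable (rev (flip d)) by apply: stable_rev; exact: stable_flip.
have Sd : size d = size a + (2 * n + 1 + size c) by rewrite /d size_cat [size (loop j ++ c)]size_cat sl.
have Sf : size (flip d) = size d by rewrite size_map.
apply: turn_at_end_window_flip; rewrite ?size_map; [exact: ok_word|by lia|].
have -> : map (subn n) (map fst d) = map fst (flip d) by rewrite /flip -!map_comp.
have Ek : k = size (map fst (flip d)) - (size d - k.+3).+3 by rewrite size_map; lia.
rewrite Ek; apply: turn_at_end_window_rev; first by rewrite size_map; lia.
rewrite -map_rev Ed; apply: Hright; rewrite -?Ed //; first by lia.
  by rewrite size_cat size_rev size_map (sl (n - j)); lia.
by rewrite size_rev; lia.
Qed.

(** A gap without the neighbour on the right. *)
Definition left_peak j d := exists a x b y c,
  [/\ d = a ++ x :: b ++ y :: c, x.1 = j, y.1 = j, avoids j b & avoids j.+1 b].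

(** By [above_after_peak], a letter at most j on the right of the peak can only come after
another letter j. The gap between this letter and the peak has no letter j - 1, so
it is a peak on the other side, and both peaks together form a complete turn. *)
Lemma peak_next j a x b y c : 0 < j < n -> stable (a ++ x :: b ++ y :: c) ->
  x.1 = j -> y.1 = j -> avoids j b -> avoids j.+1 b -> ~~ all (fun z => j < z.1) c ->
  zigzag_deco (a ++ x :: b ++ y :: c).
Proof.
move=> Hj St xj yj N1 N2 Nc.
case: j => // j in Hj xj yj N1 N2 Nc *.
have jn : j.+1 < n by case/andP: Hj.
have St1 : stable (x :: b ++ y :: c) by apply: stable_catr St.
have L1 : low j.+1 b = LPeak j.
  apply: (peak_shape jn _ xj yj) => //; apply: (@stable_catl _ c).
  by rewrite /= -catA.
have Nc' : ~~ avoids j.+1 c.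
  by apply: contra Nc => Nc; exact: (above_after_peak jn St1).
have [c0 [y' [c' [Ec y'j Nc0]]]] := has_split Nc'.
have Hc0 : all (fun z => j.+1 < z.1) c0.
  apply: (above_after_peak jn (_ : stable (x :: b ++ y :: c0))) => //.
  by apply: (@stable_catl _ (y' :: c')); move: St1; rewrite Ec /= -?catA /= -?catA.
have Ok := stable_ok St.
have /and5P[Oa Ox Ob Oy Oc] : [&& all letter_ok a, letter_ok x, all letter_ok b, letter_ok y & all letter_ok c].
  by move: Ok; rewrite all_cat /= all_cat.
have /and3P[Oc0 Oy' Oc'] : [&& all letter_ok c0, letter_ok y' & all letter_ok c'].
  by move: Oc; rewrite Ec all_cat.
have [k [Ek [kn Enk Enk' Enk1]]] : exists k, k = n - j.+2 /\
    [/\ k.+1 < n, n - j.+1 = k.+1, n - k.+2 = j & n - k.+1 = j.+1].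
  by exists (n - j.+2); split=> //; clear -jn; split; lia.
have St2 : stable (y :: c0 ++ [:: y']).
  apply: (@stable_catl _ c'); apply: (@stable_catr (x :: b)).
  by move: St1; rewrite Ec /= -?catA /= -?catA.
have L2 : low k.+1 (flip c0) = LPeak k.
  apply: (@peak_shape k (flipx y) _ (flipx y')) => //=; rewrite ?yj ?y'j //.
  - by have := stable_flip St2; rewrite flip_cons flip_cat.
  - by rewrite avoids_flip ?Enk1 // ltnW.
  - by rewrite avoids_flip ?Enk' ?(all_avoids Hc0) //.
have Ec0 : c0 = flip (LPeak k).
  rewrite -[c0]flipK // -L2; congr flip; apply/esym/all_filterP; rewrite all_map.
  by apply: sub_all Hc0 => z /=; clear -Ek jn; lia.
have Nb1 : avoids j.+1 b by [].
have Hb : all (fun z => k.+1 < z.1) (flip (rev b)).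
  have St3 : stable (x :: b ++ y :: c0 ++ [:: y']).
    by apply: (@stable_catl _ c'); move: St1; rewrite Ec /= -?catA /= -?catA.
  have := stable_flip (stable_rev St3).
  rewrite rev_cons rev_cat rev_cons rev_cat /= -!cats1 -?catA /= !(flip_cons, flip_cat).
  rewrite -?catA /= => St4.
  apply: (@above_after_peak k (flipx y') (flip (rev c0)) (flipx y)) => //=; rewrite ?yj ?y'j //.
  - by apply: (@stable_catl _ (flip [:: x])); rewrite /= -?catA /= -?catA.
  - by rewrite avoids_flip ?all_rev // ?Enk1 ?avoids_rev // ltnW.
  - by rewrite /low -rev_flip filter_rev -/(low _ _) L2 rev_LPeak.
  - by rewrite avoids_flip ?all_rev // ?Enk1 ?avoids_rev // ltnW.
have Eb : b = LPeak j.
  rewrite -L1; apply/esym/all_filterP; move: Hb; rewrite -rev_flip all_rev all_map.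
  by apply: sub_all => z /=; clear -Ek jn; lia.
have Hl z : letter_ok z -> z.1 = j.+1 -> z = (j.+1, One false).
  by move=> Oz zj; rewrite (letter_okP Oz) zj.
move: St; rewrite Ec Ec0 Eb (Hl x) // (Hl y) // (Hl y') // => St.
have := @loop_zigzag a c' j.+1 Hj; rewrite loop_LPeak // -Ek.
by rewrite /= -?catA /= -?catA /= -?catA; apply.
Qed.

(** * The shapes of stable words *)

Definition right_peak k d := left_peak (n - k) (flip d).
Definition isolated_left j d := low j.+1 d = LPeak j /\ left_peak j d.
Definition isolated_right k d := isolated_left (n - k) (flip d).

(** The two positions i and i + 1 alternate in d. *)
Definition alternates_at i (d : seq letter) :=
  sorted (fun x y : letter => x.1 != y.1) (filter (fun x => pred2 i i.+1 x.1) d).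
Fixpoint drop_first j (d : seq letter) :=
  if d is x :: d' then if x.1 == j then d' else x :: drop_first j d' else [::].

Lemma alternates_at_fail i d : ~~ alternates_at i d -> exists a x b y c,
  [/\ d = a ++ x :: b ++ y :: c, x.1 = y.1, x.1 = i \/ x.1 = i.+1, avoids i b & avoids i.+1 b].
Proof.
case/not_sorted => s [x [y [t [E]]]]; rewrite negbK => /eqP xy.
have [a [b1 [-> _ E1]]] := filter_cat_split E.
have [b2 [b3 [-> E2 E3 px]]] := filter_cons_split E1.
have [b4 [b5 [-> E4 _ _]]] := filter_cons_split E3.
exists (a ++ b2), x, b4, y, b5; split=> //; first by rewrite -catA.
- by case/orP: px => /eqP ->; [left|right].
- by elim: b4 E4 => //= z b IH; case: ifP => //; case: eqP => //= _ _ /IH.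
- elim: b4 E4 => //= z b IH; case: ifP => //.
  by case: (z.1 == i.+1); rewrite ?orbT //= => _ /IH.
Qed.

Lemma right_peakI k d a x b y c : all letter_ok d -> 0 < k <= n ->
  d = a ++ x :: b ++ y :: c -> x.1 = k -> y.1 = k -> avoids k b -> avoids k.-1 b ->
  right_peak k d.
Proof.
move=> Od /andP[k0 kn] E xk yk N1 N2.
exists (flip a), (flipx x), (flip b), (flipx y), (flip c).
have Ob : all letter_ok b by move: Od; rewrite E all_cat /= all_cat => /and5P[].
rewrite /= xk yk; split=> //; first by rewrite E !(flip_cat, flip_cons).
  by rewrite avoids_flip ?leq_subr // subKn.
rewrite avoids_flip //; last by lia.
by have -> : n - (n - k).+1 = k.-1 by lia.
Qed.

(** Two equal consecutive letters of the subword on {i, i + 1} span a gap without one of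
the two neighbours; at an end of the graph this neighbour was the only one. *)
Lemma alternates_at_peak i d : stable d -> i < n -> ~~ alternates_at i d ->
  (0 < i /\ left_peak i d) \/ (i.+1 < n /\ right_peak i.+1 d).
Proof.
move=> St i_n /alternates_at_fail[a [x [b [y [c [E xy [xi|xi] N1 N2]]]]]].
  have [i0|i0] := posnP i; last first.
    by left; split=> //; exists a, x, b, y, c; rewrite -xy.
  rewrite {}i0 in xi N1 N2; rewrite E in St; have [] := gap0 St xi (etrans (esym xy) xi) N1.
  by move: N2; rewrite avoids_count_at => /eqP ->.
right; have Od := stable_ok St.
have R : right_peak i.+1 d by apply: (right_peakI Od _ E); rewrite -?xy ?xi.
split=> //; rewrite ltn_neqAle i_n andbT; apply/eqP => Ei.
have [_ /(_ _ _ _ _ _ E (esym xy))] := St; rewrite xi => /(_ N2).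
rewrite /gap_ok xi Ei ltnn andbF; have -> : (n == 0) = false by lia.
by rewrite -Ei /=; move: N1; rewrite avoids_count_at => /eqP ->; case.
Qed.

(** The letters outside the peak are compared with it by [peak_next], applied to the
word and to its reversal. *)
Lemma left_peak_iso j d : 0 < j < n -> stable d -> ~ zigzag_deco d ->
  left_peak j d -> isolated_left j d.
Proof.
move=> Hj St NZ LP; split=> //; case: LP => a [x [b [y [c [E xj yj N1 N2]]]]].
have Hc : all (fun z => j < z.1) c.
  by apply: contraT => H; case: NZ; rewrite E in St *; exact: peak_next H.
have Ha : all (fun z => j < z.1) a.
  rewrite -all_rev; apply: contraT => H; case: NZ; rewrite -[d]revK; apply: zigzag_deco_rev.
  have := stable_rev St; rewrite E rev_cat rev_cons rev_cat rev_cons -!cats1 -?catA /=.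
  by move=> St'; apply: (peak_next Hj St') => //; rewrite avoids_rev.
case: j Hj xj yj N1 N2 Ha Hc => // j /andP[_ jn] xj yj N1 N2 Ha Hc.
have L1 : low j.+1 b = LPeak j.
  apply: (peak_shape jn _ xj yj) => //; apply: (@stable_catl _ c); apply: (@stable_catr a).
  by rewrite E in St; rewrite /= -catA.
rewrite E low_cat (all_low_nil Ha) /= xj leqnn low_cat low_S // L1 /= yj leqnn.
rewrite -/(low _ _) (all_low_nil Hc) cats1.
have /and5P[_ Ox _ Oy _] : [&& all letter_ok a, letter_ok x, all letter_ok b, letter_ok y & all letter_ok c].
  by have := stable_ok St; rewrite E all_cat /= all_cat.
by rewrite (letter_okP Ox) ?xj // (letter_okP Oy) ?yj.
Qed.

Lemma isolated_left_count_at j d : 0 < j -> isolated_left j d -> count_at j d = 2.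
Proof. by move=> j0 [L _]; rewrite -(@count_at_low j j.+1) // L count_at_LPeak gtn_eqF // leqnn. Qed.

(** For k <= j, the gap at k would be a gap of the left peak, which contains letters
k - 1. *)
Lemma peaks_ordered j k d : 0 < j < n -> 0 < k < n -> all letter_ok d ->
  isolated_left j d -> isolated_right k d -> j < k.
Proof.
move=> Hj Hk Od [L _] [_ [a [x [b [y [c [E xk yk N1 N2]]]]]]].
rewrite ltnNge; apply/negP => kj.
have Ofd := ok_flip Od.
have E' := congr1 flip E; rewrite (flipK Od) !(flip_cat, flip_cons) in E'.
have Ob : all letter_ok b by move: Ofd; rewrite E all_cat /= all_cat => /and5P[].
have kn : n - (n - k) = k by lia.
have := isolated_left_gap L E' (_ : 0 < k <= j); rewrite /= xk yk kn => H.
have {}H : low k (flip b) = LPeak k.-1.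
  apply: H => //; first by lia.
  by rewrite avoids_flip //; lia.
have : avoids k.-1 (LPeak k.-1).
  rewrite -H avoids_low; last by lia.
  rewrite avoids_flip //; last by lia.
  by have <- : (n - k).+1 = n - k.-1 by lia.
by rewrite avoids_count_at count_at_LPeak leqnn; case: (k.-1 == 0).
Qed.

Lemma filter_drop_first (p : pred nat) j d : ~~ p j ->
  filter (fun x => p x.1) (drop_first j d) = filter (fun x : letter => p x.1) d.
Proof.
move=> pj; elim: d => //= x d IH; case: eqP => [->|_] /=; first by rewrite (negPf pj).
by rewrite IH.
Qed.

Lemma drop_first_filter (p : pred nat) j d : p j ->
  filter (fun x => p x.1) (drop_first j d) = drop_first j (filter (fun x : letter => p x.1) d).
Proof.
move=> pj; elim: d => //= x d IH; case: (eqVneq x.1 j) => [Ex|xj] /=; first by rewrite Ex pj /= Ex eqxx.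
by rewrite IH; case: ifP => //= _; rewrite (negPf xj).
Qed.

Lemma alternates_at_drop_first i j d : j != i -> j != i.+1 -> alternates_at i (drop_first j d) = alternates_at i d.
Proof. by move=> ji jSi; rewrite /alternates_at (@filter_drop_first (pred2 i i.+1)) //= (negPf ji). Qed.

Lemma drop_first_cat j a x d : avoids j a -> x.1 = j -> drop_first j (a ++ x :: d) = a ++ d.
Proof. by move=> + xj; elim: a => [_|z a IH /andP[/negPf/= -> /IH ->]] //=; rewrite xj eqxx. Qed.

Lemma alternates_at_flip i d : all letter_ok d -> i < n -> alternates_at i (flip d) = alternates_at (n - i.+1) d.
Proof.
move=> Od i_n; rewrite /alternates_at; have -> : (n - i.+1).+1 = n - i by lia.
have -> : filter (fun x => pred2 i i.+1 x.1) (flip d) =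
    flip (filter (fun x => pred2 (n - i.+1) (n - i) x.1) d).
  elim: d Od => //= x d IH /andP[/andP[xn _] /IH ->].
  have -> : (n - x.1 == i) || (n - x.1 == i.+1) = (x.1 == n - i.+1) || (x.1 == n - i) by lia.
  by case: ifP.
have Of : all letter_ok (filter (fun x => pred2 (n - i.+1) (n - i) x.1) d).
  by elim: d Od => //= x d IH /andP[Ox /IH]; case: ifP => //= _ ->; rewrite Ox.
elim: (filter _ _) Of => // x [|y s] IH //= /andP[/andP[xn _] Os].
have /andP[/andP[yn _] _] := Os; rewrite -[path _ _ _]/(sorted _ (flip (y :: s))) IH //=.
by congr andb; lia.
Qed.

Lemma no_other j (s : seq letter) : all (fun x => pred2 j j.+1 x.1) s -> avoids j s ->
  all (fun x => x.1 == j.+1) s.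
Proof. by elim: s => //= x s IH /andP[/orP[->//|-> /IH H]] /andP[_ /H]. Qed.

Lemma avoids_filter_sub j (p : pred letter) a : avoids j a -> avoids j (filter p a).
Proof. by elim: a => //= x a IH /andP[xj /IH]; case: ifP => //= _ ->; rewrite xj. Qed.

Lemma isolated_left_split j d : 0 < j -> isolated_left j d -> exists a x b y c,
  [/\ d = a ++ x :: b ++ y :: c, x.1 = j /\ y.1 = j, avoids j a /\ avoids j c, avoids j b & avoids j.+1 b].
Proof.
move=> j0 I; have := isolated_left_count_at j0 I; case: I => _ [a [x [b [y [c [E xj yj N1 N2]]]]]].
rewrite E !(count_at_cat, count_at_cons) xj yj eqxx => H.
by exists a, x, b, y, c; split=> //; rewrite !avoids_count_at; lia.
Qed.

(** Two letters j + 1 on the same side of the peak would be a right peak. *)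
Lemma one_neighbour_outside j d (a : seq letter) : stable d -> j < n ->
  (j.+1 < n -> ~ right_peak j.+1 d) ->
  forall a0 c0, d = a0 ++ a ++ c0 -> avoids j a ->
  size (filter (fun x => pred2 j j.+1 x.1) a) <= 1.
Proof.
move=> St jn NR a0 c0 E Na; rewrite leqNgt; apply/negP => H.
suff /(alternates_at_peak (_ : stable a) jn) : ~~ alternates_at j a.
  have Sta : stable a by apply: (@stable_catl _ c0); apply: (@stable_catr a0); rewrite -E.
  case/(_ Sta) => [[j0 [a1 [x [b [y [c [E' xj _ _ _]]]]]]]|[jn1]].
    by move: Na; rewrite E' avoids_cat avoids_cons xj eqxx andbF.
  move=> [a1 [x [b [y [c [E' xj yj N1 N2]]]]]]; apply: (NR jn1).
  exists (flip a0 ++ a1), x, b, y, (c ++ flip c0); split=> //.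
  by rewrite E !flip_cat E' -?catA /= -?catA /= -?catA.
rewrite /alternates_at; set s := filter _ _ in H *.
have : all (fun x => x.1 == j.+1) s.
  apply: no_other; first exact: filter_all.
  exact: avoids_filter_sub.
by case: s H => [|z [|z' s]] //= _ /and3P[/eqP-> /eqP-> _]; rewrite eqxx.
Qed.

Lemma drop_first_alt_left j d : 0 < j < n -> stable d -> isolated_left j d ->
  (j.+1 < n -> ~ right_peak j.+1 d) -> alternates_at j (drop_first j d).
Proof.
move=> /andP[j0 jn] St I NR.
have [a [x [b [y [c [E [xj yj] [Na Nc] N1 N2]]]]]] := isolated_left_split j0 I.
have := @one_neighbour_outside _ _ a St jn NR [::] (x :: b ++ y :: c) E Na.
have := @one_neighbour_outside _ _ c St jn NR (a ++ x :: b ++ [:: y]) [::].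
rewrite cats0 -?catA /= -?catA /= => /(_ E Nc) Sc Sa.
have Aa : all (fun z => z.1 == j.+1) (filter (fun x => pred2 j j.+1 x.1) a).
  apply: no_other; first exact: filter_all.
  exact: avoids_filter_sub.
have Ac : all (fun z => z.1 == j.+1) (filter (fun x => pred2 j j.+1 x.1) c).
  apply: no_other; first exact: filter_all.
  exact: avoids_filter_sub.
have Eb : filter (fun x => pred2 j j.+1 x.1) b = [::].
  elim: b N1 N2 {E} => //= z b IH /andP[/negPf-> /IH H] /andP[/negPf-> /H] //.
rewrite E drop_first_cat // /alternates_at !filter_cat Eb /= yj eqxx /=.
move: (filter _ a) (filter _ c) Sa Sc Aa Ac.
by move=> [|u [|//]] [|v [|//]] _ _ /=; rewrite ?andbT ?yj //; lia.
Qed.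

Lemma count_at_drop_first i k e : count_at i (drop_first k e) = count_at i e - ((i == k) && (0 < count_at k e)).
Proof.
elim: e => [|x e IH]; first by rewrite andbF.
have -> : drop_first k (x :: e) = if x.1 == k then e else x :: drop_first k e by [].
case: (eqVneq x.1 k) => [xk|/negPf xk]; rewrite !count_at_cons ?IH.
  by rewrite xk eqxx [k == i]eq_sym; case: (i == k); lia.
by case: (eqVneq i k) => [->|_]; rewrite ?xk; lia.
Qed.

Lemma count_at_filter i (p : pred nat) e :
  count_at i (filter (fun x => p x.1) e) = if p i then count_at i e else 0.
Proof.
rewrite /count_at count_filter; case: ifP => pi.
  by apply: eq_count => x /=; case: eqP => //= ->; rewrite pi.
by rewrite -(count_pred0 e); apply: eq_count => x /=; case: eqP => //= ->; rewrite pi.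
Qed.

Lemma drop_first_alt_both j d : 0 < j -> j.+1 < n -> all letter_ok d -> isolated_left j d ->
  isolated_right j.+1 d -> alternates_at j (drop_first j.+1 (drop_first j d)).
Proof.
move=> j0 jn Od I J; have C1 := isolated_left_count_at j0 I.
have C2 : count_at j.+1 d = 2.
  have := @isolated_left_count_at (n - j.+1) (flip d) _ J; rewrite count_at_flip //; last by lia.
  have -> : n - (n - j.+1) = j.+1 by lia.
  by apply; lia.
rewrite /alternates_at; set s := filter _ _.
have Cs i : count_at i s = if pred2 j j.+1 i then count_at i (drop_first j.+1 (drop_first j d)) else 0.
  exact: count_at_filter.
have As : all (fun x => pred2 j j.+1 x.1) s by exact: filter_all.
have S1 : count_at j s = 1 by rewrite Cs /= eqxx !count_at_drop_first eqxx C1 (ltn_eqF (ltnSn j)).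
have S2 : count_at j.+1 s = 1 by rewrite Cs /= eqxx orbT !count_at_drop_first eqxx C2 (gtn_eqF (ltnSn j)).
move: As S1 S2; clear; rewrite /count_at; case: s => [|x [|y [|z s]]] //=.
  by move=> /and3P[]; lia.
by move=> /and4P[]; lia.
Qed.

Lemma flip_drop_first k d : all letter_ok d -> k <= n -> flip (drop_first k d) = drop_first (n - k) (flip d).
Proof.
move=> + kn; elim: d => //= x d IH /andP[/andP[xn _] /IH E].
have -> : (n - x.1 == n - k) = (x.1 == k) by lia.
by case: eqP => //= _; rewrite E.
Qed.

Lemma ok_drop_first k d : all letter_ok d -> all letter_ok (drop_first k d).
Proof. by elim: d => //= x d IH /andP[Ox Od]; case: eqP => //= _; rewrite Ox IH. Qed.

Lemma right_flip k d : all letter_ok d -> k <= n ->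
  right_peak (n - k) (flip d) <-> left_peak k d.
Proof. by move=> Od kn; rewrite /right_peak flipK // subKn. Qed.

Lemma drop_first_alt_right k d : 0 < k < n -> stable d -> isolated_right k d ->
  (0 < k.-1 -> ~ left_peak k.-1 d) -> alternates_at k.-1 (drop_first k d).
Proof.
move=> Hk St J NL; have Od := stable_ok St.
have := @drop_first_alt_left (n - k) (flip d) _ (stable_flip St) J.
rewrite -flip_drop_first // ?alternates_at_flip; [|exact: ok_drop_first| |]; try lia.
have -> : n - (n - k).+1 = k.-1 by lia.
apply; first by lia.
move=> H R; apply: NL; first by lia.
have /right_flip <- // : k.-1 <= n by lia.
by have -> : n - k.-1 = (n - k).+1 by lia.
Qed.

Lemma max_exists (P : nat -> Prop) N : (forall i, P i -> i <= N) -> (exists i, P i) ->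
  exists i, P i /\ forall j, P j -> j <= i.
Proof.
move=> HN [i0 Pi0]; have ex : exists i, `[< P i >] by exists i0; apply/asboolP.
have bd i : `[< P i >] -> i <= N by move/asboolP/HN.
case: (ex_maxnP ex bd) => i /asboolP Pi Hi; exists i; split=> // j Pj.
by apply: Hi; apply/asboolP.
Qed.

Lemma min_exists (P : nat -> Prop) : (exists i, P i) ->
  exists i, P i /\ forall j, P j -> i <= j.
Proof.
move=> [i0 Pi0]; have ex : exists i, `[< P i >] by exists i0; apply/asboolP.
case: (ex_minnP ex) => i /asboolP Pi Hi; exists i; split=> // j Pj.
by apply: Hi; apply/asboolP.
Qed.

(** The families, read on decorated words. *)
Inductive shape (d : seq letter) : heap_family -> Prop :=
| ShapeALT of (forall i, i < n -> alternates_at i d) : shape d ALT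
| ShapeZZ of zigzag_deco d : shape d ZZ
| ShapeLP j of 0 < j < n & isolated_left j d & (forall i, j <= i < n -> alternates_at i (drop_first j d)) :
    shape d LP
| ShapeRP k of 0 < k < n & isolated_right k d & (forall i, i < k -> alternates_at i (drop_first k d)) :
    shape d RP
| ShapeLRP j k of 0 < j < k & k < n & isolated_left j d & isolated_right k d &
    (forall i, j <= i < k -> alternates_at i (drop_first k (drop_first j d))) : shape d LRP.

(** Outside the zigzags, all peaks are isolated. Choosing j maximal among the left peaks and k
minimal among the right peaks excludes failures of alternation in
between, by [alternates_at_peak]. *)
Lemma stable_shape d : stable d -> exists X, shape d X.
Proof.
move=> St; have Od := stable_ok St.
have [Z|NZ] := pselect (zigzag_deco d); first by exists ZZ; constructor.
have IL j : 0 < j < n -> left_peak j d -> isolated_left j d.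
  by move=> Hj; exact: left_peak_iso.
have IR k : 0 < k < n -> right_peak k d -> isolated_right k d.
  move=> Hk; apply: left_peak_iso; [lia|exact: stable_flip|].
  by move/(zigzag_deco_flip Od).
have [/(@max_exists _ n)|NL] := pselect (exists j, 0 < j < n /\ left_peak j d).
  case=> [i [] |j [[Hj Lj] maxj]]; first by lia.
  have ILj := IL j Hj Lj.
  have [/min_exists [k [[Hk Rk] mink]]|NR] := pselect (exists k, 0 < k < n /\ right_peak k d).
    have IRk := IR k Hk Rk.
    have jk := peaks_ordered Hj Hk Od ILj IRk.
    have NR i : 0 < i < k -> ~ right_peak i d.
      move=> Hi Ri; have Hi' : 0 < i < n by lia.
      by have := mink i (conj Hi' Ri); lia.
    have NLi i : j < i < n -> ~ left_peak i d.
      move=> Hi Li; have Hi' : 0 < i < n by lia.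
      by have := maxj i (conj Hi' Li); lia.
    exists LRP; apply: (@ShapeLRP d j k) => //; [lia|lia|move=> i /andP[ji ik]].
    have [Ei|ji'] := eqVneq i j.
      subst i; have [Ek|jk'] := eqVneq k j.+1.
        by rewrite Ek in IRk Hk *; apply: drop_first_alt_both => //; lia.
      rewrite alternates_at_drop_first; [|lia|lia]; apply: drop_first_alt_left => // _; apply: NR; lia.
    have [Ek|ik'] := eqVneq i.+1 k.
      rewrite /alternates_at; set p := pred2 i i.+1.
      have -> : filter (fun x => p x.1) (drop_first k (drop_first j d)) =
                filter (fun x => p x.1) (drop_first k d).
        by rewrite !(@drop_first_filter p k) ?filter_drop_first // /p /=; lia.
      have := @drop_first_alt_right k d Hk St IRk; have -> : k.-1 = i by lia.
      by apply=> _; apply: NLi; lia.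
    rewrite !alternates_at_drop_first; try lia.
    have i_n : i < n by lia.
    by apply: contraT => /(alternates_at_peak St i_n)[[_ /NLi]|[_ /NR]] H; case: H; lia.
  exists LP; apply: (@ShapeLP d j) => // i /andP[ji i_n].
  have NRi k : 0 < k < n -> ~ right_peak k d.
    by move=> Hk Rk; apply: NR; exists k.
  have [->|ji'] := eqVneq i j; first by apply: drop_first_alt_left => // H; apply: NRi; lia.
  rewrite alternates_at_drop_first; [|lia|lia]; apply: contraT => /(alternates_at_peak St i_n)[[i0 Li]|[i0 /NRi]].
    have Hi : 0 < i < n by lia.
    by have := maxj i (conj Hi Li); lia.
  by case; lia.
have NLi i : 0 < i < n -> ~ left_peak i d by move=> Hi Li; apply: NL; exists i.
have [/min_exists [k [[Hk Rk] mink]]|NR] := pselect (exists k, 0 < k < n /\ right_peak k d).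
  have IRk := IR k Hk Rk.
  have NR i : 0 < i < k -> ~ right_peak i d.
    move=> Hi Ri; have Hi' : 0 < i < n by lia.
    by have := mink i (conj Hi' Ri); lia.
  exists RP; apply: (@ShapeRP d k) => // i ik.
  have [Ek|ik'] := eqVneq i.+1 k.
    have -> : i = k.-1 by lia.
    by apply: drop_first_alt_right => // H; apply: NLi; lia.
  rewrite alternates_at_drop_first; [|lia|lia].
  have i_n : i < n by lia.
  apply: contraT => /(alternates_at_peak St i_n)[[H /NLi]|[_ /NR]] H'; case: H'; lia.
exists ALT; constructor=> i i_n; apply: contraT.
move=> /(alternates_at_peak St i_n)[[i0 /NLi]|[i0 Ri]]; first by case; lia.
by case: NR; exists i.+1.
Qed.

End Stable.

(** * Sufficient conditions for stability *)

Definition sep l m (w : seq nat) :=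
  forall a b c, w = a ++ l :: b ++ l :: c -> l \notin b -> m \in b.

Lemma map_cat_split (T U : Type) (f : T -> U) u s1 s2 : map f u = s1 ++ s2 ->
  exists u1 u2, [/\ u = u1 ++ u2, map f u1 = s1 & map f u2 = s2].
Proof.
elim: s1 u => [|z s1 IH] [|x u] //=; try by move=> <-; exists [::]; eexists.
by case=> <- /IH[u1 [u2 [-> <- <-]]]; exists (x :: u1), u2.
Qed.

Lemma map_cons_split (T U : Type) (f : T -> U) u z s1 s2 : map f u = s1 ++ z :: s2 ->
  exists u1 x u2, [/\ u = u1 ++ x :: u2, map f u1 = s1, f x = z & map f u2 = s2].
Proof.
by move/map_cat_split => [u1 [[|x u2] [-> <- //= [<- <-]]]]; exists u1, x, u2.
Qed.

Lemma sep_sorted (T : Type) (f : T -> nat) (P : pred T) (s : seq T) l m : l != m ->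
  (forall x, f x = l -> P x) ->
  sorted (fun p q => p != q) (filter (pred2 l m) (map f (filter P s))) ->
  sep l m (map f s).
Proof.
move=> lm HP S a b c E Nb; apply: contraT => Nm.
have [u1 [x [u2 [Es _ xl E2]]]] := map_cons_split E.
have [u3 [y [u4 [E3 Eb yl _]]]] := map_cons_split E2.
move: S; rewrite Es E3 !filter_cat /= HP // filter_cat /= HP //.
rewrite map_cat /= map_cat /= filter_cat /= xl eqxx /= filter_cat /= yl eqxx /=.
have -> : filter (pred2 l m) (map f (filter P u3)) = [::].
  move: Nb Nm; rewrite -Eb; elim: u3 {E3 Eb} => //= z u IH.
  rewrite !inE !negb_or => /andP[zl /IH H] /andP[zm /H {}IH]; case: ifP => //= _.
  by rewrite eq_sym (negPf zl) eq_sym (negPf zm).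
by case: (filter _ (map _ _)) => [|v X] /=; rewrite ?cat_path /= eqxx ?andbF.
Qed.

Section Converse.
Variable n : nat.
Hypothesis n2 : 2 <= n.
Notation gap_ok := (gap_ok n).
Notation letter_ok := (letter_ok n).

Definition decorations i (d : seq letter) := [seq x.2 | x <- d & x.1 == i].
Definition alternates (r : seq end_split) :=
  exists b : bool, r = mkseq (fun i => One (b (+) odd i)) (size r).

Lemma deco_cat i a b : decorations i (a ++ b) = decorations i a ++ decorations i b.
Proof. by rewrite /decorations filter_cat map_cat. Qed.

Lemma deco_cons i x b : decorations i (x :: b) = (if x.1 == i then [:: x.2] else [::]) ++ decorations i b.
Proof. by rewrite /decorations /=; case: ifP. Qed.

Lemma size_deco i d : size (decorations i d) = count_at i d.
Proof. by rewrite size_map size_filter. Qed.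

Lemma deco_avoids i b : avoids i b -> decorations i b = [::].
Proof. by move=> H; apply: size0nil; rewrite size_deco; apply/eqP; rewrite -avoids_count_at. Qed.

Lemma alternates_opp i a x b y c : alternates (decorations i (a ++ x :: b ++ y :: c)) ->
  x.1 = i -> y.1 = i -> avoids i b -> exists z, x.2 = One z /\ y.2 = One (~~ z).
Proof.
move=> [z E] xi yi Nb; move: E.
rewrite deco_cat deco_cons deco_cat deco_cons (deco_avoids Nb) xi yi eqxx /=.
set r := decorations i a; set s := _ ++ _ => E.
have N k : k < size s -> nth Both s k = One (z (+) odd k).
  by move=> ks; rewrite [in LHS]E nth_mkseq.
have S1 : (size r).+1 < size s by rewrite size_cat /=; lia.
exists (z (+) odd (size r)).
have := N _ (ltnW S1); rewrite /s nth_cat ltnn subnn /= => ->; split=> //.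
have := N _ S1; rewrite /s nth_cat ltnNge leqnSn /= subSnn /= => ->.
by rewrite addbN.
Qed.

(** Unlike [zigzag_word], this also says something of words with two letters. *)
Definition zigzag_path (w : seq nat) :=
  (forall k, k.+1 < size w -> nth 0 w k = (nth 0 w k.+1).+1 \/ nth 0 w k.+1 = (nth 0 w k).+1)
  /\ zigzag_word n w.

Lemma nth_catD (a s : seq nat) k : nth 0 (a ++ s) (size a + k) = nth 0 s k.
Proof. by rewrite nth_cat ltnNge leq_addr /= addKn. Qed.

Lemma zigzag_path_step w a p q c : zigzag_path w -> w = a ++ p :: q :: c -> p = q.+1 \/ q = p.+1.
Proof.
move=> [Z _] E; have := Z (size a + 0).
by rewrite E -addnS !nth_catD; apply; rewrite size_cat /=; lia.
Qed.

Lemma zigzag_path_turn w a p q c : zigzag_path w -> w = a ++ p :: q :: p :: c -> q = 0 \/ q = n.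
Proof.
move=> [_ Z] E; have := Z (size a + 0); rewrite E -!addnS !nth_catD /=.
case; first by rewrite size_cat /=; lia.
by move=> _ [_]; apply.
Qed.

Lemma zigzag_path_gap d a x b y c i : zigzag_path (map fst d) ->
  d = a ++ x :: b ++ y :: c -> x.1 = i -> y.1 = i -> avoids i b ->
  (exists z, b = [:: z] /\ (z.1 = 0 \/ z.1 = n)) \/
  2 <= count_at i.-1 b + count_at i.+1 b.
Proof.
move=> Z E xi yi Nb.
have Ew : map fst d = map fst a ++ i :: map fst b ++ i :: map fst c.
  by rewrite E map_cat /= map_cat /= xi yi.
case: b E Nb Ew => [|z b] E Nb Ew; first by have := zigzag_path_step Z Ew; lia.
case/lastP: b E Nb Ew => [|b z'] E Nb Ew.
  by left; exists z; split=> //; exact: zigzag_path_turn Z Ew.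
right; have H1 := zigzag_path_step Z Ew.
have H2 : z'.1 = i.+1 \/ i = z'.1.+1.
  apply: (zigzag_path_step Z (a := map fst a ++ i :: z.1 :: map fst b) (c := map fst c)).
  by rewrite Ew /= map_rcons -cats1 -?catA /= -?catA.
by rewrite -cats1 !count_at_cons !count_at_cat !count_at_cons; lia.
Qed.

(** Inside a zigzag, a path from an end to itself has to come back. *)
Lemma zigzag_path_end d a x b y c i : all letter_ok d -> zigzag_path (map fst d) ->
  d = a ++ x :: b ++ y :: c -> x.1 = i -> y.1 = i -> avoids i b -> i = 0 \/ i = n ->
  1 < count_at (if i == 0 then 1 else n.-1) b.
Proof.
move=> Od Z E xi yi Nb Hi.
have Ob : all letter_ok b by move: Od; rewrite E all_cat /= all_cat => /and5P[].
have [[z [Eb Hz]]|] := zigzag_path_gap Z E xi yi Nb.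
  have /zigzag_path_step := Z; move=> /(_ (map fst a) x.1 z.1 (y.1 :: map fst c)).
  rewrite E Eb !map_cat /= => /(_ erefl).
  by rewrite xi; move: Nb; rewrite Eb /= => /andP[] /eqP; lia.
case: Hi Nb => -> Nb.
  by have := Nb; rewrite avoids_count_at /= => /eqP ->.
have -> : count_at n.+1 b = 0.
  apply/eqP; rewrite -avoids_count_at; apply: sub_all Ob => z /andP[zn _] /=; lia.
have -> : (n == 0) = false by lia.
by rewrite addn0.
Qed.

(** The three ways in which the substitution rules avoid two equal copies of an end around a single
neighbour. *)
Definition end_deco d i := [\/ size (decorations i d) <= 1, alternates (decorations i d)
  | zigzag_path (map fst d)].

Lemma gap_end d a x b y c i : all letter_ok d -> i = 0 \/ i = n ->
  sep i (if i == 0 then 1 else n.-1) (map fst d) -> end_deco d i ->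
  d = a ++ x :: b ++ y :: c -> x.1 = i -> y.1 = i -> avoids i b -> gap_ok x b y.
Proof.
move=> Od Hi S R E xi yi Nb; rewrite /gap_ok xi.
have -> : 0 < i < n = false by lia.
have Ew : map fst d = map fst a ++ i :: map fst b ++ i :: map fst c.
  by rewrite E map_cat /= map_cat /= xi yi.
split.
  have := S _ _ _ Ew; rewrite -avoids_mem => /(_ Nb).
  by rewrite lt0n -avoids_count_at avoids_mem negbK.
move=> C1; case: R => [|A|Z].
- rewrite E deco_cat deco_cons deco_cat deco_cons xi yi eqxx !size_cat /=; lia.
- by rewrite E in A; exact: alternates_opp A xi yi Nb.
- by have := zigzag_path_end Od Z E xi yi Nb Hi; rewrite C1.
Qed.

Lemma gap_sep d a x b y c i : 0 < i < n ->
  sep i i.-1 (map fst d) -> sep i i.+1 (map fst d) ->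
  d = a ++ x :: b ++ y :: c -> x.1 = i -> y.1 = i -> avoids i b -> gap_ok x b y.
Proof.
move=> Hi S1 S2 E xi yi Nb; rewrite /gap_ok xi Hi.
have Ew : map fst d = map fst a ++ i :: map fst b ++ i :: map fst c.
  by rewrite E map_cat /= map_cat /= xi yi.
have Nb' : i \notin map fst b by rewrite -avoids_mem.
have := S1 _ _ _ Ew Nb'; have := S2 _ _ _ Ew Nb'.
have H j : j \in map fst b -> 0 < weight j b.
  move=> jb; apply: leq_trans (count_at_leW _ _).
  by rewrite lt0n -avoids_count_at avoids_mem negbK.
by move=> /H H1 /H H2; apply: (@leq_add 1 1).
Qed.

Lemma weight_low i k d : i < k -> weight i (low k d) = weight i d.
Proof.
move=> ik; elim: d => // x d IH; rewrite weight_cons -IH /low /= -/(low k d).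
by case: ltnP => [|kx]; rewrite ?weight_cons // gtn_eqF // (leq_trans ik).
Qed.

Lemma weight_LPeak i : weight i (LPeak i) = 2.
Proof.
case: i => // i; rewrite LPeak_up weight_cat weight_rev weight_cons weight_up /=; lia.
Qed.

Lemma gap_peak d a x b y c i j : i <= j -> j < n -> low j.+1 d = LPeak j ->
  d = a ++ x :: b ++ y :: c -> x.1 = i -> y.1 = i -> avoids i b -> gap_ok x b y.
Proof.
move=> ij jn L E xi yi Nb; have [i0|i0] := posnP i.
  have : count_at 0 (low j.+1 d) = 1 by rewrite L count_at_LPeak.
  rewrite count_at_low // E !(count_at_cat, count_at_cons) xi yi i0 eqxx; lia.
rewrite /gap_ok xi; have -> : 0 < i < n by lia.
have H : low i b = LPeak i.-1 by apply: (isolated_left_gap L E) => //; lia.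
apply: leq_trans (leq_addr _ _).
by rewrite -(@weight_low i.-1 i) ?H ?weight_LPeak //; lia.
Qed.

Lemma gap_flip d a x b y c i : all letter_ok d -> i <= n ->
  (forall a x b y c, flip n d = a ++ x :: b ++ y :: c -> x.1 = n - i -> y.1 = n - i ->
    avoids (n - i) b -> gap_ok x b y) ->
  d = a ++ x :: b ++ y :: c -> x.1 = i -> y.1 = i -> avoids i b -> gap_ok x b y.
Proof.
move=> Od i_n H E xi yi Nb.
have /and5P[_ Ox Ob Oy _] : [&& all letter_ok a, letter_ok x, all letter_ok b, letter_ok y & all letter_ok c].
  by move: Od; rewrite E all_cat /= all_cat.
have := congr1 (flip n) E; rewrite !(flip_cat, flip_cons) => /H.
rewrite /= xi yi => /(_ erefl erefl); rewrite avoids_flip ?leq_subr // subKn // => /(_ Nb).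
move=> G; have := gap_ok_flip n2 (letter_ok_flip n2 Ox) (ok_flip n2 Ob) _ G.
by rewrite /= xi yi => /(_ erefl); rewrite !flipxK // flipK.
Qed.

(** The two extreme letters of a zigzag word may be decorated freely. *)
Definition zig_deco (d : seq letter) i := forall a x b, d = a ++ x :: b -> x.1 = i -> a <> [::] -> b <> [::] ->
  x.2 = Both.

Lemma zigzag_path_stable d : all letter_ok d -> zigzag_path (map fst d) -> zig_deco d 0 -> zig_deco d n ->
  stable n d.
Proof.
move=> Od Z D0 Dn; split=> // a x b y c E yx Nb.
have Hx : x.1 <= n by move: Od; rewrite E all_cat /= => /and3P[_ /andP[]].
have Ob : all letter_ok b by move: Od; rewrite E all_cat /= all_cat => /and5P[].
rewrite /gap_ok; case: ifP => Hi; last first.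
  have C := zigzag_path_end Od Z E erefl yx Nb (_ : x.1 = 0 \/ x.1 = n).
  by split; [|move=> C1]; (have := C _); rewrite ?C1; lia.
have [[z [Eb Hz]]|] := zigzag_path_gap Z E erefl yx Nb; last first.
  by move=> H; apply: leq_trans H _; apply: leq_add; exact: count_at_leW.
have zB : z.2 = Both.
  have Ez : d = (a ++ [:: x]) ++ z :: (y :: c) by rewrite E Eb -?catA.
  by case: Hz => zi; [apply: (D0 _ _ _ Ez zi)|apply: (Dn _ _ _ Ez zi)] => //; case: (a).
have Hs : x.1 = z.1.+1 \/ z.1 = x.1.+1.
  apply: (zigzag_path_step Z (a := map fst a) (c := y.1 :: map fst c)).
  by rewrite E Eb map_cat.
rewrite Eb !weight_cons /weight1 zB; case: Hs => ->; rewrite ?eqxx /=; lia.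
Qed.

End Converse.

(** * Heaps of words *)

Import Order.TTheory.

Section Iso.
Variable S : Type.

Lemma iso_refl (H : lposet S) : lposet_iso H H.
Proof. by exists id; split=> //; exists id. Qed.

Lemma iso_sym (H K : lposet S) : lposet_iso H K -> lposet_iso K H.
Proof.
move=> [f [[g fK gK] fm fl]]; exists g; split; first by exists f.
  by move=> x y; rewrite -fm !gK.
by move=> x; rewrite -fl gK.
Qed.

Lemma iso_trans (K H L : lposet S) : lposet_iso H K -> lposet_iso K L -> lposet_iso H L.
Proof.
move=> [f [bf fm fl]] [g [bg gm gl]]; exists (g \o f); split.
- exact: bij_comp.
- by move=> x y /=; rewrite gm fm.
- by move=> x /=; rewrite gl fl.
Qed.

Lemma subposet_iso (H K : lposet S) (f : H -> K) (A : {set H}) :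
  bijective f -> {mono f : x y / (x <= y)%O} -> (forall x, label (f x) = label x) ->
  lposet_iso (subposet A) (subposet (f @: A)).
Proof.
move=> [g fK gK] fm fl.
have Pf (x : {x : H | x \in A}) : f (val x) \in f @: A by apply: imset_f; exact: valP.
have Pg (y : {y : K | y \in f @: A}) : g (val y) \in A.
  by case: y => y /= /imsetP[x xA ->]; rewrite fK.
exists (fun x => Sub (f (val x)) (Pf x)); split.
- exists (fun y => Sub (g (val y)) (Pg y)).
    by move=> x; apply: val_inj; rewrite /= fK.
  by move=> x; apply: val_inj; rewrite /= gK.
- by move=> x y; have := fm (val x) (val y).
- by move=> x; rewrite /= fl.
Qed.

End Iso.

Section LinearExtension.
Variables (S : finType) (e : rel S).
Hypothesis esym : symmetric e.

Definition compat (s t : S) := (s == t) || e s t.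

(** In such an enumeration, comparable labels appear in the order of the heap, so that the heap
can be studied as a word, also for subposets of heaps of words. *)
Definition linear_ext (H : lposet S) (l : seq H) :=
  [/\ uniq l, (forall x, x \in l) &
   pairwise (fun x y : H => ~~ (y <= x)%O && (compat (label x) (label y) ==> (x <= y)%O)) l].

Lemma linear_ext_word (w : seq S) : linear_ext (H := heap_of_word e w) (enum (word_pos w)).
Proof.
split; [exact: enum_uniq|by move=> x; rewrite mem_enum|].
have : sorted ltn (map val (enum 'I_(size w))) by rewrite val_enum_ord iota_ltn_sorted.
rewrite sorted_map sorted_pairwise; last by move=> x y z; exact: ltn_trans.
apply: sub_pairwise => i j /= ij; apply/andP; split.
  by apply: contraL ij => /word_le_leq; rewrite -leqNgt.
by apply/implyP => c; apply: connect1; rewrite /word_prec ij.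
Qed.

Lemma word_labels (w : seq S) :
  map (@label S (heap_of_word e w)) (enum (word_pos w)) = w.
Proof. exact: (map_tnth_enum (in_tuple w)). Qed.

Lemma linear_ext_subposet (H : lposet S) (l : seq H) (A : {set H}) : linear_ext l ->
  linear_ext (H := subposet A) (pmap insub l).
Proof.
move=> [Ul Ml Pl]; split.
- by rewrite pmap_sub_uniq.
- by move=> x; rewrite mem_pmap_sub.
have : pairwise (fun x y : H => ~~ (y <= x)%O && (compat (label x) (label y) ==> (x <= y)%O))
   (map val (pmap insub l : seq {x | x \in A})).
  by rewrite (pmap_filter (insubK _)); apply: pairwise_filter.
by rewrite pairwise_map.
Qed.

Lemma labels_subposet (H : lposet S) (l : seq H) (A : {set H}) :
  map (@label S (subposet A)) (pmap insub l) = map (@label S H) (filter (mem A) l).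
Proof.
rewrite -[filter _ _](_ : map val (pmap insub l : seq {x | x \in A}) = _) -?map_comp //.
by rewrite (pmap_filter (insubK _)); apply: eq_filter => x; rewrite isSome_insub.
Qed.

Lemma linear_ext_cat (H : lposet S) (l a b : seq H) x y : linear_ext l -> l = a ++ b -> x \in a -> y \in b ->
  ~~ (y <= x)%O /\ (compat (label x) (label y) -> (x < y)%O).
Proof.
move=> [Ul _ Pl] El xa yb; rewrite El pairwise_cat in Pl.
case/and3P: Pl => /allrelP/(_ _ _ xa yb)/andP[nyx /implyP c] _ _; split=> // /c xy.
by rewrite lt_neqAle xy andbT; apply: contraNneq nyx => ->.
Qed.

Lemma sorted_cat_adj (T : Type) (r : rel T) a x y c :
  sorted r (a ++ x :: y :: c) -> r x y.
Proof.
by case: a => [|z a] /=; [case/andP|rewrite cat_path /= => /and4P[]].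
Qed.

(** Two consecutive elements of the chain of an edge are consecutive in the filtered
linear extension. *)
Lemma alternating_linear_ext (H : lposet S) (l : seq H) (I : {set S}) : linear_ext l ->
  alternating_on e I H <->
  forall s s', s \in I -> s' \in I -> e s s' ->
    sorted (fun p q => p != q) (filter (pred2 s s') (map (@label S H) l)).
Proof.
move=> Ll; have Ml x : x \in l by case: Ll.
have C s s' z z' : e s s' -> label z \in [:: s; s'] -> label z' \in [:: s; s'] ->
    compat (@label S H z) (label z').
  rewrite !inE /compat => ess' /orP[]/eqP-> /orP[]/eqP->; rewrite ?eqxx ?ess' ?orbT //.
  by rewrite esym ess' orbT.
split=> [A s s' sI s'I ess'|A s s' sI s'I ess' x y lx ly xy nz].
  apply: contraT => /not_sorted[u [p [q [v [E]]]]]; rewrite negbK => /eqP pq; subst q.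
  rewrite filter_map in E.
  have [t1 [x [t2 [Et _ xp E2]]]] := map_cons_split E.
  have [t3 [y [t4 [Et3 Et3' yp _]]]] := @map_cons_split _ _ _ _ _ [::] _ E2.
  case: t3 Et3 Et3' => // Et2 _; rewrite {t2 E2}Et2 /= in Et.
  have [a [b1 [El _ E1]]] := filter_cat_split Et.
  have [b2 [b3 [Eb1 F2 E3 Px]]] := filter_cons_split E1.
  have [b4 [c [Eb3 F4 _ Py]]] := filter_cons_split E3.
  have {El Eb1 Eb3}El : l = (a ++ b2) ++ x :: b4 ++ y :: c by rewrite El Eb1 Eb3 catA.
  have Lx : label x \in [:: s; s'] by rewrite !inE; exact: Px.
  have Ly : label y \in [:: s; s'] by rewrite !inE; exact: Py.
  have xy : (x < y)%O.
    have [] := @linear_ext_cat _ _ ((a ++ b2) ++ x :: b4) (y :: c) x y Ll.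
    - by rewrite El -?catA /= -?catA.
    - by rewrite !(mem_cat, inE) eqxx /= ?orbT.
    - by rewrite inE eqxx.
    - by move=> _; apply; exact: C ess' Lx Ly.
  suff /(A s s' sI s'I ess' x y Lx Ly xy) : forall z : H, label z \in [:: s; s'] -> ~~ (x < z < y)%O.
    by rewrite xp yp eqxx.
  move=> z Lz; apply/negP => /andP[xz zy].
  have := Ml z; rewrite El mem_cat => /orP[za|].
    have [] := @linear_ext_cat _ _ (a ++ b2) (x :: b4 ++ y :: c) z x Ll El za.
      by rewrite inE eqxx.
    by rewrite (ltW xz).
  rewrite inE => /orP[/eqP zx|]; first by rewrite zx ltxx in xz.
  rewrite mem_cat => /orP[zb|].
    suff : z \in filter (preim (@label S H) (pred2 s s')) b4 by rewrite F4.
    by rewrite mem_filter zb andbT /=; rewrite !inE in Lz.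
  rewrite inE => /orP[/eqP zy'|zc]; first by rewrite zy' ltxx in zy.
  have [] := @linear_ext_cat _ _ ((a ++ b2) ++ x :: b4 ++ [:: y]) c y z Ll.
  - by rewrite El -?catA /= -?catA.
  - by rewrite !(mem_cat, inE) eqxx /= ?orbT.
  - by [].
  - by rewrite (ltW zy).
have [a [b1 El]] : exists a b1, l = a ++ x :: b1.
  by case/splitPr: (Ml x) => a b1; exists a, b1.
have := Ml y; rewrite El mem_cat inE => /or3P[ya|/eqP yx|yb1].
- have [] := @linear_ext_cat _ _ a (x :: b1) y x Ll El ya; first by rewrite inE eqxx.
  by rewrite (ltW xy).
- by rewrite yx ltxx in xy.
have [b [c Eb1]] : exists b c, b1 = b ++ y :: c.
  by case/splitPr: yb1 => b c; exists b, c.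
have := A s s' sI s'I ess'; rewrite El Eb1 map_cat /= map_cat /= filter_cat /=.
have Lx' : (label x == s) || (label x == s') by rewrite !inE in lx.
have Ly' : (label y == s) || (label y == s') by rewrite !inE in ly.
rewrite Lx' filter_cat /= Ly'.
have -> : filter (pred2 s s') (map (@label S H) b) = [::].
  apply/eqP; rewrite -(negbK (_ == _)) -has_filter; apply/hasP => -[u /mapP[z zb ->] Lz].
  have Lz' : label z \in [:: s; s'] by rewrite !inE.
  have := nz z Lz'; apply/negP; rewrite negbK; apply/andP; split.
    have [] := @linear_ext_cat _ _ (a ++ [:: x]) (b ++ y :: c) x z Ll.
    - by rewrite El Eb1 -?catA /= -?catA.
    - by rewrite !(mem_cat, inE) eqxx /= ?orbT.
    - by rewrite !(mem_cat, inE) zb.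
    - by move=> _; apply; exact: C ess' lx Lz'.
  have [] := @linear_ext_cat _ _ (a ++ x :: b) (y :: c) z y Ll.
  - by rewrite El Eb1 -?catA /= -?catA.
  - by rewrite !(mem_cat, inE) zb /= ?orbT.
  - by rewrite inE eqxx.
  - by move=> _; apply; exact: C ess' Lz' ly.
exact: sorted_cat_adj.
Qed.

Definition chain (w : seq S) := sorted compat w.

Lemma chain_total (w : seq S) : chain w -> forall i j : heap_of_word e w,
  (i <= j)%O = (nat_of_ord i <= nat_of_ord j).
Proof.
move=> cw i j; apply/idP/idP; first exact: word_le_leq.
case: j; case: i => i iw j; elim: j => [|j IH] jw /= ij.
  rewrite leqn0 in ij; rewrite (_ : Ordinal jw = Ordinal iw) ?lexx //.
  by apply: val_inj; rewrite /= (eqP ij).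
rewrite leq_eqVlt in ij; case/orP: ij => [/eqP ij|ij].
  rewrite (_ : Ordinal jw = Ordinal iw) ?lexx //; exact: val_inj.
apply: le_trans (IH (ltnW jw) ij) _; apply: connect1.
rewrite /word_prec /= ltnSn /=.
have x0 : S := tnth (in_tuple w) (Ordinal jw).
have /(sortedP x0) := cw; move=> /(_ j jw).
by rewrite /word_label !(tnth_nth x0).
Qed.

(** The heap of a word whose consecutive letters are equal or adjacent is a chain, and has a unique
linear extension. *)
Lemma chain_iso_eq (H : lposet S) (l : seq H) (w : seq S) : linear_ext l -> chain w ->
  lposet_iso H (heap_of_word e w) -> map (@label S H) l = w.
Proof.
move=> Ll cw [f [[g fK gK] fm fl]].
have [Ul Ml Pl] := Ll.
have Sf : map (fun x => nat_of_ord (f x)) l = iota 0 (size w).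
  apply: (irr_sorted_eq ltn_trans ltnn); last first.
  - move=> i; rewrite mem_iota add0n /=; apply/mapP/idP => [[x _ ->]|iw].
      exact: ltn_ord.
    by exists (g (Ordinal iw)); rewrite ?Ml ?gK.
  - exact: iota_ltn_sorted.
  rewrite sorted_map sorted_pairwise; last by move=> x y z; exact: ltn_trans.
  apply: sub_pairwise Pl => x y /= /andP[nyx _].
  by rewrite ltnNge -(chain_total cw) fm.
case: w => [|x0 w] in cw f g fK gK fm fl Sf *.
  by case: l Ml Sf {Ll Ul Pl}.
rewrite -[RHS](mkseq_nth x0) /mkseq -Sf -map_comp; apply: eq_map => x /=.
by rewrite -fl /= /word_label (tnth_nth x0).
Qed.

Lemma linear_ext_chain_iso (H : lposet S) (l : seq H) (w : seq S) : linear_ext l -> chain w ->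
  map (@label S H) l = w -> lposet_iso H (heap_of_word e w).
Proof.
move=> Ll cw Ew; have [Ul Ml Pl] := Ll.
have Sl : size l = size w by rewrite -Ew size_map.
have Lx x : index x l < size w by rewrite -Sl index_mem.
pose f x : heap_of_word e w := Ordinal (Lx x).
have fi : injective f.
  by move=> x y /(congr1 (@nat_of_ord _)) /= Exy; rewrite -(nth_index x (Ml x)) Exy nth_index.
have cf : #|heap_of_word e w| <= #|H|.
  rewrite [X in X <= _](card_ord (size w)) -Sl -(card_uniqP Ul).
  by apply/subset_leq_card/subsetP.
exists f; split; first exact: inj_card_bij.
  move=> x y; rewrite (chain_total cw) /=.
  have x0 := x; apply/idP/idP => [ij|xy]; last first.
    rewrite leqNgt; apply/negP => yx.
    have := pairwiseP x0 Pl => /(_ _ _ _ _ yx).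
    by rewrite !inE !index_mem !Ml !nth_index // xy => /(_ isT isT).
  have {Lx fi cf f} H1 k : index x l + k < size l -> (x <= nth x0 l (index x l + k))%O.
    elim: k => [|k IH] kl; first by rewrite addn0 nth_index.
    apply: le_trans (IH _) _; first by apply: ltn_trans kl; rewrite addnS.
    have := pairwiseP x0 Pl => /(_ (index x l + k) (index x l + k.+1)).
    rewrite !inE addnS ltnSn => /(_ _ _ isT).
    rewrite addnS in kl; rewrite kl (ltnW kl) => /(_ isT isT)/andP[_ /implyP]; apply.
    have /(sortedP (label x0)) := cw; rewrite -Ew size_map => /(_ _ kl).
    by rewrite !(nth_map x0) // ltnW.
  by have := H1 (index y l - index x l); rewrite subnKC // index_mem nth_index //; apply.
move=> x /=; have s0 := label x; rewrite /word_label (tnth_nth s0) /=.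
by rewrite -[in LHS]Ew (nth_map x) ?index_mem // nth_index.
Qed.

End LinearExtension.

Lemma connect_homo (T U : finType) (e1 : rel T) (e2 : rel U) (f : T -> U) :
  (forall x y, e1 x y -> e2 (f x) (f y)) ->
  forall x y, connect e1 x y -> connect e2 (f x) (f y).
Proof.
move=> H x _ /connectP[p pp ->]; elim: p x pp => [|z p IH] x /=; first by move=> _; exact: connect0.
by move=> /andP[/H xz /IH]; apply: connect_trans; exact: connect1.
Qed.

Section Commutation.
Variables (S : finType) (m : S -> S -> nat).
Hypothesis m1 : forall s, m s s = 1.
Hypothesis mC : forall s t, m s t = m t s.

Definition transp k i := if i == k then k.+1 else if i == k.+1 then k else i.

Lemma swK k : involutive (transp k).
Proof.
move=> i; rewrite /transp; case: (i =P k) => [->|ik]; first by rewrite eqxx gtn_eqF.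
case: (i =P k.+1) => [->|iS]; first by rewrite eqxx.
by rewrite (introF eqP ik) (introF eqP iS).
Qed.

Lemma sw_lt k N i : k.+1 < N -> i < N -> transp k i < N.
Proof. by move=> kN iN; rewrite /transp; case: (i =P k) => ? /=; [|case: (i =P k.+1) => ? /=]; lia. Qed.

Lemma nth_pair s0 (a b : seq S) x y i : nth s0 (a ++ [:: x; y] ++ b) i =
  if i < size a then nth s0 a i else
    if i == size a then x else if i == (size a).+1 then y else nth s0 b (i - (size a).+2).
Proof.
rewrite nth_cat; case: ltnP => // ai.
have [k ->] : exists k, i = size a + k by exists (i - size a); rewrite subnKC.
rewrite addKn; case: k => [|[|k]]; rewrite ?addn0 ?addn1 ?eqxx //=.
  by rewrite gtn_eqF.
do 2![rewrite ifF; last lia].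
by congr nth; lia.
Qed.

Lemma nth_sw s0 (a b : seq S) x y i :
  nth s0 (a ++ [:: y; x] ++ b) (transp (size a) i) = nth s0 (a ++ [:: x; y] ++ b) i.
Proof.
rewrite !nth_pair /transp; case: (eqVneq i (size a)) => [->|ia].
  by rewrite ltnn ltnNge leqnSn /= eqxx gtn_eqF.
case: (eqVneq i (size a).+1) => [->|iS]; first by rewrite ltnn eqxx ltnNge leqnSn.
by rewrite (negPf ia) (negPf iS).
Qed.

Lemma sw_homo s0 (a b : seq S) x y i j : m x y = 2 ->
  compat (edge m) (nth s0 (a ++ [:: x; y] ++ b) i) (nth s0 (a ++ [:: x; y] ++ b) j) ->
  i < j -> transp (size a) i < transp (size a) j.
Proof.
move=> xy C ij; rewrite /transp.
have [Hi|Hi] := eqVneq i (size a); have [Hj|Hj] := eqVneq j (size a).+1.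
- have nxy : ~~ compat (edge m) x y.
    by rewrite /compat /edge xy orbF; apply/eqP => E; rewrite E m1 in xy.
  by move: C; rewrite !nth_pair Hi Hj ltnn eqxx ltnNge leqnSn /= gtn_eqF // eqxx (negPf nxy).
all: by case: (i =P size a) Hi => ? Hi; case: (j =P size a) => ?;
  case: (i =P (size a).+1) => ?; case: (j =P (size a).+1) Hj => ? Hj /=; lia.
Qed.

Section Swap.
Variables (a b : seq S) (x y : S).
Let v := a ++ [:: x; y] ++ b.
Let w := a ++ [:: y; x] ++ b.

Lemma swap_proof (i : 'I_(size v)) : transp (size a) i < size w.
Proof.
have Ev : size v = size w by rewrite /v /w !size_cat.
by apply: sw_lt; rewrite -?Ev ?ltn_ord // /v size_cat /=; lia.
Qed.

Definition swap (i : heap_of_word (edge m) v) : heap_of_word (edge m) w :=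
  Ordinal (swap_proof i).

Lemma label_swap i : label (swap i) = label i.
Proof. by rewrite /= /word_label !(tnth_nth x) /= nth_sw. Qed.

Lemma swap_le i j : m x y = 2 -> (i <= j)%O -> (swap i <= swap j)%O.
Proof.
move=> xy; apply: connect_homo => {}i {}j /andP[ij c]; apply/andP; split.
  apply: (sw_homo (s0 := x) xy _ ij).
  by move: c; rewrite /compat /word_label !(tnth_nth x); exact.
have Ei : word_label (swap i) = word_label i := label_swap i.
have Ej : word_label (swap j) = word_label j := label_swap j.
by rewrite Ei Ej.
Qed.
End Swap.

Lemma swapK a b x y : cancel (@swap a b x y) (@swap a b y x).
Proof. by move=> i; apply: val_inj; rewrite /= swK. Qed.

(** Exchanging two commuting letters transposes two incomparable consecutive
elements. *)
Lemma commutation_iso (v w : seq S) : commutation_equiv m v w ->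
  lposet_iso (heap_of_word (edge m) v) (heap_of_word (edge m) w).
Proof.
elim=> {v w} [_ _ [a b x y xy]|u|u v _|u v w _ + _].
- exists (@swap a b x y); split; last exact: label_swap.
    by exists (@swap a b y x); exact: swapK.
  move=> i j; apply/idP/idP; last exact: swap_le.
  by move=> ij; rewrite -[i]swapK -[j]swapK; apply: swap_le; rewrite // mC.
- exact: iso_refl.
- exact: iso_sym.
- exact: iso_trans.
Qed.

End Commutation.

(** * Invariance of the families under isomorphism *)

Section Transport.
Variables (S : finType) (e : rel S).

Lemma alternating_iso (H K : lposet S) (I : {set S}) : lposet_iso H K ->
  alternating_on e I H -> alternating_on e I K.
Proof.
move=> /iso_sym[f [[g fK gK] fm fl]] A s s' sI s'I ess' x y lx ly xy nz.
rewrite -!fl; apply: (A s s') => //; rewrite ?fl //.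
  by rewrite lt_neqAle fm (can_eq fK) -lt_neqAle.
move=> z lz; have := nz (g z); rewrite -fl gK => /(_ lz).
by apply: contra; rewrite !lt_neqAle -!fm gK -!(inj_eq (can_inj fK)) gK.
Qed.

Lemma restriction_iso (H K : lposet S) (I : {set S}) : lposet_iso H K ->
  lposet_iso (restriction H I) (restriction K I).
Proof.
move=> [f [bf fm fl]]; rewrite /restriction.
have -> : [set x : K | label x \in I] = f @: [set x : H | label x \in I].
  case: (bf) => g fK gK; apply/setP => y; rewrite inE; apply/idP/imsetP => [ly|[x + ->]].
    by exists (g y); rewrite ?gK // inE -fl gK.
  by rewrite inE fl.
exact: subposet_iso.
Qed.

Lemma complement_iso (H K : lposet S) (f : H -> K) (A : {set H}) :
  bijective f -> {mono f : x y / (x <= y)%O} -> (forall x, label (f x) = label x) ->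
  lposet_iso (subposet (~: A)) (subposet (~: (f @: A))).
Proof.
move=> bf fm fl; have -> : ~: (f @: A) = f @: (~: A); last exact: subposet_iso.
case: (bf) => g fK gK; apply/setP => y; rewrite inE -[y]gK.
by rewrite !(mem_imset _ _ (can_inj fK)) inE.
Qed.

End Transport.

Section FamilyTransport.
Variable n : nat.

Lemma none_between_iso (H K : lposet (Ctype n)) j p : lposet_iso H K ->
  none_between H j p -> none_between K j p.
Proof.
move=> /iso_sym[f [[g fK gK] fm fl]] N x y z lx ly lz.
have := N (f x) (f y) (f z); rewrite !fl => /(_ lx ly lz).
by rewrite !lt_neqAle !fm !(can_eq fK).
Qed.

Lemma family_iso (H K : lposet (Ctype n)) X : lposet_iso H K ->
  in_family X H -> in_family X K.
Proof.
move=> HK; have KH := iso_sym HK.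
have L1 j : LP1 H j -> LP1 K j by apply: iso_trans; exact: restriction_iso.
have R1 j : RP1 H j -> RP1 K j by apply: iso_trans; exact: restriction_iso.
have L2 j : LP2 H j -> LP2 K j by exact: none_between_iso.
have R2 j : RP2 H j -> RP2 K j by exact: none_between_iso.
have [f [bf fm fl]] := HK.
case: X => /=.
- exact: alternating_iso.
- move=> [[w [zw Hw]] [i Hi]]; split; first by exists w; split=> //; exact: iso_trans Hw.
  exists i; apply: leq_trans Hi _; rewrite -(card_imset _ (bij_inj bf)).
  apply/subset_leq_card/subsetP => y /imsetP[x]; rewrite !inE => lx ->.
  by rewrite fl.
- move=> [j [/L1 H1 /L2 H2 [x [lx A]]]]; exists j; split=> //.
  exists (f x); rewrite fl; split=> //; apply: alternating_iso A.
  by rewrite /delete -imset_set1; exact: complement_iso.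
- move=> [j [/R1 H1 /R2 H2 [x [lx A]]]]; exists j; split=> //.
  exists (f x); rewrite fl; split=> //; apply: alternating_iso A.
  by rewrite /delete -imset_set1; exact: complement_iso.
move=> [j [k [jk [/L1 H1 /L2 H2] [/R1 H3 /R2 H4] [x [y [lx ly A]]]]]].
exists j, k; split=> //; exists (f x), (f y); rewrite !fl; split=> //.
apply: alternating_iso A; rewrite /delete.
have -> : [set f x; f y] = f @: [set x; y] by rewrite imsetU !imset_set1.
exact: complement_iso.
Qed.

End FamilyTransport.

(** * Words of type affine C as words of positions *)

Lemma edge_pos (L R : finType) n a b (v w : vertex L R n) : 2 < a -> 2 < b ->
  edge (path_matrix a b) v w = (pos v == (pos w).+1) || (pos w == (pos v).+1).
Proof.
move=> a2 b2; rewrite /edge /path_matrix; case: eqP => [->|_].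
  by rewrite /= orbb; apply/esym/negbTE; rewrite neq_ltn ltnSn.
by case: ifP => //; case: v => [[]|]; case: w => [[]|].
Qed.

Definition walt i (u : seq nat) := sorted (fun p q => p != q) (filter (pred2 i i.+1) u).

Lemma alternates_at_walt i d : alternates_at i d = walt i (map fst d).
Proof. by rewrite /alternates_at /walt filter_map sorted_map. Qed.

Section Cwords.
Variable n : nat.
Hypothesis n2 : 2 <= n.
Notation C := (Ctype n).
Notation eC := (edge (@cox_C n)).
Notation cpos := (@pos unit unit n).

Lemma cpos_le (v : C) : cpos v <= n.
Proof. by case: v => [[[]|i]|[]] //=; have := ltn_ord i; lia. Qed.

Lemma cpos_inj : injective cpos.
Proof.
move=> [[[]|i]|[]] [[[]|j]|[]] //=; try by lia.
- by case=> /val_inj ->.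
- by have := ltn_ord i; lia.
- by have := ltn_ord j; lia.
Qed.

Lemma eC_sym : symmetric eC.
Proof. by move=> v w; rewrite !edge_pos // orbC. Qed.

Lemma map_cpos_inj : injective (map cpos).
Proof. exact/inj_map/cpos_inj. Qed.

Lemma chain_cpos (w : seq C) :
  sorted (fun p q => (p == q.+1) || (q == p.+1)) (map cpos w) -> chain eC w.
Proof.
rewrite sorted_map; apply: sub_sorted => v v' /=.
by rewrite /compat edge_pos // => ->; rewrite orbT.
Qed.

Lemma sorted_labels (s s' : C) (u : seq C) :
  sorted (fun p q => p != q) (filter (pred2 s s') u) =
  sorted (fun p q => p != q) (filter (pred2 (cpos s) (cpos s')) (map cpos u)).
Proof.
rewrite filter_map sorted_map.
have -> : filter (preim cpos (pred2 (cpos s) (cpos s'))) u = filter (pred2 s s') u.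
  by apply: eq_filter => v /=; rewrite !(inj_eq cpos_inj).
by apply: eq_sorted => v v' /=; rewrite (inj_eq cpos_inj).
Qed.

Definition vtx (i : nat) : C :=
  if i == 0 then tC n else if insub i.-1 is Some k then sC k else uC n.

Lemma pos_vtx i : i <= n -> cpos (vtx i) = i.
Proof.
move=> i_n; rewrite /vtx; case: eqP => [->//|i0].
case: insubP => [k _ Ek|Hk]; rewrite /cpos /=; first by have : val k = i.-1 := Ek; move=> /= ->; lia.
by lia.
Qed.

Lemma alternating_between_walt (H : lposet C) (l : seq H) a b : linear_ext eC l ->
  alternating_between a b H <->
  forall i, a <= i -> i < b -> i < n -> walt i (map cpos (map (@label C H) l)).
Proof.
move=> Ll; rewrite /alternating_between (alternating_linear_ext eC_sym _ Ll).
split=> [A i ai ib i_n|A s s'].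
  have P1 := pos_vtx (ltnW i_n); have P2 := pos_vtx i_n.
  have := A (vtx i) (vtx i.+1); rewrite sorted_labels !inE edge_pos // P1 P2 eqxx orbT.
  by apply=> //; lia.
move=> sI s'I; rewrite sorted_labels edge_pos // => ss'.
have /andP[as_ sb] : a <= cpos s <= b by rewrite inE in sI.
have /andP[as' s'b] : a <= cpos s' <= b by rewrite inE in s'I.
case/orP: ss' => /eqP E.
  have := A (cpos s') as'; rewrite /walt -E => /(_ _ _).
  rewrite (eq_filter (a2 := pred2 (cpos s) (cpos s'))); last by move=> z /=; rewrite orbC.
  by apply; have := cpos_le s; lia.
by have := A (cpos s) as_; rewrite /walt -E; apply; have := cpos_le s'; lia.
Qed.

Lemma is_ALT_walt (H : lposet C) (l : seq H) : linear_ext eC l ->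
  is_ALT H <-> forall i, i < n -> walt i (map cpos (map (@label C H) l)).
Proof.
move=> Ll; have -> : is_ALT H = alternating_between 0 n H.
  congr alternating_on; apply/setP => v; rewrite !inE /=; apply/esym.
  exact: cpos_le.
rewrite (alternating_between_walt _ _ Ll); split=> A i; first by move=> i_n; apply: A.
by move=> *; apply: A.
Qed.

Lemma map_s_up : map cpos (s_up n) = iota 1 n.-1.
Proof.
rewrite /s_up -map_comp -[1]addn0 iotaDl -[in RHS]val_enum_ord -map_comp.
exact: eq_map.
Qed.

Lemma filter_le_iota N (k : nat) : k < N -> filter (fun i => i <= k) (iota 0 N) = iota 0 k.+1.
Proof.
move=> kN; have -> : N = k.+1 + (N - k.+1) by lia.
rewrite iotaD filter_cat; have /all_filterP -> : all (fun i => i <= k) (iota 0 k.+1).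
  by apply/allP => i; rewrite mem_iota; lia.
rewrite (_ : filter _ _ = [::]) ?cats0 //; apply/eqP; rewrite -(negbK (_ == _)) -has_filter.
by apply/hasPn => i; rewrite mem_iota; lia.
Qed.

Lemma filter_ge_iota N (k : nat) : k < N -> filter (fun i => k <= i) (iota 0 N) = iota k (N - k).
Proof.
move=> kN; have {1}-> : N = k + (N - k) by lia.
rewrite iotaD filter_cat; have /all_filterP -> : all (fun i => k <= i) (iota (0 + k) (N - k)).
  by apply/allP => i; rewrite mem_iota; lia.
rewrite (_ : filter _ _ = [::]) //; apply/eqP; rewrite -(negbK (_ == _)) -has_filter.
by apply/hasPn => i; rewrite mem_iota; lia.
Qed.

Lemma map_s_sub (p : pred nat) :
  map cpos [seq sC k | k : 'I_n.-1 <- enum 'I_n.-1 & p k] = map succn (filter p (iota 0 n.-1)).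
Proof.
rewrite -map_comp -[in RHS]val_enum_ord filter_map -map_comp.
exact: eq_map.
Qed.

Lemma map_s_up_to (j : 'I_n.-1) : map cpos (s_up_to j) = iota 1 j.+1.
Proof.
by rewrite (map_s_sub (fun k => k <= j)) filter_le_iota // -[succn]/(addn 1) -iotaDl.
Qed.

Lemma map_s_up_from (j : 'I_n.-1) : map cpos (s_up_from j) = iota j.+1 (n - j.+1).
Proof.
rewrite (map_s_sub (fun k => j <= k)) filter_ge_iota // -[succn]/(addn 1) -iotaDl.
by congr iota; have := ltn_ord j; lia.
Qed.

Definition wP_left (j : 'I_n.-1) := s_down_from j ++ [:: tC n] ++ s_up_to j.
Definition wP_right (j : 'I_n.-1) := s_up_from j ++ [:: uC n] ++ s_down_to j.

Lemma map_wP_left j : map cpos (wP_left j) = map fst (LPeak j.+1).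
Proof.
by rewrite LPeak_up map_cat /= map_rev !map_up /wP_left !map_cat map_rev map_s_up_to.
Qed.

Lemma map_wP_right (j : 'I_n.-1) : map cpos (wP_right j) = map fst (flip n (LPeak (n - j.+1))).
Proof.
have jn := ltn_ord j; rewrite flip_LPeak //; last lia.
have -> : n - (n - j.+1) = j.+1 by lia.
by rewrite map_cat /= map_rev !map_up /wP_right !map_cat map_rev map_s_up_from.
Qed.

Definition wzig : seq nat := 0 :: iota 1 n.-1 ++ n :: rev (iota 1 n.-1).

Lemma map_zigzag : map cpos (zigzag n) = wzig.
Proof. by rewrite /zigzag !map_cat /= map_rev map_s_up. Qed.

Definition adj (p q : nat) := (p == q.+1) || (q == p.+1).

Lemma adj_LPeak i : path adj i.+1 (rcons (map fst (LPeak i)) i.+1).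
Proof.
elim: i => [|i IH] //=.
by rewrite map_rcons rcons_path IH last_rcons /adj /= eqxx ?orbT.
Qed.

Lemma sorted_LPeak i : sorted adj (map fst (LPeak i)).
Proof. by case: i => //= i; rewrite map_rcons; exact: adj_LPeak. Qed.

Lemma sorted_flip d : all (letter_ok n) d -> sorted adj (map fst d) ->
  sorted adj (map fst (flip n d)).
Proof.
move=> Od; rewrite -map_comp !sorted_map.
elim: d Od => //= x [|y d] IH //= /andP[/andP[xn _] Od] /andP[xy /(IH Od)].
have /andP[/andP[yn _] _] := Od; move=> S; apply/andP; split; last exact: S.
by move: xy; rewrite /adj /=; lia.
Qed.

End Cwords.

Section Zigzag.
Variable n : nat.
Hypothesis n2 : 2 <= n.
Notation C := (Ctype n).
Notation eC := (edge (@cox_C n)).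
Notation cpos := (@pos unit unit n).

(** The position of the k-th letter of the infinite zigzag, which has period 2 n. *)
Definition zigzag_pos (k : nat) := let r := k %% (n + n) in if r <= n then r else n + n - r.

Lemma zigzag_pos_period k : zigzag_pos (n + n + k) = zigzag_pos k.
Proof. by rewrite /zigzag_pos modnDl. Qed.

Lemma zigzag_pos_small k : k < n + n -> zigzag_pos k = if k <= n then k else n + n - k.
Proof. by move=> kn; rewrite /zigzag_pos modn_small. Qed.

Lemma zigzag_pos_shift k : exists r, r < n + n /\ forall i, zigzag_pos (k + i) = zigzag_pos (r + i).
Proof.
exists (k %% (n + n)); split; first by rewrite ltn_mod; lia.
by move=> i; rewrite /zigzag_pos modnDml.
Qed.

Lemma zigzag_pos_le k : zigzag_pos k <= n.
Proof. by rewrite /zigzag_pos; case: ifP => //; lia. Qed.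

Lemma zzn3 r i : r < n + n -> i < 3 -> zigzag_pos (r + i) =
  if r + i <= n then r + i else if r + i <= n + n then n + n - (r + i) else r + i - (n + n).
Proof.
move=> rn i3; have [ri|ri] := ltnP (r + i) (n + n).
  by rewrite zigzag_pos_small // (ltnW ri).
have -> : r + i = n + n + (r + i - (n + n)) by lia.
rewrite zigzag_pos_period zigzag_pos_small; last lia.
rewrite ifT; last lia.
rewrite ifF; last lia.
by case: leqP => ?; lia.
Qed.

Lemma zigzag_pos_T3 k : turn_at_end n (zigzag_pos k) (zigzag_pos k.+1) (zigzag_pos k.+2).
Proof.
have [r [rn Hr]] := zigzag_pos_shift k.
have := Hr 0; have := Hr 1; have := Hr 2.
rewrite !(zzn3 rn) // [k + 0]addn0 [k + 1]addn1 [k + 2]addn2 => -> -> ->; rewrite /turn_at_end.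
by do ?case: leqP => ?; lia.
Qed.

Lemma zigzag_pos_step k : zigzag_pos k = (zigzag_pos k.+1).+1 \/ zigzag_pos k.+1 = (zigzag_pos k).+1.
Proof. by have [] := zigzag_pos_T3 k. Qed.

Lemma wzig_zigzag_pos : wzig n = mkseq zigzag_pos (n + n).
Proof.
have Sw : size (wzig n) = n + n by rewrite /wzig /= size_cat /= size_rev !size_iota; lia.
apply: (@eq_from_nth _ 0); rewrite ?size_mkseq // => i; rewrite Sw => i_n.
rewrite nth_mkseq // zigzag_pos_small //.
have -> : wzig n = iota 0 n ++ n :: rev (iota 1 n.-1) by rewrite /wzig; case: (n) n2.
rewrite nth_cat size_iota; case: ltnP => Hi; first by rewrite nth_iota // (ltnW Hi).
have [->|ni] := eqVneq i n; first by rewrite subnn leqnn.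
have -> : i - n = (i - n.+1).+1 by lia.
rewrite /= nth_rev size_iota ?nth_iota; try lia.
by rewrite ifF; lia.
Qed.

Lemma power_zigzag_pos N : map cpos (flatten (nseq N (zigzag n))) = mkseq zigzag_pos (N * (n + n)).
Proof.
elim: N => // N IH.
have -> : flatten (nseq N.+1 (zigzag n)) = zigzag n ++ flatten (nseq N (zigzag n)) by [].
rewrite map_cat IH map_zigzag // wzig_zigzag_pos mulSn /mkseq [iota 0 (n + n + _)]iotaD map_cat.
congr (_ ++ _); rewrite add0n -[in iota (n + n)](addn0 (n + n)) iotaDl -map_comp.
by apply: eq_map => k /=; rewrite zigzag_pos_period.
Qed.

Lemma infix_zigzag_path (a u c : seq nat) N : mkseq zigzag_pos N = a ++ u ++ c -> zigzag_path n u.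
Proof.
move=> E; have SN : size a + size u <= N.
  by rewrite -(size_mkseq zigzag_pos N) E !size_cat; lia.
have Nu i : i < size u -> nth 0 u i = zigzag_pos (size a + i).
  move=> iu; rewrite -(nth_mkseq 0 zigzag_pos (_ : size a + i < N)); last lia.
  by rewrite E nth_catD nth_cat iu.
split=> k ku; rewrite !Nu ?addnS; try lia; [exact: zigzag_pos_step|exact: zigzag_pos_T3].
Qed.

(** A path which turns only at the ends is determined by its first two positions. *)
Lemma zigzag_path_zigzag_pos u : zigzag_path n u -> all (fun i => i <= n) u -> 1 < size u ->
  exists k, u = mkseq (fun i => zigzag_pos (k + i)) (size u).
Proof.
move=> [Z1 Z2] Au u1.
have Hu i : i < size u -> nth 0 u i <= n by move=> iu; apply: (allP Au); rewrite mem_nth.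
have [k [K0 K1]] : exists k, nth 0 u 0 = zigzag_pos (k + 0) /\ nth 0 u 1 = zigzag_pos (k + 1).
  have := Z1 0 u1; have := Hu 0 (ltnW u1); have := Hu 1 u1.
  move: (nth 0 u 0) (nth 0 u 1) => p q qn pn [pq|pq].
    exists (n + n - p); rewrite !zzn3; try lia.
    by do ?case: leqP => ?; lia.
  by exists p; rewrite !zzn3; try lia; do ?case: leqP => ?; lia.
exists k; apply: (@eq_from_nth _ 0); rewrite ?size_mkseq // => i iu.
rewrite nth_mkseq //.
suff H : forall j, j.+1 < size u -> nth 0 u j = zigzag_pos (k + j) /\ nth 0 u j.+1 = zigzag_pos (k + j.+1).
  have [ii|ii] := ltnP i.+1 (size u); first by have [] := H i ii.
  have Ei : i = i.-1.+1 by lia.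
  by rewrite Ei; have [] // := H i.-1; rewrite -Ei.
elim=> [|j IH] ju; first by [].
have [H1 H2] := IH (ltnW ju); split=> //.
have := Z2 j ju; have := zigzag_pos_T3 (k + j); have := zigzag_pos_le (k + j).+2; have := Hu j.+2 ju.
rewrite H1 H2 !addnS; have := zigzag_pos_le (k + j).
move: (zigzag_pos _) (zigzag_pos _) (zigzag_pos _) (nth 0 u j.+2) => p q r r'.
by rewrite /turn_at_end; lia.
Qed.

Lemma zigzag_factor_zigzag_path (w : seq C) : zigzag_factor w -> zigzag_path n (map cpos w).
Proof.
move=> [N /infixP[s [s' E]]]; have := power_zigzag_pos N; rewrite E !map_cat => /esym.
exact: infix_zigzag_path.
Qed.

Lemma zigzag_path_zigzag_factor (w : seq C) : zigzag_path n (map cpos w) -> 1 < size w -> zigzag_factor w.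
Proof.
move=> Z w1; have [||k Ek] := zigzag_path_zigzag_pos Z; rewrite ?size_map //.
  by apply/allP => i /mapP[v _ ->]; exact: cpos_le.
rewrite size_map in Ek.
exists (k + size w); apply/infixP.
have E := power_zigzag_pos (k + size w).
have HM : k + size w <= (k + size w) * (n + n) by rewrite leq_pmulr //; lia.
move: E; rewrite -(subnKC HM) {1}/mkseq -addnA iotaD iotaD !map_cat !add0n.
move=> /map_cat_split[u1 [u23 [-> _]]] /map_cat_split[u2 [u3 [-> E2 _]]].
exists u1, u3; congr (_ ++ (_ ++ _)); apply: (map_cpos_inj n2).
rewrite E2 Ek /mkseq -[in iota k _](addn0 k) iotaDl -map_comp.
by apply: eq_map.
Qed.

Lemma card_label (w : seq C) s :
  #|[set x : heap_of_word eC w | label x == s]| = count_mem s w.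
Proof.
have [U M _] := linear_ext_word eC w.
rewrite -[in RHS](word_labels eC w) count_map -size_filter.
rewrite -(card_uniqP (filter_uniq _ U)); apply: eq_card => x.
by rewrite inE mem_filter M andbT.
Qed.

Lemma count_cpos (w : seq C) s d : map fst d = map cpos w -> count_mem s w = count_at (cpos s) d.
Proof.
move=> E; rewrite /count_at -(count_map fst (pred1 (cpos s))) E count_map.
by apply: eq_count => v /=; rewrite (inj_eq (cpos_inj n2)).
Qed.

Lemma none_between_word (w : seq C) (i : 'I_n.-1) (p : nat) a b c :
  map cpos w = a ++ i.+1 :: b ++ i.+1 :: c -> i.+1 \notin a -> i.+1 \notin b ->
  i.+1 \notin c -> p \notin b -> none_between (heap_of_word eC w) i p.
Proof.
move=> E Na Nb Nc Np x y z lx ly lz.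
have Sw : size w = size a + (size b + (size c).+1).+1.
  by rewrite -(size_map cpos) E size_cat /= size_cat.
have Hn (v : heap_of_word eC w) : cpos (label v) = nth 0 (map cpos w) (nat_of_ord v).
  have v0 := label v; rewrite (nth_map v0) ?ltn_ord //.
  by rewrite /= /word_label (tnth_nth v0).
have Hj (v : heap_of_word eC w) : label v = sC i ->
    nat_of_ord v = size a \/ nat_of_ord v = size a + (size b).+1.
  move=> lv; have := Hn v; rewrite lv E nth_cat /=.
  case: ltnP => va Ei; first by move: Na; rewrite Ei mem_nth.
  have [k Ek] : exists k, nat_of_ord v = size a + k by exists (v - size a); rewrite subnKC.
  rewrite Ek addKn in Ei *; case: k Ei Ek => [|k] /= Ei Ek; first by left; rewrite addn0.
  move: Ei; rewrite nth_cat; case: ltnP => kb Ei; first by move: Nb; rewrite Ei mem_nth.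
  have [l El] : exists l, k = size b + l by exists (k - size b); rewrite subnKC.
  rewrite El addKn in Ei; case: l El Ei => [|l] El /= Ei; first by right; lia.
  have : (nat_of_ord v) < size w by exact: ltn_ord.
  rewrite Ek El Sw => vw; move: Nc; rewrite Ei mem_nth //; by move: vw; rewrite ltn_add2l ltnS ltn_add2l ltnS.
apply/negP => /andP[xz zy].
have lt_pos (u v : heap_of_word eC w) : (u < v)%O -> nat_of_ord u < nat_of_ord v.
  rewrite lt_neqAle => /andP[uv /word_le_leq]; rewrite leq_eqVlt => /orP[/eqP E'|//].
  by rewrite (val_inj E' : u = v) eqxx in uv.
have := lt_pos _ _ xz; have := lt_pos _ _ zy => zy' xz'.
have := Hn z; rewrite lz E nth_cat.
have Hz : size a < nat_of_ord z < size a + (size b).+1 by have := Hj x lx; have := Hj y ly; lia.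
move: (nat_of_ord z) Hz => iz Hz.
rewrite ifF; last lia.
have [k Ek] : exists k, iz = size a + k.+1 by exists (iz - (size a).+1); lia.
have kb : k < size b by lia.
by rewrite Ek addKn /= nth_cat kb => Ep; move: Np; rewrite Ep mem_nth.
Qed.

Lemma del_first (T : eqType) (f : T -> nat) (l : seq T) d j : uniq l ->
  map f l = map fst d -> 0 < count_at j d ->
  exists x, [/\ x \in l, f x = j & map f (filter (predC1 x) l) = map fst (drop_first j d)].
Proof.
move=> U E; rewrite lt0n -avoids_count_at => /has_split[a [z [c [Ed zj Na]]]].
move: E; rewrite Ed map_cat /= => E.
have [a' [x [c' [El Ea xz Ec]]]] := map_cons_split E.
exists x; split; first by rewrite El mem_cat inE eqxx orbT.
  by rewrite xz.
move: U; rewrite El cat_uniq /= negb_or => /and4P[_ /andP[xa _] xc _].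
rewrite drop_first_cat // map_cat -Ea -Ec filter_cat /= eqxx /= -map_cat; congr map.
by congr cat; apply/all_filterP/allP => v /=; apply: contraTneq => ->.
Qed.

(** * The family of a stable word *)

Lemma low_word (w : seq C) d j : map fst d = map cpos w ->
  map cpos (filter (fun v => cpos v < j) w) = map fst (low j d).
Proof. by move=> E; rewrite -(filter_map cpos (fun i => i < j)) -E /low filter_map. Qed.

Lemma map_fst_flip d : map fst (flip n d) = map (subn n) (map fst d).
Proof. by rewrite /flip -!map_comp. Qed.

Lemma high_word (w : seq C) d j : map fst d = map cpos w -> all (letter_ok n) d ->
  j <= n -> map cpos (filter (fun v => j <= cpos v) w) = map fst (flip n (low (n - j).+1 (flip n d))).
Proof.
move=> E Od jn; rewrite -(filter_map cpos (fun i => j <= i)) -E.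
elim: d Od {E} => //= x d IH /andP[/andP[xn _] /IH ->].
have -> : (n - x.1 < (n - j).+1) = (j <= x.1) by lia.
by case: ifP => //= _; rewrite subKn.
Qed.

(** The restriction is isomorphic to the chain of the peak, hence has the same word. *)
Lemma LP1_word (w : seq C) d (j : 'I_n.-1) : map fst d = map cpos w ->
  LP1 (heap_of_word eC w) j <-> map fst (low j.+2 d) = map fst (LPeak j.+1).
Proof.
move=> E; have Lw := linear_ext_word eC w.
have Ls := linear_ext_subposet [set x : heap_of_word eC w | label x \in labels_between n 0 (pos (@sC n j))] Lw.
have CP : chain eC (wP_left j) by apply: chain_cpos => //; rewrite map_wP_left //; exact: sorted_LPeak.
have El : map (@label C (restriction (heap_of_word eC w) (labels_between n 0 (pos (@sC n j)))))
    (pmap insub (enum (word_pos w))) = filter (fun v => cpos v < j.+2) w.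
  rewrite labels_subposet -[in RHS](word_labels eC w) [RHS]filter_map; congr map.
  by apply: eq_filter => x /=; rewrite !inE.
split=> [iso|L].
  by have := chain_iso_eq Ls CP iso; rewrite El -(low_word _ E) => ->; rewrite map_wP_left.
apply: (linear_ext_chain_iso Ls CP); rewrite El; apply: (map_cpos_inj n2).
by rewrite (low_word _ E) L map_wP_left.
Qed.

Lemma RP1_word (w : seq C) d (k : 'I_n.-1) : map fst d = map cpos w -> all (letter_ok n) d ->
  RP1 (heap_of_word eC w) k <->
  map fst (low (n - k.+1).+1 (flip n d)) = map fst (LPeak (n - k.+1)).
Proof.
move=> E Od; have Lw := linear_ext_word eC w; have kn := ltn_ord k.
have Ls := linear_ext_subposet [set x : heap_of_word eC w | label x \in labels_between n (pos (@sC n k)) n] Lw.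
have OL : all (letter_ok n) (LPeak (n - k.+1)).
  have : forall i, i < n -> all (letter_ok n) (LPeak i).
    elim=> [|i IH] /= i_n; first by rewrite /letter_ok.
    by rewrite -cats1 all_cat IH ?(ltnW i_n) //= andbT /letter_ok /=; lia.
  by apply; lia.
have CP : chain eC (wP_right k).
  by apply: chain_cpos => //; rewrite map_wP_right //; apply: sorted_flip => //; exact: sorted_LPeak.
have El : map (@label C (restriction (heap_of_word eC w) (labels_between n (pos (@sC n k)) n)))
    (pmap insub (enum (word_pos w))) = filter (fun v => k.+1 <= cpos v) w.
  rewrite labels_subposet -[in RHS](word_labels eC w) [RHS]filter_map; congr map.
  by apply: eq_filter => x /=; rewrite !inE cpos_le // andbT.
have Eh := high_word E Od (_ : k.+1 <= n).
have inj (a b : seq letter) : all (fun i => i <= n) (map fst a) -> all (fun i => i <= n) (map fst b) ->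
    map fst (flip n a) = map fst (flip n b) -> map fst a = map fst b.
  have id_in u : all (fun i => i <= n) u -> map (subn n) (map (subn n) u) = u.
    by move=> /allP Hu; rewrite -map_comp; apply: map_id_in => i /Hu /= ?; rewrite subKn.
  by rewrite !map_fst_flip => Ha Hb /(congr1 (map (subn n))); rewrite !id_in.
have Al : all (fun i => i <= n) (map fst (low (n - k.+1).+1 (flip n d))).
  apply: ok_word; have := ok_flip n2 Od.
  by elim: (flip n d) => //= y u IH /andP[Oy /IH Ou]; case: ifP => //= _; rewrite Oy.
have AL : all (fun i => i <= n) (map fst (LPeak (n - k.+1))) by exact: ok_word.
have {}Eh : map cpos (filter (fun v => k.+1 <= cpos v) w) =
    map fst (flip n (low (n - k.+1).+1 (flip n d))) by apply: Eh; lia.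
split=> [iso|L].
  apply: inj => //; rewrite -Eh -map_wP_right // -El.
  by congr map; exact: chain_iso_eq Ls CP iso.
apply: (linear_ext_chain_iso Ls CP); rewrite El; apply: (map_cpos_inj n2).
by rewrite Eh map_wP_right // !map_fst_flip L.
Qed.

End Zigzag.

Section Families.
Variable n : nat.
Hypothesis n2 : 2 <= n.
Notation C := (Ctype n).
Notation eC := (edge (@cox_C n)).
Notation cpos := (@pos unit unit n).

Lemma zigzag_word_zigzag_path u : zigzag_word n u -> 2 < size u -> zigzag_path n u.
Proof.
move=> Z u3; split=> // k ku; have [k3|k3] := ltnP k.+2 (size u).
  by have [] := Z k k3.
by case: k ku k3 => [|k] ku k3; [lia|have [_ []] := Z k ku].
Qed.

Lemma isolated_right_split k d : 0 < k < n -> all (letter_ok n) d -> isolated_right n k d ->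
  exists a x b y c, [/\ d = a ++ x :: b ++ y :: c, x.1 = k /\ y.1 = k,
    avoids k a /\ avoids k c, avoids k b & avoids k.-1 b].
Proof.
move=> Hk Od I; have k0 : 0 < n - k by lia.
have kn : k <= n by lia.
have k1 : k.-1 <= n by lia.
have Ek : n - k.-1 = (n - k).+1 by lia.
have kk : n - (n - k) = k by exact: subKn.
have [a [x [b [y [c [E [xk yk] [Na Nc] N1 N2]]]]]] := isolated_left_split n2 k0 I.
have E' := congr1 (flip n) E; rewrite (flipK Od) !(flip_cat, flip_cons) in E'.
have Ofd := ok_flip n2 Od.
have /and5P[Oa Ox Ob Oy Oc] : [&& all (letter_ok n) a, letter_ok n x, all (letter_ok n) b,
    letter_ok n y & all (letter_ok n) c].
  by move: Ofd; rewrite E all_cat /= all_cat.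
exists (flip n a), (flipx n x), (flip n b), (flipx n y), (flip n c).
by split; rewrite ?avoids_flip ?Ek //= xk yk kk.
Qed.

Lemma word_split (w : seq C) (d a b c : seq letter) x y j p : map fst d = map cpos w ->
  d = a ++ x :: b ++ y :: c -> x.1 = j -> y.1 = j -> avoids j a -> avoids j c -> avoids j b -> avoids p b ->
  [/\ map cpos w = map fst a ++ j :: map fst b ++ j :: map fst c,
      j \notin map fst a, j \notin map fst b, j \notin map fst c & p \notin map fst b].
Proof. by move=> <- -> xj yj; rewrite !avoids_mem => *; rewrite map_cat /= map_cat /= xj yj. Qed.

Lemma delete_labels (w : seq C) (A : {set heap_of_word eC w}) :
  map (@label C (delete A)) (pmap insub (enum (word_pos w))) =
  map (@label C (heap_of_word eC w)) (filter (fun v => v \notin A) (enum (word_pos w))).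
Proof.
rewrite labels_subposet; congr map; apply: eq_filter => v /=; by rewrite inE.
Qed.

Lemma enum_labels (w : seq C) (d : seq letter) : map fst d = map cpos w ->
  map (fun x : heap_of_word eC w => cpos (label x)) (enum (word_pos w)) = map fst d.
Proof. by move=> ->; rewrite -[in RHS](word_labels eC w) -[RHS]map_comp. Qed.

(** Each shape is the reading of the definition of a family on the linear extension of the heap
given by the word. *)
Lemma shape_family (w : seq C) d X : stable n d -> shape n d X -> map fst d = map cpos w ->
  in_family X (heap_of_word eC w).
Proof.
move=> St Sh E; have Od := stable_ok St; have Lw := linear_ext_word eC w.
have U : uniq (enum (word_pos w)) := enum_uniq _.
have En := enum_labels E.
have one (x : heap_of_word eC w) :
    filter (fun v => v \notin [set x]) (enum (word_pos w)) =
    filter (predC1 x) (enum (word_pos w)).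
  by apply: eq_filter => v; rewrite inE.
case: Sh => [A|[Z [i [Hi H3]]]|j Hj I A|k Hk J A|j k jk kn I J A] /=.
- apply/(is_ALT_walt n2 Lw) => i i_n; rewrite word_labels -E -alternates_at_walt; exact: A.
- have szd : 2 < size d by apply: leq_trans H3 (count_size _ _).
  have Zs : zigzag_path n (map cpos w) by rewrite -E; apply: zigzag_word_zigzag_path; rewrite ?size_map.
  split.
    exists w; split; last exact: iso_refl.
    by apply: zigzag_path_zigzag_factor => //; rewrite -(size_map cpos) -E size_map; lia.
  have iP : i.-1 < n.-1 by lia.
  exists (Ordinal iP); rewrite card_label (count_cpos n2 _ E) /=.
  by have -> : i.-1.+1 = i by lia.
- have jP : j.-1 < n.-1 by lia.
  have Ej : (nat_of_ord (Ordinal jP)).+1 = j by rewrite /=; lia.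
  have j0 : 0 < j by lia.
  exists (Ordinal jP); split.
  + by apply/(LP1_word n2 _ E); rewrite Ej; case: I => ->.
  + have [a [x [b [y [c [Ed [xj yj] [Na Nc] N1 N2]]]]]] := isolated_left_split n2 j0 I.
    have [Ew Ma Mb Mc Mp] := word_split E Ed xj yj Na Nc N1 N2.
    rewrite /LP2 [pos _]Ej; apply: (none_between_word n2 (a := map fst a) (b := map fst b) (c := map fst c)); rewrite ?Ej //.
  have C0 : 0 < count_at j d by rewrite (isolated_left_count_at j0 I).
  have [x [xl xj Ex]] := del_first U En C0.
  exists x; split; first by apply: (cpos_inj n2); rewrite xj; exact: esym Ej.
  apply/(alternating_between_walt n2 _ _ (linear_ext_subposet _ Lw)) => i; rewrite [pos _]Ej => ji _ i_n.
  by rewrite delete_labels -map_comp one Ex -alternates_at_walt; apply: A; rewrite ji.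
- have kP : k.-1 < n.-1 by lia.
  have Ek : (nat_of_ord (Ordinal kP)).+1 = k by rewrite /=; lia.
  exists (Ordinal kP).
  have [a [x [b [y [c [Ed [xk yk] [Na Nc] N1 N2]]]]]] := isolated_right_split Hk Od J.
  split.
  + by apply/(RP1_word n2 _ E Od); rewrite Ek; case: J => ->.
  + have [Ew Ma Mb Mc Mp] := word_split E Ed xk yk Na Nc N1 N2.
    rewrite /RP2 [pos _]Ek; apply: (none_between_word n2 (a := map fst a) (b := map fst b) (c := map fst c)); rewrite ?Ek //.
  have C0 : 0 < count_at k d by rewrite Ed count_at_cat count_at_cons xk eqxx addnCA add1n.
  have [z [zl zk Ez]] := del_first U En C0.
  exists z; split; first by apply: (cpos_inj n2); rewrite zk; exact: esym Ek.
  apply/(alternating_between_walt n2 _ _ (linear_ext_subposet _ Lw)) => i; rewrite [pos _]Ek => _ ik i_n.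
  by rewrite delete_labels -map_comp one Ez -alternates_at_walt; apply: A.
have jP : j.-1 < n.-1 by lia.
have kP : k.-1 < n.-1 by lia.
have Ej : (nat_of_ord (Ordinal jP)).+1 = j by rewrite /=; lia.
have Ek : (nat_of_ord (Ordinal kP)).+1 = k by rewrite /=; lia.
have jk' : nat_of_ord (Ordinal jP) < nat_of_ord (Ordinal kP) by rewrite /=; lia.
have kj : (k == j) = false by lia.
have j0 : 0 < j by lia.
have Hk : 0 < k < n by lia.
exists (Ordinal jP), (Ordinal kP).
have [a [x [b [y [c [Ed [xj yj] [Na Nc] N1 N2]]]]]] := isolated_left_split n2 j0 I.
have [a' [x' [b' [y' [c' [Ed' [xk yk] [Na' Nc'] N1' N2']]]]]] := isolated_right_split Hk Od J.
split.
- exact: jk'.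
- split; first by apply/(LP1_word n2 _ E); rewrite Ej; case: I => ->.
  have [Ew Ma Mb Mc Mp] := word_split E Ed xj yj Na Nc N1 N2.
  rewrite /LP2 [pos _]Ej; apply: (none_between_word n2 (a := map fst a) (b := map fst b) (c := map fst c)); rewrite ?Ej //.
- split; first by apply/(RP1_word n2 _ E Od); rewrite Ek; case: J => ->.
  have [Ew Ma Mb Mc Mp] := word_split E Ed' xk yk Na' Nc' N1' N2'.
  rewrite /RP2 [pos _]Ek; apply: (none_between_word n2 (a := map fst a') (b := map fst b') (c := map fst c')); rewrite ?Ek //.
have C0 : 0 < count_at j d by rewrite (isolated_left_count_at j0 I).
have [z [zl zj Ez]] := del_first U En C0.
have C1 : 0 < count_at k (drop_first j d).
  by rewrite (count_at_drop_first n2) kj subn0 Ed' count_at_cat count_at_cons xk eqxx addnCA add1n.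
have [z' [zl' zk' Ez']] := del_first (filter_uniq _ U) Ez C1.
exists z, z'; split.
- by apply: (cpos_inj n2); rewrite zj; exact: esym Ej.
- by apply: (cpos_inj n2); rewrite zk'; exact: esym Ek.
apply/(alternating_between_walt n2 _ _ (linear_ext_subposet _ Lw)) => i; rewrite [pos (sC (Ordinal jP))]Ej [pos (sC (Ordinal kP))]Ek => ji ik i_n.
rewrite delete_labels -map_comp.
have -> : filter (fun v => v \notin [set z; z']) (enum (word_pos w)) =
   filter (predC1 z') (filter (predC1 z) (enum (word_pos w))).
  by rewrite -filter_predI; apply: eq_filter => v; rewrite !inE negb_or andbC.
by rewrite Ez' -alternates_at_walt; apply: A; rewrite ji.
Qed.

(** * Stability of the words obtained by substitution *)

Lemma walt_sep i u : walt i u -> sep i i.+1 u /\ sep i.+1 i u.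
Proof.
move=> A; split; rewrite -[u]map_id; apply: (@sep_sorted _ _ predT) => //.
- by rewrite ltn_eqF.
- by rewrite filter_predT map_id.
- by rewrite gtn_eqF.
rewrite filter_predT map_id (eq_filter (a2 := pred2 i i.+1)) // => z /=; exact: orbC.
Qed.

Lemma delete_sep (w : seq C) (d : seq letter) (A : {set heap_of_word eC w}) i : map fst d = map cpos w ->
  walt i (map cpos (map (@label C (delete A)) (pmap insub (enum (word_pos w))))) ->
  ((forall x, x \in A -> cpos (label x) <> i) -> sep i i.+1 (map fst d)) /\
  ((forall x, x \in A -> cpos (label x) <> i.+1) -> sep i.+1 i (map fst d)).
Proof.
move=> E; rewrite delete_labels -map_comp -(enum_labels E) => weight.
have P j : (forall x, x \in A -> cpos (label x) <> j) ->
   forall x : heap_of_word eC w, cpos (label x) = j -> x \notin A.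
  by move=> H x xj; apply/negP => /H.
split=> /P HA; apply: (sep_sorted (P := fun v => v \notin A)) => //.
- by rewrite ltn_eqF.
- by rewrite gtn_eqF.
by rewrite (eq_filter (a2 := pred2 i i.+1)) // => z /=; exact: orbC.
Qed.

Lemma zigzag_path_chain (w : seq C) : zigzag_path n (map cpos w) -> chain eC w.
Proof.
move=> [Z _]; apply: chain_cpos => //; apply/(sortedP 0) => k ku.
by case: (Z k ku) => ->; rewrite eqxx ?orbT.
Qed.

Lemma zigzag2 : flatten (nseq 2 (zigzag n)) = zigzag n ++ zigzag n.
Proof. by rewrite [LHS]/= cats0. Qed.

Lemma special_t : zigzag_factor (zigzag n ++ [:: tC n]).
Proof.
exists 2; apply/infixP; exists [::], (s_up n ++ [:: uC n] ++ s_down n).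
by rewrite zigzag2; exact: (catA (zigzag n) [:: tC n] _).
Qed.

Lemma special_u : zigzag_factor ([:: uC n] ++ s_down n ++ [:: tC n] ++ s_up n ++ [:: uC n]).
Proof.
exists 2; apply/infixP; exists ([:: tC n] ++ s_up n), (s_down n).
by rewrite zigzag2 /zigzag -?catA /= -?catA /= -?catA.
Qed.

(** The words of the special cases are zigzags, hence determined by their heaps. *)
Lemma special_iso (w z : seq C) : zigzag_factor z ->
  lposet_iso (heap_of_word eC w) (heap_of_word eC z) -> w = z.
Proof.
move=> F iso; have Z := zigzag_factor_zigzag_path n2 F.
by rewrite -[LHS](word_labels eC w); apply: chain_iso_eq (linear_ext_word eC w) (zigzag_path_chain Z) iso.
Qed.

Definition spread_rule d i (w z : seq C) := [\/ size (decorations i d) <= 1, alternates (decorations i d)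
  | lposet_iso (heap_of_word eC w) (heap_of_word eC z)].

Lemma spread_end_deco d i w z : zigzag_factor z -> map fst d = map cpos w ->
  spread_rule d i w z -> end_deco n d i.
Proof.
move=> F E [H|H|iso]; [exact: Or31|exact: Or32|apply: Or33].
by rewrite E (special_iso F iso); exact: zigzag_factor_zigzag_path.
Qed.

Lemma deco_eq (u v : seq letter) : all (letter_ok n) u -> all (letter_ok n) v ->
  map fst u = map fst v -> all (fun x => x.1 < n) u -> decorations 0 u = decorations 0 v -> u = v.
Proof.
elim: u v => [|x u IH] [|y v] //= /andP[Ox Ou] /andP[Oy Ov] [xy E] /andP[xn un].
rewrite !deco_cons -xy; case: (posnP x.1) => [x0|x0] /=.
  case=> xy2 E2; rewrite (IH v) //; congr (_ :: _).
  by case: (x) (y) xy xy2 => ? ? [? ?] /= -> ->.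
move=> E2; rewrite (IH v) // (letter_okP Ox) ?x0 // (letter_okP Oy) -?xy ?x0 //.
Qed.

Lemma ok_LPeak j : j < n -> all (letter_ok n) (LPeak j).
Proof.
elim: j => [|j IH] /= jn; first by rewrite /letter_ok.
by rewrite -cats1 all_cat IH ?(ltnW jn) //= andbT /letter_ok /=; lia.
Qed.

Lemma deco_LPeak j : decorations 0 (LPeak j) = [:: Both].
Proof. by elim: j => //= j IH; rewrite deco_cons -cats1 deco_cat IH. Qed.

Lemma ok_low k d : all (letter_ok n) d -> all (letter_ok n) (low k d).
Proof. by elim: d => //= y u IH /andP[Oy /IH Ou]; case: ifP => //= _; rewrite Oy. Qed.

Lemma deco_low k d : 0 < k -> decorations 0 (low k d) = decorations 0 d.
Proof.
move=> k0; elim: d => //= x d IH; rewrite [in RHS]deco_cons -IH.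
by case: ltnP => [|kx]; rewrite ?deco_cons //; case: eqP => // x0; lia.
Qed.

Lemma low_LPeak j d : all (letter_ok n) d -> j < n -> decorations 0 d = [:: Both] ->
  map fst (low j.+1 d) = map fst (LPeak j) -> low j.+1 d = LPeak j.
Proof.
move=> Od jn D E; apply: deco_eq => //; first exact: ok_low.
- exact: ok_LPeak.
- by elim: (d) => //= x u IH; case: ifP => //= xj; rewrite IH andbT; lia.
by rewrite deco_low // D deco_LPeak.
Qed.

Lemma deco_flip d : all (letter_ok n) d -> decorations 0 (flip n d) = decorations n d.
Proof.
elim: d => //= x d IH /andP[/andP[xn _] /IH E]; rewrite !deco_cons E /=.
by have -> : (n - x.1 == 0) = (x.1 == n) by lia.
Qed.

Lemma gaps_stable d : all (letter_ok n) d ->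
  (forall i, i <= n -> forall a x b y c, d = a ++ x :: b ++ y :: c -> x.1 = i -> y.1 = i ->
     avoids i b -> gap_ok n x b y) -> stable n d.
Proof.
move=> Od H; split=> // a x b y c E yx Nb; apply: (H x.1 _ _ _ _ _ _ E) => //.
by move: Od; rewrite E all_cat /= => /and3P[_ /andP[]].
Qed.

Lemma gap_peak_right d a x b y c i k : all (letter_ok n) d -> 0 < k <= i -> i <= n ->
  low (n - k).+1 (flip n d) = LPeak (n - k) ->
  d = a ++ x :: b ++ y :: c -> x.1 = i -> y.1 = i -> avoids i b -> gap_ok n x b y.
Proof.
move=> Od ki i_n L; apply: (gap_flip n2 Od i_n) => a' x' b' y' c'.
by apply: (gap_peak n2 _ _ L); lia.
Qed.

Lemma zigzag_word_rule_deco d (w : seq C) (s : C) : map fst d = map cpos w ->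
  (forall i, i < size (decorations (cpos s) d) ->
    [\/ nth Both (decorations (cpos s) d) i = Both,
        i = 0 /\ (exists w', w = s :: w')
      | i = (size (decorations (cpos s) d)).-1 /\ (exists w', w = rcons w' s)]) ->
  zig_deco d (cpos s).
Proof.
move=> E R a x b Ed xs a0 b0.
have D : decorations (cpos s) d = decorations (cpos s) a ++ x.2 :: decorations (cpos s) b.
  by rewrite Ed deco_cat deco_cons xs eqxx.
have := R (size (decorations (cpos s) a)); rewrite D size_cat /= nth_cat ltnn subnn /=.
case; first by lia.
- by [].
- move=> [i0 [w' Ew]]; case: a a0 Ed i0 {D} => // z a _ Ed i0.
  have zs : z.1 = cpos s by move: E; rewrite Ed Ew => -[].
  by rewrite deco_cons zs eqxx in i0.
move=> [i0 [w' Ew]]; case/lastP: b b0 Ed i0 {D} => // b z _ Ed i0.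
have zs : z.1 = cpos s.
  by move: E; rewrite Ed Ew -rcons_cons -rcons_cat !map_rcons => /rcons_inj[].
by move: i0; rewrite -cats1 deco_cat deco_cons zs eqxx size_cat /=; lia.
Qed.

(** Alternation along the two edges at an interior position gives the two
neighbours required in each gap; the gaps inside a peak are smaller peaks,
whose summit is double; at the ends the substitution rules apply ([gap_end]). *)
Lemma family_stable (w : seq C) d X : in_family X (heap_of_word eC w) ->
  map fst d = map cpos w -> all (letter_ok n) d ->
  t_rule X w (decorations 0 d) -> u_rule X w (decorations n d) -> stable n d.
Proof.
move=> F E Od [_ Rt] [_ Ru]; have Lw := linear_ext_word eC w.
have St_t : spread_rule d 0 w (zigzag n ++ [:: tC n]) -> end_deco n d 0.
  exact: spread_end_deco special_t E.
have St_u : spread_rule d n w ([:: uC n] ++ s_down n ++ [:: tC n] ++ s_up n ++ [:: uC n]) ->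
    end_deco n d n.
  exact: spread_end_deco special_u E.
case: X F Rt Ru => /=.
- move=> /(is_ALT_walt n2 Lw) A Rt Ru; rewrite word_labels -E in A.
  apply: gaps_stable => // i i_n a x b y c.
  have [i0|i0] := posnP i.
    subst i; apply: gap_end => //; [by left| |exact: St_t].
    by have [] := walt_sep (A 0 (ltnW n2)).
  have [Ei|Ei] := eqVneq i n.
    subst i; apply: gap_end => //; [by right| |exact: St_u].
    have -> : (n == 0) = false by lia.
    have := walt_sep (A n.-1 _); have -> : n.-1.+1 = n by lia.
    by case; [lia|].
  have Hi : 0 < i < n by lia.
  apply: (gap_sep Hi).
    have := walt_sep (A i.-1 _); have -> : i.-1.+1 = i by lia.
    by case; [lia|].
  by have [] := walt_sep (A i _); first lia.
- move=> [[w' [F' iso]] _] Rt Ru; have Ew := special_iso F' iso; subst w'.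
  apply: (zigzag_path_stable n2 Od); first by rewrite E; exact: zigzag_factor_zigzag_path.
    exact: (@zigzag_word_rule_deco d w (tC n)).
  exact: (@zigzag_word_rule_deco d w (uC n)).
- move=> [j [/(LP1_word n2 _ E) L _ [x [xj A]]]] Rt Ru.
  have jn : j.+1 < n by have := ltn_ord j; lia.
  have {}L := low_LPeak Od jn Rt L.
  have {}A i : j < i -> i < n -> sep i.+1 i (map fst d) /\ (j.+1 < i -> sep i i.+1 (map fst d)).
    move=> ji i_n; have /(alternating_between_walt n2 _ _ (linear_ext_subposet _ Lw)) := A.
    move=> /(_ i ji i_n i_n) /(delete_sep E)[S1 S2].
    split; [apply: S2 => z|move=> ji'; apply: S1 => z]; rewrite inE => /eqP ->; rewrite xj /=; lia.
  apply: gaps_stable => // i i_n a y b z c.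
  have [ij|ij] := leqP i j.+1; first exact: gap_peak L.
  have SL : sep i i.-1 (map fst d).
    have := A i.-1; have -> : i.-1.+1 = i by lia.
    by case; [lia|lia|].
  have [Ei|Ei] := eqVneq i n.
    subst i; apply: gap_end => //; [by right| |exact: St_u].
    by have -> : (n == 0) = false by lia.
  have [|_ SR] := A i (ltnW ij); first by lia.
  by apply: gap_sep => //; [lia|exact: SR].
- move=> [k [/(RP1_word n2 _ E Od) L _ [x [xk A]]]] Rt Ru.
  have kn := ltn_ord k.
  have {}L : low (n - k.+1).+1 (flip n d) = LPeak (n - k.+1).
    apply: low_LPeak => //; [exact: ok_flip|lia|by rewrite deco_flip].
  have {}A i : i < k.+1 -> sep i i.+1 (map fst d) /\ (i < k -> sep i.+1 i (map fst d)).
    move=> ik; have /(alternating_between_walt n2 _ _ (linear_ext_subposet _ Lw)) := A.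
    have i_n : i < n by lia.
    move=> /(_ i (leq0n i) ik i_n) /(delete_sep E)[S1 S2].
    split; [apply: S1 => z|move=> ji'; apply: S2 => z]; rewrite inE => /eqP ->; rewrite xk /=; lia.
  apply: gaps_stable => // i i_n a y b z c.
  have [ki|ki] := ltnP k i; first by apply: gap_peak_right L => //; lia.
  have [SR _] := A i ki.
  have [i0|i0] := posnP i.
    by subst i; apply: gap_end => //; [by left|exact: St_t].
  have [|_ SL] := A i.-1; first by lia.
  rewrite (_ : i.-1.+1 = i) in SL; last by lia.
  by apply: gap_sep => //; [lia|apply: SL; lia].
move=> [j [k [jk [/(LP1_word n2 _ E) L _] [/(RP1_word n2 _ E Od) R _] [x [x' [xj xk A]]]]]] Rt Ru.
have jn : j.+1 < n by have := ltn_ord j; lia.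
have kn := ltn_ord k.
have {}L := low_LPeak Od jn Rt L.
have {}R : low (n - k.+1).+1 (flip n d) = LPeak (n - k.+1).
  apply: low_LPeak => //; [exact: ok_flip|lia|by rewrite deco_flip].
have {}A i : j < i < k.+1 -> (i < k -> sep i.+1 i (map fst d)) /\ (j.+1 < i -> sep i i.+1 (map fst d)).
  move=> /andP[ji ik]; have /(alternating_between_walt n2 _ _ (linear_ext_subposet _ Lw)) := A.
  have i_n : i < n by lia.
  move=> /(_ i ji ik i_n) /(delete_sep E)[S1 S2].
  by split=> H; [apply: S2 => z|apply: S1 => z]; rewrite !inE => /orP[]/eqP ->; rewrite ?xj ?xk /=; lia.
apply: gaps_stable => // i i_n a y b z c.
have [ij|ij] := leqP i j.+1; first exact: gap_peak L.
have [ki|ki] := ltnP k i; first by apply: gap_peak_right R => //; lia.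
have [|SL _] := A i.-1; first by lia.
rewrite (_ : i.-1.+1 = i) in SL; last by lia.
have [|_ SR] := A i; first by lia.
by apply: gap_sep => //; [lia|apply: SL; lia|exact: SR].
Qed.

End Families.

(** * Gaps of braid-free words *)

Section Gaps.
Variables (S : finType) (m : S -> S -> nat).
Hypothesis m1 : forall s, m s s = 1.
Hypothesis mC : forall s t, m s t = m t s.
Hypothesis m_neq : forall s t, s != t -> 1 < m s t.

Notation "u === v" := (commutation_equiv m u v) (at level 70).

Lemma ceq_refl u : u === u. Proof. exact: rst_refl. Qed.
Lemma ceq_sym u v : u === v -> v === u. Proof. exact: rst_sym. Qed.
Lemma ceq_trans v u w : u === v -> v === w -> u === w.
Proof. exact: rst_trans. Qed.

Lemma ceq_cat u u' v v' : u === u' -> v === v' -> u ++ v === u' ++ v'.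
Proof.
move=> /(commutation_cat [::] v) /= H /(commutation_cat u' [::]); rewrite !cats0.
exact: ceq_trans.
Qed.

Lemma ceq_catl a u v : u === v -> a ++ u === a ++ v.
Proof. by apply: ceq_cat; exact: ceq_refl. Qed.

Lemma ceq_move s b c : all (fun x => m s x == 2) b -> s :: b ++ c === b ++ s :: c.
Proof.
elim: b => [_|x b IH /andP[/eqP sx /IH H]] /=; first exact: ceq_refl.
apply: (@ceq_trans (x :: s :: b ++ c)); last exact: (@ceq_catl [:: x]).
exact/rst_step/(CommutationStep [::] (b ++ c) sx).
Qed.

Lemma commute2 s x : x != s -> ~~ edge m s x -> m s x = 2.
Proof. by rewrite /edge eq_sym -leqNgt => /m_neq; case: (m s x) => [|[|[|]]]. Qed.

Lemma all_commute s b : s \notin b -> ~~ has (edge m s) b -> all (fun x => m s x == 2) b.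
Proof.
elim: b => //= x b IH; rewrite inE !negb_or => /andP[sx sb] /andP[ex eb].
by rewrite IH // andbT commute2 // eq_sym.
Qed.

(** Otherwise the two letters s could be brought together. *)
Lemma gap_edge a s b c : braid_free m (a ++ s :: b ++ s :: c) -> s \notin b -> has (edge m s) b.
Proof.
move=> B sb; apply: contraT => eb.
have H : a ++ s :: b ++ s :: c === (a ++ b) ++ [:: s; s] ++ c.
  by rewrite -catA; apply: ceq_catl; apply: ceq_move; exact: all_commute.
by have [] := B _ H (a ++ b) c s s.
Qed.

Lemma gap_single a s b1 t b2 c : braid_free m (a ++ s :: b1 ++ t :: b2 ++ s :: c) ->
  s \notin b1 -> s \notin b2 -> ~~ has (edge m s) b1 -> ~~ has (edge m s) b2 ->
  m s t <> 3.
Proof.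
move=> B s1 s2 e1 e2 st.
have H : a ++ s :: b1 ++ t :: b2 ++ s :: c === (a ++ b1) ++ [:: s; t; s] ++ b2 ++ c.
  rewrite -catA; apply: ceq_catl.
  apply: ceq_trans (ceq_move _ (all_commute s1 e1)) _; apply: ceq_catl.
  apply: (@ceq_catl [:: s; t]); apply: ceq_sym; apply: ceq_move; exact: all_commute.
have [_] := B _ H (a ++ b1) (b2 ++ c) s t.
by rewrite st /=; case.
Qed.

(** Otherwise s t s t could be brought together. *)
Lemma gap_double a s b1 t b2 b3 c :
  braid_free m (a ++ s :: b1 ++ t :: b2 ++ s :: b3 ++ t :: c) ->
  s \notin b1 -> s \notin b2 -> t \notin b2 -> t \notin b3 ->
  ~~ has (edge m s) b1 -> ~~ has (edge m s) b2 ->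
  ~~ has (edge m t) b2 -> ~~ has (edge m t) b3 -> m s t <> 4.
Proof.
move=> B s1 s2 t2 t3 es1 es2 et2 et3 st.
have H : a ++ s :: b1 ++ t :: b2 ++ s :: b3 ++ t :: c ===
    (a ++ b1) ++ [:: s; t; s; t] ++ b2 ++ b3 ++ c.
  rewrite -catA; apply: ceq_catl.
  apply: ceq_trans (ceq_move _ (all_commute s1 es1)) _; apply: ceq_catl.
  apply: (@ceq_catl [:: s; t]); apply: (@ceq_trans (s :: b2 ++ b3 ++ t :: c)).
    by apply: ceq_sym; apply: ceq_move; exact: all_commute.
  apply: (@ceq_catl [:: s]); apply: ceq_sym; rewrite !catA; apply: ceq_move.
  by rewrite all_cat !all_commute.
have [_] := B _ H (a ++ b1) (b2 ++ b3 ++ c) s t.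
by rewrite st /=; case.
Qed.

(** A single neighbour t with label 3 would give the braid s t s. *)
Lemma gap_laced a s b c : braid_free m (a ++ s :: b ++ s :: c) -> s \notin b ->
  (forall t, t \in b -> edge m s t -> m s t = 3) -> 1 < count (edge m s) b.
Proof.
move=> B sb H; have hb := gap_edge B sb.
rewrite ltnNge; apply/negP => c1.
have [t [b1 [b2 [Eb N1 et]]]] : exists t b1 b2, [/\ b = b1 ++ t :: b2, ~~ has (edge m s) b1 & edge m s t].
  elim: b hb {B sb H c1} => //= x b IH; case: (boolP (edge m s x)) => [ex _|ex /= /IH].
    by exists x, [::], b.
  by move=> [t [b1 [b2 [-> N1 et]]]]; exists t, (x :: b1), b2; rewrite /= negb_or ex.
subst b; move: c1; rewrite count_cat /= et => c1.
have N2 : ~~ has (edge m s) b2 by rewrite has_count; lia.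
move: sb; rewrite mem_cat inE !negb_or => /and3P[s1 _ s2].
rewrite -catA /= in B; apply: (gap_single B s1 s2 N1 N2).
by apply: H => //; rewrite mem_cat inE eqxx orbT.
Qed.

Lemma ceq_count p u v : u === v -> count p u = count p v.
Proof.
elim=> {u v} [_ _ [a c s t _]|u|u v _|u v w _ + _] //; last exact: etrans.
by rewrite !count_cat /= (addnCA (p s)).
Qed.

Lemma split_occ (s : S) k v : k < count_mem s v -> exists a r, v = a ++ s :: r /\ count_mem s a = k.
Proof.
elim: v k => //= x v IH k; case: eqVneq => [->|xs] /=.
  case: k => [_|k]; first by exists [::], v.
  rewrite add1n ltnS => /IH[a [r [-> <-]]]; exists (s :: a), r; split=> //=.
  by rewrite eqxx.
rewrite add0n => /IH[a [r [-> <-]]]; exists (x :: a), r; split=> //=.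
by rewrite (negPf xs).
Qed.

Lemma split_occ_uniq (s : S) A r A' r' : A ++ s :: r = A' ++ s :: r' ->
  count_mem s A = count_mem s A' -> A = A' /\ r = r'.
Proof.
elim: A A' => [|x A IH] [|x' A'] //=; first by case.
- by case=> <- _; rewrite eqxx.
- by case=> -> _; rewrite eqxx.
case=> <- E /addnI/(IH _ E)[-> ->]; by [].
Qed.

(** The order of s with each of its neighbours is invariant under commutation
([commutation_filter]), so that the gap after the k-th letter s contains the same
neighbours in every word of the class. *)
Lemma gap_transfer v v' a s b c : v === v' -> v' = a ++ s :: b ++ s :: c -> s \notin b ->
  exists a2 b2 c2, [/\ v = a2 ++ s :: b2 ++ s :: c2, s \notin b2,
    count_mem s a2 = count_mem s a &
    forall t, edge m s t -> count_mem t b2 = count_mem t b].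
Proof.
move=> H E sb.
have Cs := ceq_count (pred1 s) H.
have sb0 : count_mem s b = 0 by apply/eqP; rewrite -leqn0 leqNgt -has_count has_pred1.
have [a2 [r [Ev Ca]]] : exists a2 r, v = a2 ++ s :: r /\ count_mem s a2 = count_mem s a.
  apply: split_occ; rewrite Cs E count_cat /= eqxx; lia.
have [b2 [c2 [Er Cb]]] : exists b2 c2, r = b2 ++ s :: c2 /\ count_mem s b2 = 0.
  apply: split_occ; move: Cs; rewrite E Ev !count_cat /= count_cat /= eqxx Ca.
  by rewrite !add1n => /addnI[->]; rewrite addnS.
have sb2 : s \notin b2 by rewrite -has_pred1 has_count Cb.
exists a2, b2, c2; split=> //; first by rewrite Ev Er.
move=> t st; have ts : s != t by apply: contraTneq st => <-; rewrite /edge m1.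
have := commutation_filter mC ts _ H; rewrite gtn_eqF // => /(_ isT).
have P u : filter (pred2 s t) (s :: u) = s :: filter (pred2 s t) u by rewrite /= eqxx.
have Cf u : count_mem s (filter (pred2 s t) u) = count_mem s u.
  by rewrite count_filter; apply: eq_count => x /=; case: eqP.
have Ct u : count_mem t (filter (pred2 s t) u) = count_mem t u.
  by rewrite count_filter; apply: eq_count => x /=; case: (x =P t) => //= _; rewrite orbT.
rewrite E Ev Er !filter_cat !P !filter_cat !P => F.
have [_ F2] := split_occ_uniq F (etrans (Cf _) (etrans Ca (esym (Cf _)))).
have [F3 _] := split_occ_uniq F2 (etrans (Cf _) (etrans (etrans Cb (esym sb0)) (esym (Cf _)))).
by rewrite -Ct F3 Ct.
Qed.

Lemma count_edge s b b2 : (forall t, edge m s t -> count_mem t b2 = count_mem t b) ->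
  count (edge m s) b2 = count (edge m s) b.
Proof.
move=> H; rewrite -!size_filter; apply/perm_size/allP => t _ /=; apply/eqP.
rewrite !count_filter; have [et|et] := boolP (edge m s t).
  have E u : count (predI (pred1 t) (edge m s)) u = count_mem t u.
    by apply: eq_count => x; rewrite /=; case: (x =P t) => [->|_] //=; rewrite et.
  by rewrite !E H.
have E u : count (predI (pred1 t) (edge m s)) u = 0.
  by rewrite -(count_pred0 u); apply: eq_count => x; rewrite /=; case: (x =P t) => [->|_] //=; rewrite (negbTE et).
by rewrite !E.
Qed.

Lemma gap_count_edge v v' a b c A B C s : v === v' ->
  v' = a ++ s :: b ++ s :: c -> s \notin b -> v = A ++ s :: B ++ s :: C -> s \notin B ->
  count_mem s A = count_mem s a -> count (edge m s) B = count (edge m s) b.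
Proof.
move=> H E sb E2 sB CA; have [a2 [b2 [c2 [E3 sb2 Ca T]]]] := gap_transfer H E sb.
rewrite E2 in E3; have [_ E4] := split_occ_uniq E3 (etrans CA (esym Ca)).
have [-> _] : B = b2 /\ s :: C = s :: c2; last exact: count_edge.
have Z u : s \notin u -> count_mem s u = 0 by move=> su; apply/count_memPn.
by have [-> ->] := split_occ_uniq E4 (etrans (Z _ sB) (esym (Z _ sb2))).
Qed.

(** A square or a braid s t s in the class would be a gap with at most one
neighbour. *)
Lemma laced_braid_free v : (forall s t, m s t <= 3) ->
  (forall a s b c, v = a ++ s :: b ++ s :: c -> s \notin b -> 1 < count (edge m s) b) ->
  braid_free m v.
Proof.
move=> m3 G v' H a c s t; split=> [E|mst E].
  have [a2 [b2 [c2 [E2 sb _ C]]]] := gap_transfer (b := [::]) H E isT.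
  by have := G _ _ _ _ E2 sb; rewrite (count_edge C).
have st3 : m s t = 3 by have := m3 s t; lia.
have st : s \notin [:: t] by rewrite inE; apply: contraTneq mst => <-; rewrite m1.
rewrite st3 /= in E.
have [a2 [b2 [c2 [E2 sb _ C]]]] := gap_transfer (b := [:: t]) H E st.
by have := G _ _ _ _ E2 sb; rewrite (count_edge C) /=; case: (edge m s t).
Qed.

End Gaps.

(** * Expansions of decorated words *)

Lemma cat_prefix (T : eqType) (s : T) (A B e X : seq T) : A ++ s :: B = e ++ X -> s \notin e ->
  exists A', A = e ++ A' /\ X = A' ++ s :: B.
Proof.
elim: e A => [|y e IH] A /=; first by move=> <- _; exists A.
rewrite inE negb_or => + /andP[sy se]; case: A => [|z A] /=.
  by case=> E; rewrite E eqxx in sy.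
by case=> -> /IH/(_ se)[A' [-> ->]]; exists A'.
Qed.

Lemma cat_cons_split (T : Type) (u w A B : seq T) s : u ++ w = A ++ s :: B ->
  (exists e, u = A ++ s :: e /\ B = e ++ w) \/ (exists A', A = u ++ A' /\ w = A' ++ s :: B).
Proof.
elim: u A => [|x u IH] [|y A] /=; try by right; eexists.
- by case=> -> <-; left; exists u.
case=> -> /IH[[e [-> ->]]|[A' [-> ->]]]; first by left; exists e.
by right; exists A'.
Qed.

Section PathMatrix.
Variables (L R : finType) (n p q : nat).
Hypotheses (p2 : 2 < p) (q2 : 2 < q).
Notation V := (vertex L R n).
Notation mat := (@path_matrix L R n p q).

Lemma path_matrix1 (s : V) : mat s s = 1.
Proof. by rewrite /path_matrix eqxx. Qed.

Lemma path_matrixC (s t : V) : mat s t = mat t s.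
Proof.
rewrite /path_matrix eq_sym orbC; case: eqP => // _; case: ifP => //.
by case: s => [[?|?]|?]; case: t => [[?|?]|?].
Qed.

Lemma path_matrix_neq (s t : V) : s != t -> 1 < mat s t.
Proof.
rewrite /path_matrix => /negPf ->; case: ifP => //.
by case: s => [[?|?]|?]; case: t => [[?|?]|?] _; lia.
Qed.

Lemma edgeP (s t : V) : edge mat s t = (pos s == (pos t).+1) || (pos t == (pos s).+1).
Proof. exact: edge_pos. Qed.

Definition pcount j (u : seq V) := count (fun v => pos v == j) u.

Lemma count_edge_pos (s : V) u :
  count (edge mat s) u = (if pos s is k.+1 then pcount k u else 0) + pcount (pos s).+1 u.
Proof.
rewrite /pcount; elim: u => [|t u IH] /=; first by case: (pos s).
rewrite IH edgeP; case: (pos s) => [|k] /=; first by lia.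
by rewrite eqSS (eq_sym k); case: eqP => E1; case: eqP => E2 /=; lia.
Qed.

Lemma count_edge_S (s : V) k u : pos s = k.+1 ->
  count (edge mat s) u = pcount k u + pcount k.+2 u.
Proof. by rewrite count_edge_pos => ->. Qed.

Section Expand.
Hypothesis n2 : 2 <= n.
Variable letter_word : letter -> seq V.
Notation ok := (letter_ok n).
Hypothesis EX_pos : forall x, ok x -> all (fun v => pos v == x.1) (letter_word x).
Hypothesis EX_uniq : forall x, uniq (letter_word x).

Definition expand d := flatten (map letter_word d).

Lemma expand_cat d d' : expand (d ++ d') = expand d ++ expand d'.
Proof. by rewrite /expand map_cat flatten_cat. Qed.

Lemma expand_cons x d : expand (x :: d) = letter_word x ++ expand d.
Proof. by []. Qed.

Lemma expand_split d A s B : expand d = A ++ s :: B -> exists d1 x d2 e1 e2,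
  [/\ d = d1 ++ x :: d2, letter_word x = e1 ++ s :: e2, A = expand d1 ++ e1 & B = e2 ++ expand d2].
Proof.
elim: d A => [|x d IH] A; first by case: A.
rewrite expand_cons => E; case: (cat_cons_split E) => [[e [Ex EB]]|[A' [EA E']]].
  by exists [::], x, d, A, e.
have [d1 [y [d2 [e1 [e2 [Ed Ey EA' EB]]]]]] := IH _ E'; rewrite EA Ed EA' EB; exists (x :: d1), y, d2, e1, e2; split=> //.
by rewrite expand_cons catA.
Qed.

Lemma expand_gap d A s B C : expand d = A ++ s :: B ++ s :: C -> s \notin B ->
  exists d1 x d2 y d3 e1 e2 f1 f2, [/\ d = d1 ++ x :: d2 ++ y :: d3,
    letter_word x = e1 ++ s :: e2, letter_word y = f1 ++ s :: f2 & B = e2 ++ expand d2 ++ f1].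
Proof.
move=> E sB; have [d1 [x [d' [e1 [e2 [-> Ex _ E2]]]]]] := expand_split E.
have se : s \notin e2.
  by have := EX_uniq x; rewrite Ex cat_uniq /= => /and4P[].
have [B' [EB E3]] := cat_prefix E2 se.
have [d2 [y [d3 [f1 [f2 [-> Ey EB' _]]]]]] := expand_split E3.
by exists d1, x, d2, y, d3, e1, e2, f1, f2; rewrite EB EB'.
Qed.

Lemma pos_EX x s e1 e2 : ok x -> letter_word x = e1 ++ s :: e2 -> pos s = x.1.
Proof. by move=> /EX_pos + E; rewrite E all_cat /= => /and3P[_ /eqP]. Qed.

Lemma pcount_EX j x : ok x -> pcount j (letter_word x) = (x.1 == j) * size (letter_word x).
Proof.
move=> /EX_pos; rewrite /pcount; elim: (letter_word x) => [|v u IH] /=; first by rewrite muln0.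
by move=> /andP[/eqP -> /IH ->]; case: eqP => _; rewrite ?mul1n ?mul0n.
Qed.

Lemma pcount_sub j x e1 e2 s : ok x -> letter_word x = e1 ++ s :: e2 -> x.1 != j ->
  pcount j e1 = 0 /\ pcount j e2 = 0.
Proof.
move=> Ox E xj; have := pcount_EX j Ox; rewrite (negPf xj) mul0n E /pcount count_cat /=.
lia.
Qed.

Lemma pcount_expand j d : all ok d ->
  (forall x, ok x -> x.1 = j -> size (letter_word x) = weight1 x) -> pcount j (expand d) = weight j d.
Proof.
move=> + H; elim: d => // x d IH /andP[Ox /IH E].
rewrite expand_cons /pcount count_cat -!/(pcount _ _) E weight_cons pcount_EX //.
by case: eqP => // /H ->.
Qed.

Lemma pcount_expand1 j d : all ok d ->
  (forall x, ok x -> x.1 = j -> size (letter_word x) = 1) -> pcount j (expand d) = count_at j d.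
Proof.
move=> + H; elim: d => // x d IH /andP[Ox /IH E].
rewrite expand_cons /pcount count_cat -!/(pcount _ _) E count_at_cons pcount_EX //.
by case: eqP => // /H ->.
Qed.

Lemma expand_avoids s d : all ok d -> avoids (pos s) d -> s \notin expand d.
Proof.
elim: d => // x d IH /andP[Ox Od] /andP[xs Nd]; rewrite expand_cons mem_cat negb_or IH // andbT.
by apply: contra xs => sx; have /allP/(_ _ sx) := EX_pos Ox; rewrite eq_sym.
Qed.

Hypothesis mid_single : forall x, ok x -> 0 < x.1 < n -> size (letter_word x) = 1.

(** A gap between letters of a decorated word that share a generator s is a gap of s in
the expansion, and the ends of the two letters do not contribute neighbours. *)
Lemma braid_free_gap d a x b y c s e1 e2 f1 f2 : all ok d ->
  braid_free mat (expand d) -> d = a ++ x :: b ++ y :: c -> x.1 = y.1 -> avoids x.1 b ->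
  letter_word x = e1 ++ s :: e2 -> letter_word y = f1 ++ s :: f2 ->
  exists A B C, [/\ expand d = A ++ s :: B ++ s :: C, s \notin B,
    A = expand a ++ e1, B = e2 ++ expand b ++ f1 & count (edge mat s) B = count (edge mat s) (expand b)].
Proof.
move=> Od BF E xy Nb Ex Ey.
have /and5P[Oa Ox Ob Oy Oc] : [&& all ok a, ok x, all ok b, ok y & all ok c].
  by move: Od; rewrite E all_cat /= all_cat.
exists (expand a ++ e1), (e2 ++ expand b ++ f1), (f2 ++ expand c); split=> //.
- by rewrite E !(expand_cat, expand_cons) Ex Ey -?catA /= -?catA.
- have Nb' : s \notin expand b by apply: expand_avoids; rewrite ?(pos_EX Ox Ex).
  have sf : s \notin f1 by have := EX_uniq y; rewrite Ey cat_uniq /= negb_or => /and3P[_ /andP[]].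
  have se : s \notin e2 by have := EX_uniq x; rewrite Ex cat_uniq /= => /and4P[].
  by rewrite !mem_cat !negb_or Nb' sf se.
rewrite !count_edge_pos (pos_EX Ox Ex) /pcount !count_cat -!/(pcount _ _).
have X j : x.1 != j -> pcount j e2 = 0 /\ pcount j f1 = 0.
  move=> xj; have [_ ->] := pcount_sub Ox Ex xj; split=> //.
  by rewrite xy in xj; have [-> _] := pcount_sub Oy Ey xj.
have [-> ->] := X x.1.+1 (negbT (ltn_eqF (ltnSn _))).
rewrite addn0 add0n; congr (_ + _); case Exk: x.1 => [|k] //.
have [|E1 E2] := X k; first by rewrite Exk gtn_eqF.
rewrite !count_cat; transitivity (pcount k e2 + (pcount k (expand b) + pcount k f1)); first by [].
by rewrite E1 E2 add0n addn0.
Qed.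

End Expand.
End PathMatrix.

(** * Braid-free words of type affine D *)

Definition mid (L R : finType) n i : seq (vertex L R n) :=
  if insub i.-1 is Some k then [:: sv L R k] else [::].

Lemma midE (L R : finType) n i : 0 < i < n -> exists k : 'I_n.-1, k.+1 = i /\ mid L R n i = [:: sv L R k].
Proof.
move=> Hi; rewrite /mid; case: insubP => [k _ Ek|]; last by lia.
by exists k; split=> //; have : nat_of_ord k = i.-1 := Ek; lia.
Qed.

Section TypeD.
Variable n : nat.
Hypothesis n2 : 2 <= n.
Notation ok := (letter_ok n).
Notation mD := (@cox_D n).

Definition exD (x : letter) : seq (Dtype n) :=
  if x.1 == 0 then split_word (@tD n) x.2
  else if x.1 == n then split_word (@uD n) x.2 else mid bool bool n x.1.

Lemma exD_mid x : 0 < x.1 < n -> exD x = mid bool bool n x.1.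
Proof.
move=> Hx; rewrite /exD; have -> : (x.1 == 0) = false by lia.
by have -> : (x.1 == n) = false by lia.
Qed.

Lemma exD_pos x : ok x -> all (fun v => pos v == x.1) (exD x).
Proof.
move=> /andP[xn _]; rewrite /exD; case: eqP => [->|x0]; first by case: x.2.
case: eqP => [->|xn']; first by case: x.2 => [b|] /=; rewrite ?eqxx.
have [|k [Ek ->]] := @midE bool bool n x.1; first by lia.
by rewrite /= Ek eqxx.
Qed.

Lemma exD_uniq x : uniq (exD x).
Proof.
rewrite /exD; do 2![case: ifP => _; first by case: x.2].
by rewrite /mid; case: insub.
Qed.

Lemma exD_size x : ok x -> size (exD x) = weight1 x.
Proof.
move=> Ox; have /andP[xn _] := Ox; rewrite /exD /weight1.
case: eqP => [_|x0]; first by case: x.2.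
case: eqP => [_|xn']; first by case: x.2.
have Hi : 0 < x.1 < n by lia.
by have [k [_ ->]] := @midE bool bool n x.1 Hi; rewrite (letter_okP Ox).
Qed.

Notation expandD := (expand exD).

Lemma end_of (i : nat) x : ok x -> (0 < x.1 < n) = false -> x.1 = 0 \/ x.1 = n.
Proof. by move=> /andP[xn _]; lia. Qed.

Lemma exD_end x : ok x -> (0 < x.1 < n) = false ->
  exists f : bool -> Dtype n, [/\ exD x = split_word f x.2, f true != f false &
    forall y, y.1 = x.1 -> exD y = split_word f y.2].
Proof.
move=> Ox /(end_of 0 Ox)[x0|xn].
  by exists (@tD n); split=> [||y yx] //; rewrite /exD ?yx x0.
have n0 : (n == 0) = false by lia.
by exists (@uD n); split=> [||y yx] //; rewrite /exD ?yx xn n0 eqxx.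
Qed.

Lemma W1_count_at d i : all ok d -> (0 < i < n) = false -> i <= n ->
  count_at (if i == 0 then 1 else n.-1) d = weight (if i == 0 then 1 else n.-1) d.
Proof. by move=> Od Hi i_n; rewrite (weight_int Od) //; case: eqP => ?; lia. Qed.

Lemma edge_count_end (s : Dtype n) d : all ok d -> (0 < pos s < n) = false -> pos s <= n ->
  count (edge mD s) (expandD d) = count_at (if pos s == 0 then 1 else n.-1) d.
Proof.
move=> Od Hs sn; rewrite W1_count_at //.
have P j : pcount j (expandD d) = weight j d.
  by apply: (pcount_expand exD_pos Od) => x Ox _; exact: exD_size.
have [s0|s0] := posnP (pos s); first by rewrite count_edge_pos // s0 P.
have Es : pos s = n.-1.+1 by lia.
rewrite (count_edge_S _ _ _ Es) // !P.
have -> : weight n.-1.+2 d = 0.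
  rewrite avoids_weight //; elim: (d) Od => //= x u IH /andP[/andP[xn _] /IH ->].
  by rewrite andbT; lia.
exact: addn0.
Qed.

Lemma edge_count_mid (s : Dtype n) d : all ok d -> 0 < pos s < n ->
  count (edge mD s) (expandD d) = weight (pos s).-1 d + weight (pos s).+1 d.
Proof.
move=> Od Hs.
have P j : pcount j (expandD d) = weight j d.
  by apply: (pcount_expand exD_pos Od) => x Ox _; exact: exD_size.
have Es : pos s = (pos s).-1.+1 by lia.
by rewrite (count_edge_S _ _ _ Es) // !P -Es.
Qed.

(** Two decorations without a common generator are the two single copies. *)
Lemma split_share (V : Type) (f : bool -> V) c c' :
  (exists s e1 e2 f1 f2, split_word f c = e1 ++ s :: e2 /\ split_word f c' = f1 ++ s :: f2) \/
  (exists z, c = One z /\ c' = One (~~ z)).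
Proof.
case: c c' => [b|] [b'|].
- case: (eqVneq b' b) => [->|nb]; first by left; exists (f b), [::], [::], [::], [::].
  by right; exists b; split=> //; case: b b' nb => [] [].
- left; case: b; first by exists (f true), [::], [::], [:: f false], [::].
  by exists (f false), [::], [::], [::], [:: f true].
- left; case: b'; first by exists (f true), [:: f false], [::], [::], [::].
  by exists (f false), [::], [:: f true], [::], [::].
- by left; exists (f false), [::], [:: f true], [::], [:: f true].
Qed.

Lemma braid_free_stable d : all ok d -> sep 0 1 (map fst d) -> sep n n.-1 (map fst d) ->
  braid_free mD (expandD d) -> stable n d.
Proof.
move=> Od S0 Sn BF; split=> // a x b y c E yx Nb.
have /and5P[Oa Ox Ob Oy Oc] : [&& all ok a, ok x, all ok b, ok y & all ok c].
  by move: Od; rewrite E all_cat /= all_cat.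
have G s e1 e2 f1 f2 : exD x = e1 ++ s :: e2 -> exD y = f1 ++ s :: f2 ->
    1 < count (edge mD s) (expandD b).
  move=> Ex Ey; have [A [B [C [EA sB _ _ <-]]]] :=
    @braid_free_gap _ _ _ 3 3 isT isT n2 _ exD_pos exD_uniq _ _ _ _ _ _ _ _ _ _ _ Od BF E (esym yx) Nb Ex Ey.
  rewrite EA in BF; apply: (gap_laced _ BF sB) => [s' t'|t _].
    exact: path_matrix_neq.
  rewrite /edge /cox_D /path_matrix; case: eqP => // _; case: ifP => // _.
  by case: s {Ex Ey EA sB BF} => [[?|?]|?]; case: t => [[?|?]|?].
rewrite /gap_ok; case: ifP => Hx.
  have [k [Ek Em]] := @midE bool bool n x.1 Hx.
  have Dx : exD x = [::] ++ sv bool bool k :: [::].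
    by rewrite exD_mid // Em.
  have Dy : exD y = [::] ++ sv bool bool k :: [::].
    by rewrite exD_mid ?yx // Em.
  have Hk : 0 < pos (sv bool bool k) < n by rewrite /= Ek; case/andP: Hx.
  by have := G _ _ _ _ _ Dx Dy; rewrite edge_count_mid //= -Ek.
have Hi := end_of 0 Ox Hx.
have Ew : map fst d = map fst a ++ x.1 :: map fst b ++ x.1 :: map fst c.
  by rewrite E map_cat /= map_cat /= yx.
have C0 : 0 < count_at (if x.1 == 0 then 1 else n.-1) b.
  rewrite lt0n -avoids_count_at avoids_mem negbK.
  have Nb' : x.1 \notin map fst b by rewrite -avoids_mem.
  case: Hi => xi; rewrite xi in Ew Nb' *; first exact: S0 Ew Nb'.
  have -> : (n == 0) = false by lia.
  exact: Sn Ew Nb'.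
split=> // C1; have [f [Ex _ Ey]] := exD_end Ox Hx.
have [[s [e1 [e2 [f1 [f2 [Hs Hs']]]]]]|//] := split_share f x.2 y.2.
have Dx := etrans Ex Hs; have Dy := etrans (Ey y yx) Hs'.
have ps : pos s = x.1 by exact: (pos_EX exD_pos Ox Dx).
have := G _ _ _ _ _ Dx Dy; rewrite edge_count_end ?ps //; last by case/andP: Ox.
by rewrite C1.
Qed.

(** If the two letters are consecutive at this end, they share a copy, so one neighbour is
not enough; otherwise each of the intermediate gaps brings a neighbour. *)
Lemma stable_end_gap (V : eqType) (f : bool -> V) s d d1 x d2 y d3 : stable n d ->
  d = d1 ++ x :: d2 ++ y :: d3 -> y.1 = x.1 -> (0 < x.1 < n) = false ->
  f true != f false -> s \in split_word f x.2 -> s \in split_word f y.2 ->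
  1 < count_at (if x.1 == 0 then 1 else n.-1) d2.
Proof.
move=> St Ed yx Hx fne; set k := if _ then _ else _.
have C1 u v z w r : d = u ++ v :: z ++ w :: r -> v.1 = x.1 -> w.1 = x.1 -> avoids x.1 z -> 0 < count_at k z.
  move=> E' vx wx Nz; have [_ /(_ _ _ _ _ _ E')] := St.
  by rewrite vx wx /gap_ok vx Hx => /(_ erefl Nz)[].
have [Nd2|] := boolP (avoids x.1 d2).
  have [_ /(_ _ _ _ _ _ Ed yx Nd2)] := St; rewrite /gap_ok Hx -/k => -[c0 c1].
  move=> sx sy; rewrite ltn_neqAle c0 andbT; apply/eqP => /esym/c1[z [xz yz]].
  move: sx sy; rewrite xz yz /= !inE => /eqP-> /eqP.
  by move: fne; case: z {xz yz} => /eqP fne // E'; case: fne.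
move=> /has_split[e [z [f' [E2 zx Ne]]]] _ _.
have H1 : 0 < count_at k e.
  by apply: (C1 d1 x e z (f' ++ y :: d3)) => //; rewrite Ed E2 -?catA /= -?catA.
suff H2 : 0 < count_at k f' by rewrite E2 count_at_cat count_at_cons; lia.
have [Nf|] := boolP (avoids x.1 f').
  by apply: (C1 (d1 ++ x :: e) z f' y d3) => //; rewrite Ed E2 -?catA /= -?catA.
move=> /has_split[e' [z' [f'' [E3 zx' Ne']]]].
have : 0 < count_at k e'.
  by apply: (C1 (d1 ++ x :: e) z e' z' (f'' ++ y :: d3)) => //; rewrite Ed E2 E3 -?catA /= -?catA.
by rewrite E3 count_at_cat; lia.
Qed.

(** The gap of a generator of an end may contain letters with the other copy, which is the
case handled by [stable_end_gap]; for the other generators the gap condition applies directly. *)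
Lemma stable_braid_free d : stable n d -> braid_free mD (expandD d).
Proof.
move=> St; have Od := stable_ok St; apply: laced_braid_free => [s|s t|s t|A s B C E sB].
- exact: path_matrix1.
- exact: path_matrixC.
- rewrite /cox_D /path_matrix; case: eqP => // _; case: ifP => // _.
  by case: s => [[?|?]|?]; case: t => [[?|?]|?].
have [d1 [x [d2 [y [d3 [e1 [e2 [f1 [f2 [Ed Ex Ey EB]]]]]]]]]] := expand_gap exD_uniq E sB.
have /and5P[O1 Ox O2 Oy O3] : [&& all ok d1, ok x, all ok d2, ok y & all ok d3].
  by move: Od; rewrite Ed all_cat /= all_cat.
have px := pos_EX exD_pos Ox Ex; have py := pos_EX exD_pos Oy Ey.
have yx : y.1 = x.1 by rewrite -px -py.
apply: (@leq_trans (count (edge mD s) (expandD d2))); last by rewrite EB !count_cat; lia.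
have [Hx|Hx] := boolP (0 < x.1 < n).
  rewrite edge_count_mid ?px //.
  have Nd2 : avoids x.1 d2.
    apply/contraT => /has_split[e [z [f [E2 zx Ne]]]].
    have Oz : ok z by move: O2; rewrite E2 all_cat /= => /and3P[].
    have [k [_ Em]] := @midE bool bool n x.1 Hx.
    have Ez : exD z = exD x by rewrite !exD_mid ?zx.
    have Dx : exD x = [:: sv bool bool k] by rewrite exD_mid // Em.
    have sx : s \in exD x by rewrite Ex mem_cat inE eqxx orbT.
    have sk : s = sv bool bool k by move: sx; rewrite Dx inE => /eqP.
    by move: sB; rewrite EB E2 expand_cat expand_cons Ez Dx sk !mem_cat !inE eqxx !orbT.
  have [_ /(_ _ _ _ _ _ Ed yx Nd2)] := St.
  by rewrite /gap_ok Hx.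
have Hs : (0 < pos s < n) = false by rewrite px; exact: negbTE.
have sn : pos s <= n by rewrite px; case/andP: Ox.
rewrite edge_count_end // px; set k := if _ then _ else _.
have [f [Dx fne Df]] := exD_end Ox (negbTE Hx).
by apply: (stable_end_gap St Ed yx (negbTE Hx) fne (s := s));
  rewrite -?Dx -?(Df y yx) ?Ex ?Ey mem_cat inE eqxx orbT.
Qed.

End TypeD.

(** * Collapsing braid-free words *)

Lemma has_first (T : Type) (P : pred T) b : has P b ->
  exists b1 x b2, [/\ b = b1 ++ x :: b2, ~~ has P b1 & P x].
Proof.
elim: b => //= x b IH; case: (boolP (P x)) => [px _|px /= /IH].
  by exists [::], x, b.
by move=> [b1 [y [b2 [-> N1 py]]]]; exists (x :: b1), y, b2; rewrite /= negb_or px.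
Qed.

Lemma sep_cons_neq l m x u : l != x -> sep l m u -> sep l m (x :: u).
Proof.
move=> lx S [|y a] b c /=; first by case=> E; rewrite E eqxx in lx.
by case=> _; exact: S.
Qed.

Lemma sep_cons l m u : sep l m u ->
  (forall a r, u = a ++ l :: r -> l \notin a -> m \in a) -> sep l m (l :: u).
Proof. by move=> S H [|y a] b c /= [] => [|_]; [exact: H|exact: S]. Qed.

(** Adding one copy of an end e in front of an expansion: if the other copy occurs before any
neighbour [nb] of e, both commute together and are merged into a double letter. *)
Section Absorb.
Variables (L R : finType) (n p q : nat).
Hypotheses (p2 : 2 < p) (q2 : 2 < q) (n2 : 2 <= n).
Notation V := (vertex L R n).
Notation mat := (@path_matrix L R n p q).
Variable letter_word : letter -> seq V.
Notation ok := (letter_ok n).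
Hypothesis EX_pos : forall x, ok x -> all (fun v => pos v == x.1) (letter_word x).
Hypothesis EX_uniq : forall x, uniq (letter_word x).
Notation expand := (expand letter_word).
Notation "u === v" := (commutation_equiv mat u v) (at level 70).

Variables (e nb : nat) (f : bool -> V).
Hypothesis e_end : e = 0 /\ nb = 1 \/ e = n /\ nb = n.-1.
Hypothesis EXe : forall c, letter_word (e, c) = split_word f c.
Hypothesis f_neq : f true != f false.

Let path_matrix_neq2 (s t : V) : s != t -> 1 < mat s t.
Proof. exact: path_matrix_neq. Qed.

Lemma pos_f b : pos (f b) = e.
Proof.
have Oe : ok (e, One b) by rewrite /letter_ok /=; case: e_end => -[-> _]; rewrite ?ltnn ?andbF /= ?leqnn.
by have := EX_pos Oe; rewrite EXe /= andbT => /eqP.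
Qed.

Lemma far_commute b d : all ok d -> avoids e d -> avoids nb d ->
  all (fun v => mat (f b) v == 2) (expand d).
Proof.
elim: d => // x d IH /andP[Ox Od] /andP[xe Ne] /andP[xn Nn].
rewrite all_cat IH // andbT; apply: sub_all (EX_pos Ox) => v /eqP pv.
have /andP[x_n _] := Ox; apply/eqP; apply: commute2.
- exact: path_matrix_neq.
- by apply/eqP => E; rewrite -pv E pos_f eqxx in xe.
rewrite edgeP // pos_f pv negb_or; move: (x.1) x_n xe xn => k kn ke kb.
by case: e_end ke kb => -[-> ->] ke kb; apply/andP; split; apply/eqP; lia.
Qed.

Lemma absorb b d : all ok d -> braid_free mat (f b :: expand d) -> exists d',
  [/\ all ok d', f b :: expand d === expand d' &
     map fst d' = map fst d \/ (map fst d' = e :: map fst d /\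
       forall a r, map fst d = a ++ e :: r -> e \notin a -> nb \in a)].
Proof.
move=> Od BF; have ne : nb != e by apply/eqP; case: e_end => -[-> ->]; lia.
have Oe c : ok (e, c).
  by rewrite /letter_ok /=; case: e_end => -[-> _]; rewrite ?ltnn ?andbF /= ?leqnn.
have Hnew : f b :: expand d === expand ((e, One b) :: d).
  by rewrite expand_cons EXe; exact: ceq_refl.
have nohas u : ~~ has (fun z : letter => (z.1 == e) || (z.1 == nb)) u -> avoids e u /\ avoids nb u.
  by elim: u => //= z u IH; rewrite !negb_or => /andP[/andP[-> ->] /IH[-> ->]].
have [|Nd] := boolP (has (fun z : letter => (z.1 == e) || (z.1 == nb)) d); last first.
  exists ((e, One b) :: d); split=> //=; first by rewrite Oe.
  right; split=> // a r E ea; have [] := nohas d Nd; rewrite avoids_mem.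
  by rewrite E mem_cat inE eqxx orbT.
move=> /has_first[d1 [x [d2 [Ed N1 /orP[/eqP xe|/eqP xn]]]]]; last first.
  exists ((e, One b) :: d); split=> //=; first by rewrite Oe.
  right; split=> // a r; rewrite Ed map_cat /= => E ea.
  case: (cat_cons_split E) => [[u [E1 _]]|[[|y u] [-> /=]]].
  - have [] := nohas d1 N1; rewrite avoids_mem.
    by rewrite E1 mem_cat inE eqxx orbT.
  - by case=> E2; rewrite -E2 xn eqxx in ne.
  by case=> <- _; rewrite mem_cat inE xn eqxx orbT.
have /and3P[O1 Ox O2] : [&& all ok d1, ok x & all ok d2] by move: Od; rewrite Ed all_cat.
have [Ne Nn] := nohas d1 N1.
have FC := far_commute b O1 Ne Nn.
have Ex : letter_word x = split_word f x.2 by rewrite -EXe -xe -surjective_pairing.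
have BF' : forall r1 r2, letter_word x <> r1 ++ f b :: r2.
  move=> r1 r2 Er; rewrite Ed expand_cat expand_cons Er -catA in BF.
  have nbd : f b \notin expand d1 by apply: (expand_avoids EX_pos) => //; rewrite pos_f.
  have nr : f b \notin r1.
    by have := EX_uniq x; rewrite Er cat_uniq /= negb_or => /and3P[_ /andP[]].
  have nr2 : all (fun v => mat (f b) v == 2) r1.
    apply/allP => v vr; apply/eqP; apply: commute2.
    - exact: path_matrix_neq.
    - by apply: contraNneq nr => <-.
    rewrite edgeP // pos_f.
    have /allP/(_ v) := EX_pos Ox; rewrite Er mem_cat vr => /(_ isT)/eqP->.
    by rewrite xe orbb ltn_eqF.
  have nE : f b \notin expand d1 ++ r1 by rewrite mem_cat negb_or nbd.
  have BF2 : braid_free mat ([::] ++ f b :: (expand d1 ++ r1) ++ f b :: (r2 ++ expand d2)).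
    by move: BF; rewrite -!catA.
  have := gap_edge path_matrix_neq2 BF2 nE; rewrite has_cat => /orP[] /hasP[v vr].
    by have /allP/(_ v vr)/eqP := FC; rewrite /edge => ->.
  by have /allP/(_ v vr)/eqP := nr2; rewrite /edge => ->.
case Ec: x.2 => [b'|]; last first.
  exfalso; move: BF'; rewrite Ex Ec /=; case: (b) => H.
    by case: (H [:: f false] [::]).
  by case: (H [::] [:: f true]).
have bb : b' = ~~ b.
  by case: b b' Ec BF' {BF Hnew FC} => [] [] Ec //; rewrite Ex Ec /= => /(_ [::] [::]).
exists (d1 ++ (e, Both) :: d2); split.
- by rewrite all_cat O1 /= Oe.
- rewrite Ed !expand_cat !expand_cons Ex Ec bb EXe /=.
  apply: ceq_trans (ceq_move _ FC) _; apply: ceq_catl.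
  case: (b) => /=; last exact: ceq_refl.
  have ft : mat (f true) (f false) = 2.
    apply: commute2; [exact: path_matrix_neq|by rewrite eq_sym|].
    by rewrite edgeP // !pos_f orbb ltn_eqF.
  exact/rst_step/(CommutationStep [::] _ ft).
by left; rewrite Ed !map_cat /= xe.
Qed.

End Absorb.

Section Collapse.
Variables (L R : finType) (n p q : nat).
Hypotheses (p2 : 2 < p) (q2 : 2 < q) (n2 : 2 <= n).
Notation mat := (@path_matrix L R n p q).
Notation "u === v" := (commutation_equiv mat u v) (at level 70).
Notation ok := (letter_ok n).

(** Induction on the word: it suffices to absorb one generator at a time. *)
Lemma collapse_word (letter_word : letter -> seq (vertex L R n)) (Q : seq nat -> Prop) v :
  Q [::] ->
  (forall x d, all ok d -> Q (map fst d) -> braid_free mat (x :: expand letter_word d) ->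
     exists d', [/\ all ok d', x :: expand letter_word d === expand letter_word d' & Q (map fst d')]) ->
  braid_free mat v ->
  exists d, [/\ all ok d, v === expand letter_word d & Q (map fst d)].
Proof.
move=> Q0 Qs; elim: v => [|x v IH] BF; first by exists [::]; split=> //; exact: ceq_refl.
have [d [Od vd Qd]] := IH (braid_free_cons BF).
have H : x :: v === x :: expand letter_word d by exact: (@ceq_catl _ mat [:: x]).
have [d' [Od' vd' Qd']] := Qs x d Od Qd (braid_free_commutation BF H).
by exists d'; split=> //; exact: ceq_trans H vd'.
Qed.

End Collapse.

Lemma mid_sv (L R : finType) n (i : 'I_n.-1) : mid L R n i.+1 = [:: sv L R i].
Proof.
have [|k [Ek ->]] := @midE L R n i.+1; first by have := ltn_ord i; lia.
by congr [:: sv L R _]; apply: val_inj; case: Ek.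
Qed.

Section CollapseD.
Variable n : nat.
Hypothesis n2 : 2 <= n.
Notation ok := (letter_ok n).
Notation mD := (@cox_D n).

Lemma collapse_D v : braid_free mD v -> exists d, [/\ all ok d,
  commutation_equiv mD v (expand (@exD n) d) & sep 0 1 (map fst d) /\ sep n n.-1 (map fst d)].
Proof.
apply: (@collapse_word _ _ n 3 3 _ (fun u => sep 0 1 u /\ sep n n.-1 u)).
  by split=> -[|? ?].
have n0 : 0 != n by lia.
move=> [[b|i]|b] d Od [S0 Sn] BF.
- have [|||d' [Od' E H]] := @absorb _ _ n 3 3 isT isT n2 (@exD n) (exD_pos n2) (@exD_uniq n)
    0 1 (@tD n) _ _ _ b d Od BF; [by left|by []|by []|].
  exists d'; split=> //; case: H => [-> //|[-> H]].
  by split; [exact: sep_cons|apply: sep_cons_neq; rewrite // eq_sym].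
- have Hi : 0 < i.+1 < n by have := ltn_ord i; lia.
  exists ((i.+1, One false) :: d); split=> /=.
  + by rewrite Od andbT /letter_ok /= implybT andbT ltnW.
  + by rewrite expand_cons exD_mid // mid_sv; exact: ceq_refl.
  by split; apply: sep_cons_neq => //; apply/eqP; lia.
- have [|||d' [Od' E H]] := @absorb _ _ n 3 3 isT isT n2 (@exD n) (exD_pos n2) (@exD_uniq n)
    n n.-1 (@uD n) _ _ _ b d Od BF; [by right| |by []|].
    by move=> c; rewrite /exD /= eqxx eq_sym (negPf n0).
  exists d'; split=> //; case: H => [-> //|[-> H]].
  by split; [apply: sep_cons_neq|exact: sep_cons].
Qed.

End CollapseD.

(** * Expansions of type affine B *)

Section CollapseB.
Variable n : nat.
Hypothesis n2 : 2 <= n.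
Notation ok := (letter_ok n).
Notation mB := (@cox_B n).

(** The decoration of the right end is ignored. *)
Definition exB (x : letter) : seq (Btype n) :=
  if x.1 == 0 then split_word (@tB n) x.2
  else if x.1 == n then [:: uB n] else mid bool unit n x.1.

Lemma exB_mid x : 0 < x.1 < n -> exB x = mid bool unit n x.1.
Proof.
move=> Hx; rewrite /exB; have -> : (x.1 == 0) = false by lia.
by have -> : (x.1 == n) = false by lia.
Qed.

Lemma exB_n x : x.1 = n -> exB x = [:: uB n].
Proof. by rewrite /exB => ->; rewrite eqxx; have -> : (n == 0) = false by lia. Qed.

Lemma exB_pos x : ok x -> all (fun v => pos v == x.1) (exB x).
Proof.
move=> /andP[xn _]; rewrite /exB; case: eqP => [->|x0]; first by case: x.2.
case: eqP => [->|xn']; first by rewrite /= eqxx.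
have [|k [Ek ->]] := @midE bool unit n x.1; first by lia.
by rewrite /= Ek eqxx.
Qed.

Lemma exB_uniq x : uniq (exB x).
Proof.
rewrite /exB; case: ifP => _; first by case: x.2.
case: ifP => // _.
by rewrite /mid; case: insub.
Qed.

Lemma collapse_B v : braid_free mB v -> exists d, [/\ all ok d,
  commutation_equiv mB v (expand exB d) & sep 0 1 (map fst d) /\ sep n n.-1 (map fst d)].
Proof.
apply: (@collapse_word _ _ n 3 4 _ (fun u => sep 0 1 u /\ sep n n.-1 u)).
  by split=> -[|? ?].
have n0 : 0 != n by lia.
move=> [[b|i]|b] d Od [S0 Sn] BF.
- have [|||d' [Od' E H]] := @absorb _ _ n 3 4 isT isT n2 exB exB_pos exB_uniq
    0 1 (@tB n) _ _ _ b d Od BF; [by left|by []|by []|].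
  exists d'; split=> //; case: H => [-> //|[-> H]].
  by split; [exact: sep_cons|apply: sep_cons_neq; rewrite // eq_sym].
- have Hi : 0 < i.+1 < n by have := ltn_ord i; lia.
  exists ((i.+1, One false) :: d); split=> /=.
  + by rewrite Od andbT /letter_ok /= implybT andbT ltnW.
  + by rewrite expand_cons exB_mid // mid_sv; exact: ceq_refl.
  by split; apply: sep_cons_neq => //; apply/eqP; lia.
have Hb : (inr b : Btype n) = uB n by case: b {BF}.
rewrite Hb in BF *; exists ((n, One false) :: d); split=> /=.
- by rewrite Od andbT /letter_ok /= leqnn implybT.
- by rewrite expand_cons exB_n //; exact: ceq_refl.
split; first exact: sep_cons_neq.
apply: sep_cons => // a r E0.
have [d1 [z [d2 [Ed Ea zn _]]]] := map_cons_split E0.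
rewrite -Ea -!avoids_mem => Nn.
have /and3P[O1 Oz O2] : [&& all ok d1, ok z & all ok d2] by move: Od; rewrite Ed all_cat.
have BF2 : braid_free mB ([::] ++ uB n :: expand exB d1 ++ uB n :: expand exB d2).
  by move: BF; rewrite Ed expand_cat expand_cons exB_n.
have H := @gap_edge _ mB (@path_matrix_neq _ _ n 3 4 isT isT) _ _ _ _ BF2 (expand_avoids exB_pos (s := uB n) O1 Nn).
have /hasP[s sd] := H.
rewrite edgeP // => /orP[] /eqP ps; last first.
  exfalso; move: sd; apply/negP; apply: (expand_avoids exB_pos) => //.
  elim: (d1) O1 => //= x u IH /andP[/andP[xn _] /IH ->].
  by rewrite andbT ps /=; lia.
have -> : n.-1 = pos s by have : n = (pos s).+1 := ps; lia.
apply: contraTT sd; rewrite -avoids_mem => Ns; exact: (expand_avoids exB_pos).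
Qed.

End CollapseB.

(** * Decorations of the right end in type affine B *)

Section Redecorate.
Variable n : nat.
Hypothesis n2 : 2 <= n.

(** The next letter of position n is reached after exactly one letter of position n - 1, k of
which have already been passed. *)
Fixpoint near (k : nat) (r : seq letter) : bool :=
  if r is x :: r' then if x.1 == n then k == 1 else near (k + (x.1 == n.-1)) r'
  else false.

(** Letters n at distance one in the sense of [near] from another one receive alternating
single copies z; the others are double. Starting with k = 2 means that there is
no previous letter n. *)
Fixpoint redecorate (z : bool) (k : nat) (d : seq letter) : seq letter :=
  if d is x :: r then
    if x.1 == n then (n, if (k == 1) || near 0 r then One z else Both) :: redecorate (~~ z) 0 r
    else x :: redecorate z (k + (x.1 == n.-1)) r
  else [::].

Lemma near_split k r : near k r -> exists b y c,
  [/\ r = b ++ y :: c, y.1 = n, avoids n b & k + count_at n.-1 b = 1].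
Proof.
elim: r k => //= x r IH k; case: eqP => [xn /eqP ->|/eqP xn /IH[b [y [c [-> yn Nb E]]]]].
  by exists [::], x, r.
by exists (x :: b), y, c; rewrite avoids_cons xn count_at_cons addnA.
Qed.

Lemma redecorate_near z j k d : near k (redecorate z j d) = near k d.
Proof.
elim: d z j k => //= x d IH z j k; case: eqP => [xn|/eqP/negPf xn] /=; first by rewrite eqxx.
by rewrite xn IH.
Qed.

Lemma redecorate_fst z k d : map fst (redecorate z k d) = map fst d.
Proof. by elim: d z k => //= x d IH z k; case: eqP => [->|_] /=; rewrite IH. Qed.

Lemma redecorate_ok z k d : all (letter_ok n) d -> all (letter_ok n) (redecorate z k d).
Proof.
elim: d z k => //= x d IH z k /andP[Ox Od]; case: eqP => [xn|_] /=; rewrite IH ?andbT //.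
by rewrite /letter_ok /= leqnn ltnn andbF.
Qed.

Lemma redecorate_expand z k d : expand (@exB n) (redecorate z k d) = expand (@exB n) d.
Proof.
elim: d z k => //= x d IH z k; case: eqP => [xn|_] /=; rewrite !expand_cons IH //.
by rewrite !exB_n.
Qed.

Lemma redecorate_first z k d b y c : redecorate z k d = b ++ y :: c -> y.1 = n -> avoids n b ->
  k + count_at n.-1 b = 1 -> y.2 = One z /\ near k d.
Proof.
elim: d z k b => [|x d IH] z k [|w b] //=; case: eqP => [xn|xn].
- by case=> <- _ _ _; rewrite addn0 => -> /=; split.
- by case=> <- _ /xn.
- by case=> <- _; rewrite /= eqxx.
case=> <- E yn /andP[_ Nb]; rewrite addnA => H.
exact: IH E yn Nb H.
Qed.

Lemma redecorate_at z k d a x r : redecorate z k d = a ++ x :: r -> x.1 = n ->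
  exists z' k' d0, [/\ x.2 = (if (k' == 1) || near 0 d0 then One z' else Both),
    r = redecorate (~~ z') 0 d0 & k' = 1 -> (avoids n a /\ k + count_at n.-1 a = 1) \/
      exists a1 w a2, [/\ a = a1 ++ w :: a2, w.1 = n, avoids n a2 & count_at n.-1 a2 = 1]].
Proof.
elim: d z k a => [|y d IH] z k [|w a] //=; case: eqP => [yn|yn].
- case=> <- <- _; exists z, k, d; split=> //= ->; by left.
- by case=> <- _ /yn.
- case=> <- E xn; have [z' [k' [d0 [H1 H2 H3]]]] := IH _ _ _ E xn.
  exists z', k', d0; split=> // /H3[[Na E1]|[a1 [w' [a2 [-> wn N2 E2]]]]]; right.
    by exists [::], (n, if (k == 1) || near 0 d then One z else Both), a.
  by exists ((n, if (k == 1) || near 0 d then One z else Both) :: a1), w', a2.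
case=> <- E xn; have [z' [k' [d0 [H1 H2 H3]]]] := IH _ _ _ E xn.
exists z', k', d0; split=> // /H3[[Na E1]|[a1 [w' [a2 [-> wn N2 E2]]]]].
  left; split; first by apply/andP; split=> //; apply/eqP.
  by rewrite -E1 -addnA.
by right; exists (y :: a1), w', a2.
Qed.

Lemma redecorate_opposite z k d a x b y c : redecorate z k d = a ++ x :: b ++ y :: c ->
  x.1 = n -> y.1 = n -> avoids n b -> count_at n.-1 b = 1 ->
  exists z', x.2 = One z' /\ y.2 = One (~~ z').
Proof.
move=> E xn yn Nb C; have [z' [k' [d0 [-> E0 _]]]] := redecorate_at E xn.
have [-> Nr] := redecorate_first (k := 0) (esym E0) yn Nb C.
by exists z'; rewrite Nr orbT.
Qed.

Lemma redecorate_linked z d a x r b : redecorate z 2 d = a ++ x :: r -> x.1 = n -> x.2 = One b ->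
  (exists b y c, [/\ r = b ++ y :: c, y.1 = n, avoids n b & count_at n.-1 b = 1]) \/
  (exists a1 w a2, [/\ a = a1 ++ w :: a2, w.1 = n, avoids n a2 & count_at n.-1 a2 = 1]).
Proof.
move=> E xn; have [z' [k' [d0 [-> E0 H]]]] := redecorate_at E xn.
have [/H[[_]|]|_] := eqVneq k' 1; [by lia|by right|].
have [Nr _|//] := boolP (near 0 d0); left.
by apply: (@near_split 0); rewrite E0 redecorate_near.
Qed.

End Redecorate.

Section GapB.
Variable n : nat.
Hypothesis n2 : 2 <= n.
Notation ok := (letter_ok n).
Notation mB := (@cox_B n).
Notation exB := (@exB n).
Notation expandB := (expand exB).

Lemma pcountB j d : all ok d -> j < n -> pcount j (expandB d) = weight j d.
Proof.
move=> Od jn; apply: (pcount_expand (exB_pos n2) Od) => x Ox xj; rewrite /exB /weight1.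
case: eqP => [_|x0]; first by case: x.2.
case: eqP => [E|_]; first by lia.
have Hi : 0 < x.1 < n by lia.
by have [k [_ ->]] := @midE bool unit n x.1 Hi; rewrite (letter_okP Ox).
Qed.

Lemma pcountBn d : all ok d -> pcount n (expandB d) = count_at n d.
Proof.
move=> Od; apply: (pcount_expand1 (exB_pos n2) Od) => x Ox xn.
by rewrite exB_n.
Qed.

Lemma mB_neq (s t : Btype n) : s != t -> 1 < mB s t.
Proof. exact: path_matrix_neq. Qed.

Lemma mB3 (s t : Btype n) : edge mB s t -> s != uB n -> t != uB n -> mB s t = 3.
Proof.
rewrite /edge /cox_B /path_matrix; case: eqP => // _; case: ifP => // _ _.
by case: s => [[?|?]|[]]; case: t => [[?|?]|[]].
Qed.

Lemma pos_uB (s : Btype n) : (pos s == n) = (s == uB n).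
Proof.
case: s => [[b|i]|[]] /=; last by rewrite !eqxx.
  by apply/negbTE; apply/eqP; lia.
by apply/negbTE; apply/eqP; have := ltn_ord i; lia.
Qed.

Lemma no_expand s d : all ok d -> avoids (pos s) d -> s \notin expandB d.
Proof. exact: (expand_avoids (exB_pos n2)). Qed.

Lemma no_edge (s : Btype n) d : all ok d -> (forall j, j = (pos s).+1 \/ pos s = j.+1 -> avoids j d) ->
  ~~ has (edge mB s) (expandB d).
Proof.
move=> Od H; apply/hasP => -[t td].
rewrite edgeP // => Hp; move: td; apply/negP; apply: no_expand => //; apply: H.
by case/orP: Hp => /eqP; auto.
Qed.

Lemma no_big j d : all ok d -> n < j -> avoids j d.
Proof.
by elim: d => //= x u IH /andP[/andP[xn _] Ou] nj; rewrite IH // andbT; apply/eqP; lia.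
Qed.

(** A single copy at z means that there is another letter n with only one letter n - 1 in
between, namely x or y, so that u s u s or s u s u could be brought together. *)
Lemma single_n d a x b y c : redecorate n false 2 d = a ++ x :: b ++ y :: c ->
  all ok (redecorate n false 2 d) -> braid_free mB (expandB (redecorate n false 2 d)) ->
  x.1 = n.-1 -> y.1 = n.-1 -> avoids n.-1 b -> avoids n.-2 b -> count_at n b = 1 -> weight n b = 1 -> False.
Proof.
move=> E Od BF Ex1 Ey1 Nb N2 C1 Wn.
have /and5P[Oa Ox Ob Oy Oc] : [&& all ok a, ok x, all ok b, ok y & all ok c].
  by move: Od; rewrite E all_cat /= all_cat.
have [n1n nn2] : n.-1 != n /\ n = n.-1.+1 by clear -n2; split; [apply/eqP; lia|lia].
have [b1 [z [b2 [Eb zn Nb1]]]] : exists b1 z b2, [/\ b = b1 ++ z :: b2, z.1 = n & avoids n b1].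
  by apply: has_split; rewrite avoids_count_at C1.
have Nb2 : avoids n b2.
  move: C1; rewrite Eb count_at_cat count_at_cons zn eqxx avoids_count_at.
  by move: (count_at n b1) (count_at n b2) => u v; clear; lia.
have [beta Ez] : exists beta, z.2 = One beta.
  case Ez: z.2 => [beta|]; first by exists beta.
  move: Wn; rewrite Eb weight_cat weight_cons zn eqxx /weight1 Ez.
  by move: (weight n b1) (weight n b2) => u v; clear; lia.
have [Nx1 Nx2] : avoids n.-1 b1 /\ avoids n.-1 b2.
  by move: Nb; rewrite Eb avoids_cat avoids_cons => /and3P[].
have [Ny1 Ny2] : avoids n.-2 b1 /\ avoids n.-2 b2.
  by move: N2; rewrite Eb avoids_cat avoids_cons => /and3P[].
have [Ob1 Ob2] : all ok b1 /\ all ok b2.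
  by move: Ob; rewrite Eb all_cat /= => /and3P[].
have Hx : 0 < n.-1 < n by clear -n2; lia.
have [k [Ek Em]] := @midE bool unit n n.-1 Hx; set s := sv bool unit k.
have Dx : exB x = [:: s] by rewrite exB_mid ?Ex1 ?Em.
have Dy : exB y = [:: s] by rewrite exB_mid ?Ey1 ?Em.
have ps : pos s = n.-1 by rewrite /= Ek.
have pu : pos (uB n) = n by [].
have ms : mB s (uB n) = 4 by rewrite /cox_B /path_matrix /s /= Ek -nn2 eqxx orbT.
have NS u : all ok u -> avoids n.-1 u -> s \notin expandB u.
  by move=> Ou Nu; apply: no_expand; rewrite ?ps.
have NU u : all ok u -> avoids n u -> uB n \notin expandB u.
  by move=> Ou Nu; apply: no_expand.
have NeS u : all ok u -> avoids n u -> avoids n.-2 u -> ~~ has (edge mB s) (expandB u).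
  move=> Ou Nu Nu2; apply: no_edge => // j; rewrite ps -nn2 => -[-> //|nj].
  by have -> : j = n.-2 by rewrite nj.
have NeU u : all ok u -> avoids n.-1 u -> ~~ has (edge mB (uB n)) (expandB u).
  move=> Ou Nu; apply: no_edge => // j; rewrite pu => -[-> |nj]; first exact: no_big.
  by have -> : j = n.-1 by rewrite nj.
have Ez1 : exB z = [:: uB n] by rewrite exB_n.
have E' : redecorate n false 2 d = (a ++ x :: b1) ++ z :: b2 ++ y :: c.
  by rewrite E Eb -!catA /=.
have [[b' [w [c' [E1 wn Nb' Cb']]]]|[a1 [w [a2 [E1 wn Na2 Ca2]]]]] := redecorate_linked n2 E' zn Ez.
  have [[e [Ee _]]|[A' [EA' E2]]] := cat_cons_split E1.
    by move: Nb2; rewrite Ee avoids_cat avoids_cons wn eqxx andbF.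
  case: A' EA' E2 => [|y' c1] EA' /= [Ey]; first by move: n1n; rewrite -Ey1 Ey wn eqxx.
  move=> Ec; move: Cb' Nb'; rewrite EA' -Ey count_at_cat count_at_cons avoids_cat avoids_cons Ey1 eqxx.
  move=> Cc /and3P[_ _ Nc1]; have Nx3 : avoids n.-1 c1.
    by rewrite avoids_count_at; move: Cc; clear; move: (count_at _ b2) (count_at _ c1) => u v; lia.
  have Oc1 : all ok c1 by move: Oc; rewrite Ec all_cat => /andP[].
  have Ew1 : exB w = [:: uB n] by rewrite exB_n.
  have := @gap_double _ mB mB_neq (expandB a) s (expandB b1) (uB n) (expandB b2) (expandB c1) (expandB c').
  rewrite ms => H; apply: H (erefl _) => //; try by [apply: NS|apply: NU|apply: NeS|apply: NeU].
  by move: BF; rewrite E' Ec !(expand_cat, expand_cons) Dx Dy Ez1 Ew1 -!catA.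
have [[e [Ee Ea2]]|[A' [EA' E2]]] := cat_cons_split E1; last first.
  case: A' EA' E2 => [|y' c1] EA' /= [Ey]; first by move: n1n; rewrite -Ex1 Ey wn eqxx.
  by move=> Eb1; move: Nb1; rewrite Eb1 avoids_cat avoids_cons wn eqxx andbF.
move: Ca2 Na2; rewrite Ea2 count_at_cat count_at_cons avoids_cat avoids_cons Ex1 eqxx.
move=> Cc /and3P[Ne _ _]; have Nxe : avoids n.-1 e.
  by rewrite avoids_count_at; move: Cc; clear; move: (count_at _ e) (count_at _ b1) => u v; lia.
have Oe : all ok e by move: Oa; rewrite Ee all_cat /= => /and3P[].
have Ew1 : exB w = [:: uB n] by rewrite exB_n.
have := @gap_double _ mB mB_neq (expandB a1) (uB n) (expandB e) s (expandB b1) (expandB b2) (expandB c).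
have ms' : mB (uB n) s = 4 by rewrite -ms; exact: path_matrixC.
rewrite ms' => H; apply: H (erefl _) => //; try by [apply: NS|apply: NU|apply: NeS|apply: NeU].
by move: BF; rewrite E' Ee !(expand_cat, expand_cons) Dx Dy Ez1 Ew1 -!catA.
Qed.

(** The gaps of u are stable by the choice of the decorations; those of s_(n-1)
because a lone u in such a gap is double by [single_n]; all the other edges have label 3. *)
Lemma braid_free_stable_B d : all ok d -> sep 0 1 (map fst d) -> sep n n.-1 (map fst d) ->
  braid_free mB (expandB d) -> exists d2, expandB d2 = expandB d /\ stable n d2.
Proof.
move=> Od0 S0 Sn BF0; exists (redecorate n false 2 d); split; first exact: redecorate_expand.
have Od := redecorate_ok false 2 Od0; have Ef := redecorate_fst n false 2 d.
move: BF0; rewrite -(redecorate_expand n2 false 2) -Ef in S0 Sn * => BF.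
move Ed2 : (redecorate n false 2 d) => d2; rewrite Ed2 in S0 Sn BF Od; clear Ef.
split=> // a x b y c E yx Nb.
have /and5P[Oa Ox Ob Oy Oc] : [&& all ok a, ok x, all ok b, ok y & all ok c].
  by move: Od; rewrite E all_cat /= all_cat.
have BG s e1 e2 f1 f2 : exB x = e1 ++ s :: e2 -> exB y = f1 ++ s :: f2 ->
    exists A B C, [/\ expandB d2 = A ++ s :: B ++ s :: C, s \notin B,
      B = e2 ++ expandB b ++ f1 & count (edge mB s) B = count (edge mB s) (expandB b)].
  move=> Ex Ey; have [A [B [C [EA sB _ H1 H2]]]] :=
    @braid_free_gap _ _ _ 3 4 isT isT n2 _ (exB_pos n2) (@exB_uniq n) _ _ _ _ _ _ _ _ _ _ _ Od BF E (esym yx) Nb Ex Ey.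
  by exists A, B, C.
have CE s : pos s < n.-1 -> count (edge mB s) (expandB b) =
    (if pos s is k.+1 then weight k b else 0) + weight (pos s).+1 b.
  move=> sn; rewrite count_edge_pos // pcountB //; last by lia.
  by case: (pos s) sn => // k kn; rewrite pcountB //; lia.
have G s e1 e2 f1 f2 : pos s < n.-1 -> exB x = e1 ++ s :: e2 -> exB y = f1 ++ s :: f2 ->
    1 < count (edge mB s) (expandB b).
  move=> sn Ex Ey; have [A [B [C [EA sB _ <-]]]] := BG _ _ _ _ _ Ex Ey.
  rewrite EA in BF; apply: (gap_laced mB_neq BF sB) => t _ et.
  apply: mB3 => //; rewrite -pos_uB; apply/eqP; first by clear -sn; lia.
  by move: et; rewrite edgeP // => /orP[] /eqP; clear -sn; lia.
rewrite /gap_ok; case: ifP => Hx; last first.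
  have Ew : map fst d2 = map fst a ++ x.1 :: map fst b ++ x.1 :: map fst c.
    by rewrite E map_cat /= map_cat /= yx.
  have Nb' : x.1 \notin map fst b by rewrite -avoids_mem.
  have [x0|xn] : x.1 = 0 \/ x.1 = n by have /andP[] := Ox; clear -Hx; lia.
    rewrite x0 /= in Ew Nb' *; split.
      by rewrite lt0n -avoids_count_at avoids_mem negbK; exact: S0 Ew Nb'.
    move=> C1; have Ex : exB x = split_word (@tB n) x.2 by rewrite /exB x0.
    have Ey : exB y = split_word (@tB n) y.2 by rewrite /exB yx x0.
    have [[s [e1 [e2 [f1 [f2 [Hs Hs']]]]]]|//] := split_share (@tB n) x.2 y.2.
    have Dx := etrans Ex Hs; have Dy := etrans Ey Hs'.
    have ps : pos s = 0 by rewrite (pos_EX (exB_pos n2) Ox Dx).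
    have n10 : 0 < n.-1 by clear -n2; lia.
    by have := G _ _ _ _ _ _ Dx Dy; rewrite CE ps // (@weight_int n) // C1 => /(_ n10).
  have n0 : (n == 0) = false by clear -n2; lia.
  rewrite xn n0; split.
    rewrite lt0n -avoids_count_at avoids_mem negbK; rewrite xn in Ew Nb'; exact: Sn Ew Nb'.
  move=> C1; rewrite -Ed2 in E; rewrite xn in Nb yx; exact: redecorate_opposite E xn yx Nb C1.
have [k [Ek Em]] := @midE bool unit n x.1 Hx; set s := sv bool unit k.
have Dx : exB x = [::] ++ s :: [::] by rewrite exB_mid // Em.
have Dy : exB y = [::] ++ s :: [::] by rewrite exB_mid ?yx // Em.
have ps : pos s = x.1 by rewrite /= Ek.
have [xn1|xn1] := ltnP x.1 n.-1.
  by have := G _ _ _ _ _ _ Dx Dy; rewrite CE ps // => /(_ xn1); rewrite -Ek.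
have Ex1 : x.1 = n.-1 by clear -Hx xn1; lia.
rewrite leqNgt; apply/negP => Lt'.
have Lt : weight n.-2 b + weight n b < 2.
  have nn2 : n.-1.+1 = n by clear -n2; lia.
  by rewrite Ex1 nn2 in Lt'.
have [A [B [C [EA sB EB CB]]]] := BG _ _ _ _ _ Dx Dy.
have Wn : count_at n b <= weight n b by exact: count_at_leW.
have EBb : B = expandB b by rewrite EB cats0.
have BF1 : braid_free mB (A ++ s :: B ++ s :: C) by rewrite -EA.
have Cs : count (edge mB s) B = weight n.-2 b + count_at n b.
  have En : n = n.-2.+2 by clear -n2; lia.
  have psn : pos s = n.-2.+1 by rewrite ps Ex1; clear -n2; lia.
  rewrite CB (count_edge_S _ _ _ psn) // pcountB //; last by clear -n2; lia.
  by rewrite -En pcountBn.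
have Nn : count_at n b <> 0.
  move=> c0; have : 1 < count (edge mB s) B.
    apply: (gap_laced mB_neq BF1 sB) => t tB et; apply: mB3 => //.
    apply: contraTneq tB => ->; rewrite EBb; apply: no_expand => //=.
    by rewrite avoids_count_at c0.
  by rewrite Cs c0 addn0; move: Lt; clear; move: (weight n b) => u; lia.
have W2 : weight n.-2 b = 0 by clear -Lt Wn Nn; lia.
have Wn1 : weight n b = 1 by clear -Lt Wn Nn; lia.
have N2 : avoids n.-2 b by rewrite avoids_count_at -leqn0 -W2 count_at_leW.
have C1 : count_at n b = 1 by clear -Wn1 Wn Nn; lia.
have Nb1 : avoids n.-1 b by rewrite -Ex1.
rewrite -Ed2 in E Od BF; exact: (single_n E Od BF Ex1 (etrans yx Ex1) Nb1 N2 C1 Wn1).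
Qed.

End GapB.

(** * Braid-free words of type affine B *)

Section StableB.
Variable n : nat.
Hypothesis n2 : 2 <= n.
Notation ok := (letter_ok n).
Notation mB := (@cox_B n).
Notation exB := (@exB n).
Notation expandB := (expand exB).

Lemma exB_single x : ok x -> 0 < x.1 -> exists w, exB x = [:: w] /\ pos w = x.1.
Proof.
move=> Ox x0; have /andP[xn _] := Ox.
case: (eqVneq x.1 n) => [E|E]; first by exists (uB n); rewrite exB_n.
have [|k [Ek Em]] := @midE bool unit n x.1; first by lia.
exists (sv bool unit k); rewrite exB_mid //; first by lia.
Qed.

Lemma pos_injB (s t : Btype n) : 0 < pos s -> pos t = pos s -> t = s.
Proof.
case: s => [[b|i]|[]] //=; case: t => [[b'|j]|[]] //=.
- by move=> _ [E]; congr (inl (inr _)); exact: val_inj.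
- by move=> _ E; have := ltn_ord i; rewrite -ltnS -E; lia.
- by lia.
by move=> _ E; have := ltn_ord j; lia.
Qed.

Lemma expand_at d A s B : all ok d -> expandB d = A ++ s :: B -> 0 < pos s ->
  exists d1 x d2, [/\ d = d1 ++ x :: d2, expandB d1 = A, x.1 = pos s & expandB d2 = B].
Proof.
move=> Od E ps; have [d1 [x [d2 [e1 [e2 [Ed Ex EA EB]]]]]] := expand_split E.
have Ox : ok x by move: Od; rewrite Ed all_cat /= => /and3P[].
have px := pos_EX (exB_pos n2) Ox Ex; rewrite px in ps.
have [w [Ew _]] := exB_single Ox ps.
exists d1, x, d2; move: Ex; rewrite Ew EA EB => Ex.
case: e1 Ex {EA} => [[_ <-]|? [|? ?]] //; by rewrite cats0.
Qed.

Lemma notin_expand s d : all ok d -> 0 < pos s -> s \notin expandB d -> avoids (pos s) d.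
Proof.
move=> Od ps sd; apply/contraT => /has_split[e [z [f [Ed zs _]]]].
have Oz : ok z by move: Od; rewrite Ed all_cat /= => /and3P[].
have [|w [Ew pw]] := exB_single Oz; first by rewrite zs.
have Ews : w = s by apply: pos_injB; rewrite // pw.
by move: sd; rewrite Ed expand_cat expand_cons Ew Ews !mem_cat inE eqxx !orbT.
Qed.

(** As in type affine D, except that in the gaps of s_(n-1) a double letter u counts for one
generator only. *)
Lemma stable_gap_B d A s B C : stable n d -> expandB d = A ++ s :: B ++ s :: C -> s \notin B ->
  0 < count (edge mB s) B /\ (s != uB n -> (edge mB s (uB n) -> uB n \notin B) -> 1 < count (edge mB s) B).
Proof.
move=> St E sB; have Od := stable_ok St.
have [ps|ps] := posnP (pos s).
  suff H : 1 < count (edge mB s) B by split=> //; exact: ltnW.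
  have [d1 [x [d2 [y [d3 [e1 [e2 [f1 [f2 [Ed Ex Ey EB]]]]]]]]]] := expand_gap (@exB_uniq n) E sB.
  have /and5P[O1 Ox O2 Oy O3] : [&& all ok d1, ok x, all ok d2, ok y & all ok d3].
    by move: Od; rewrite Ed all_cat /= all_cat.
  have px := pos_EX (exB_pos n2) Ox Ex; have py := pos_EX (exB_pos n2) Oy Ey.
  have yx : y.1 = x.1 by rewrite -px -py.
  have x0 : x.1 = 0 by rewrite -px.
  have Dx : exB x = split_word (@tB n) x.2 by rewrite /exB x0.
  have Dy : exB y = split_word (@tB n) y.2 by rewrite /exB yx x0.
  apply: (@leq_trans (count (edge mB s) (expandB d2))); last by rewrite EB !count_cat; lia.
  have n1 : 0 < 1 < n by [].
  rewrite count_edge_pos // ps add0n (pcountB n2 O2) // (weight_int O2 n1).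
  have Hx : (0 < x.1 < n) = false by rewrite x0.
  have H := stable_end_gap n2 (f := @tB n) (s := s) St Ed yx Hx isT.
  rewrite x0 /= in H; apply: H.
    by rewrite -Dx Ex mem_cat inE eqxx orbT.
  by rewrite -Dy Ey mem_cat inE eqxx orbT.
have [d1 [x [d' [Ed EA xs E']]]] := expand_at Od E ps.
have Od' : all ok d' by move: Od; rewrite Ed all_cat => /and3P[].
have [d2 [y [d3 [Ed' EB ys _]]]] := expand_at Od' E' ps.
have /and3P[O2 Oy O3] : [&& all ok d2, ok y & all ok d3].
  by move: Od'; rewrite Ed' all_cat.
have Ox : ok x by move: Od; rewrite Ed all_cat => /and3P[].
have yx : y.1 = x.1 by rewrite xs.
have Nd2 : avoids x.1 d2 by rewrite xs; apply: notin_expand; rewrite // EB.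
rewrite Ed' in Ed; have [_ /(_ _ _ _ _ _ Ed yx Nd2)] := St.
rewrite /gap_ok -EB xs; case: ifP => Hs.
  have Es : pos s = (pos s).-1.+1 by rewrite prednK.
  rewrite (count_edge_S _ _ _ Es) // -Es (pcountB n2 O2); last by clear -Hs; lia.
  have [sn|sn] := ltnP (pos s).+1 n.
    by rewrite (pcountB n2 O2) // => G; split=> [|_ _]; [exact: ltnW|].
  have Sn : (pos s).+1 = n by clear -Hs sn; lia.
  rewrite Sn.
  rewrite (pcountBn n2 O2) => G; split=> [|_ uN].
    have := avoids_count_at n d2; case: (count_at n d2) => [/avoids_weight Wn|]; last by lia.
    by move: G; rewrite Wn; lia.
  have Nn : avoids n d2.
    apply: (@notin_expand (uB n)) => //=; first by lia.
    by rewrite uN // edgeP //= Sn eqxx orbT.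
  by move: G; rewrite (avoids_weight Nn); lia.
move=> /= [c0 _].
have sn : pos s = n by have /andP[] := Ox; rewrite xs; clear -Hs ps; lia.
move: c0; rewrite gtn_eqF // => c0.
have En : pos s = n.-1.+1 by rewrite sn prednK //; lia.
have su : s = uB n by apply/eqP; rewrite -pos_uB // sn.
rewrite su eqxx; split=> //.
rewrite -su (count_edge_S _ _ _ En) // (pcountB n2 O2); last by clear -n2; lia.
apply: leq_trans (leq_addr _ _); apply: leq_trans c0 (count_at_leW _ _).
Qed.

Lemma lone_both d e1 x f1 z f2 y e2 : stable n d -> d = e1 ++ x :: (f1 ++ z :: f2) ++ y :: e2 ->
  x.1 = n.-1 -> y.1 = n.-1 -> z.1 = n -> avoids n.-1 f1 -> avoids n.-1 f2 -> avoids n f1 -> avoids n f2 ->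
  (exists2 p, pos p = n.-1 & count (edge mB p) (expandB (f1 ++ z :: f2)) = 1) -> z.2 = Both.
Proof.
move=> St Ed xn yn zn N1 N2 M1 M2 [p pp Cp].
have Of : all ok (f1 ++ z :: f2).
  by have := stable_ok St; rewrite Ed all_cat /= (all_cat _ (_ ++ _)) => /and3P[_ _ /andP[]].
have W0 : weight n.-2 (f1 ++ z :: f2) = 0.
  have Ep : pos p = n.-2.+1 by rewrite pp; clear -n2; lia.
  have En : n.-2.+2 = n by clear -n2; lia.
  move: Cp; rewrite (count_edge_S _ _ _ Ep) // En (pcountB n2 Of); last by clear -n2; lia.
  rewrite (pcountBn n2 Of) (count_at_cat n) count_at_cons zn eqxx.
  by move: (weight _ _) (count_at _ _) (count_at _ _) => u1 u2 u3; clear; lia.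
have [n1n nn2] : n.-1 != n /\ n.-1.+1 = n by clear -n2; split; [apply/eqP; lia|lia].
have [_ /(_ _ _ _ _ _ Ed)] := St; rewrite xn yn avoids_cat avoids_cons zn eq_sym n1n N1 N2 => /(_ erefl isT).
have Hi : 0 < n.-1 < n by clear -n2; lia.
rewrite /gap_ok xn Hi nn2 W0 weight_cat weight_cons zn eqxx (avoids_weight M1) (avoids_weight M2) /weight1.
by case: z.2.
Qed.

Lemma linked_one d e1 z f1 x f2 w e2 : stable n d -> d = e1 ++ z :: (f1 ++ x :: f2) ++ w :: e2 ->
  z.1 = n -> w.1 = n -> x.1 = n.-1 -> avoids n.-1 f1 -> avoids n.-1 f2 -> avoids n f1 -> avoids n f2 ->
  exists b, z.2 = One b /\ w.2 = One (~~ b).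
Proof.
move=> St Ed zn wn xn N1 N2 M1 M2.
have [n1n n0] : n.-1 != n /\ (n == 0) = false by clear -n2; split; [apply/eqP; lia|lia].
have [_ /(_ _ _ _ _ _ Ed)] := St; rewrite zn wn avoids_cat avoids_cons xn n1n M1 M2 => /(_ erefl isT).
rewrite /gap_ok zn ltnn andbF n0 /= => -[_]; apply.
by move: N1 N2; rewrite !avoids_count_at count_at_cat count_at_cons xn eqxx => /eqP-> /eqP->.
Qed.

(** The pattern s t s t contains a gap of s_(n-1) whose only neighbour is u, which makes this u
double, and a gap of the same u with a single neighbour s_(n-1), which makes it a single
copy. Both gaps are found in the expansion by [gap_count_edge]. *)
Lemma no_square_B d v a c s t : stable n d -> commutation_equiv mB (expandB d) v ->
  edge mB s t -> s = uB n \/ t = uB n -> v <> a ++ [:: s; t; s; t] ++ c.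
Proof.
move=> St H est Hu Ev; have Od := stable_ok St.
have st : s != t by apply: contraTneq est => ->; rewrite /edge /cox_B path_matrix1.
have m2 : mB s t != 2 by rewrite gtn_eqF.
have := commutation_filter (@path_matrixC _ _ n 3 4) st m2 H.
rewrite Ev filter_cat /= !eqxx ?orbT /= => F.
have [A [r1 [E1 FA F1]]] := filter_cat_split F.
have [z1 [r2 [E2 Z1 F2 _]]] := filter_cons_split F1.
have [b1 [r3 [E3 B1 F3 _]]] := filter_cons_split F2.
have [b2 [r4 [E4 B2 F4 _]]] := filter_cons_split F3.
have [b3 [r5 [E5 B3 F5 _]]] := filter_cons_split F4.
have N b : filter (pred2 s t) b = [::] -> s \notin b /\ t \notin b.
  move=> Fb; split; apply/negP => sb.
    by have := mem_filter (pred2 s t) s b; rewrite Fb sb /= eqxx.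
  by have := mem_filter (pred2 s t) t b; rewrite Fb sb /= eqxx orbT.
have [[s0 t0] [s1 t1] [s2 t2] [s3 t3]] := And4 (N _ Z1) (N _ B1) (N _ B2) (N _ B3).
have C p u w : p \in [:: s; t] -> filter (pred2 s t) u = filter (pred2 s t) w -> count_mem p u = count_mem p w.
  move=> ps; have P q : count_mem p (filter (pred2 s t) q) = count_mem p q.
    rewrite count_filter; apply: eq_count => x /=; case: eqP => // ->.
    by move: ps; rewrite !inE.
  by move=> Fu; rewrite -P Fu P.
have [ps pt] : 0 < pos s /\ 0 < pos t.
  have pu : pos (uB n) = n by [].
  by move: est; rewrite edgeP //; case: Hu => ->; rewrite pu => /orP[] /eqP Ep; clear -Ep n2; lia.
have [d1 [x1 [d' [Ed EA xs1 E']]]] : exists d1 x d2, [/\ d = d1 ++ x :: d2, expandB d1 = A ++ z1, x.1 = pos s & expandB d2 = r2].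
  by apply: expand_at; rewrite // E1 E2 catA.
rewrite E3 in E'; have Od1 : all ok d' by move: Od; rewrite Ed all_cat => /and3P[].
have [d2 [x2 [d'' [Ed' EB1 xs2 E'']]]] := expand_at Od1 E' pt.
rewrite E4 in E''; have Od2 : all ok d'' by move: Od1; rewrite Ed' all_cat => /and3P[].
have [d3 [x3 [d4' [Ed'' EB2 xs3 E3']]]] := expand_at Od2 E'' ps.
rewrite E5 in E3'; have Od3 : all ok d4' by move: Od2; rewrite Ed'' all_cat => /and3P[].
have [d4 [x4 [d5 [Ed3 EB3 xs4 _]]]] := expand_at Od3 E3' pt.
have O2 : all ok d2 by move: Od1; rewrite Ed' all_cat => /and3P[].
have O3 : all ok d3 by move: Od2; rewrite Ed'' all_cat => /and3P[].
have O4 : all ok d4 by move: Od3; rewrite Ed3 all_cat => /and3P[].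
have [Ns2 Ns3] : avoids (pos s) d2 /\ avoids (pos s) d3.
  by split; apply: notin_expand; rewrite // ?EB1 ?EB2.
have [Nt2 Nt3] : avoids (pos t) d2 /\ avoids (pos t) d3.
  by split; apply: notin_expand; rewrite // ?EB1 ?EB2.
have [Ns4 Nt4] : avoids (pos s) d4 /\ avoids (pos t) d4.
  by split; apply: notin_expand; rewrite // ?EB3.
have Cs u : s \notin u -> count_mem s u = 0 by move=> su; apply/count_memPn.
have Ct u : t \notin u -> count_mem t u = 0 by move=> su; apply/count_memPn.
have pu : pos (uB n) = n by [].
have pos_le (w : Btype n) : pos w <= n.
  by case: w => [[?|k]|?] //=; have := ltn_ord k; clear; lia.
have [sn|tn] : (pos s = n.-1 /\ t = uB n) \/ (pos t = n.-1 /\ s = uB n).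
  move: est (pos_le s) (pos_le t); rewrite edgeP //.
  by case: Hu => Eu; rewrite Eu pu => /orP[] /eqP Ep l1 l2; [right|exfalso|exfalso|left];
    (try split=> //); clear -Ep l1 l2 n2; lia.
- case: sn => sn tu; have x2n : x2.1 = n by rewrite xs2 tu.
  have x4n : x4.1 = n by rewrite xs4 tu.
  have Ed4 : d = d1 ++ x1 :: (d2 ++ x2 :: d3) ++ x3 :: (d4 ++ x4 :: d5).
    by rewrite Ed Ed' Ed'' Ed3 -!catA.
  have Ed5 : d = (d1 ++ x1 :: d2) ++ x2 :: (d3 ++ x3 :: d4) ++ x4 :: d5.
    by rewrite Ed Ed' Ed'' Ed3 -!catA /=.
  rewrite tu pu in Nt2 Nt3 Nt4; rewrite sn in Ns2 Ns3 Ns4 xs1 xs3.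
  have [b [x2b _]] := linked_one St Ed5 x2n x4n xs3 Ns3 Ns4 Nt3 Nt4.
  suff : x2.2 = Both by rewrite x2b.
  apply: (lone_both St Ed4) => //; exists s => //.
  rewrite expand_cat expand_cons EB1 EB2 (exB_n n2 x2n) -tu cat1s.
  have E6 : v = a ++ s :: [:: t] ++ s :: (t :: c) by rewrite Ev.
  have E7 : expandB d = (A ++ z1) ++ s :: (b1 ++ t :: b2) ++ s :: (b3 ++ t :: r5).
    by rewrite E1 E2 E3 E4 E5 -!catA.
  rewrite (gap_count_edge (@path_matrix1 _ _ n 3 4) (@path_matrixC _ _ n 3 4) H E6 _ E7).
  + by rewrite /= est.
  + by rewrite inE.
  + by rewrite mem_cat inE (negPf st) (negPf s1) (negPf s2).
  by rewrite count_cat (Cs _ s0) addn0; apply: C FA; rewrite !inE eqxx.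
case: tn => tn su; have x1n : x1.1 = n by rewrite xs1 su.
have x3n : x3.1 = n by rewrite xs3 su.
have Ed4 : d = d1 ++ x1 :: (d2 ++ x2 :: d3) ++ x3 :: (d4 ++ x4 :: d5).
  by rewrite Ed Ed' Ed'' Ed3 -!catA.
have Ed5 : d = (d1 ++ x1 :: d2) ++ x2 :: (d3 ++ x3 :: d4) ++ x4 :: d5.
  by rewrite Ed Ed' Ed'' Ed3 -!catA /=.
rewrite su pu in Ns2 Ns3 Ns4; rewrite tn in Nt2 Nt3 Nt4 xs2 xs4.
have [b [_ x3b]] := linked_one St Ed4 x1n x3n xs2 Nt2 Nt3 Ns2 Ns3.
suff : x3.2 = Both by rewrite x3b.
apply: (lone_both St Ed5) => //; exists t => //.
rewrite expand_cat expand_cons EB2 EB3 (exB_n n2 x3n) -su cat1s.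
have E6 : v = (a ++ [:: s]) ++ t :: [:: s] ++ t :: c by rewrite Ev -catA.
have E7 : expandB d = (A ++ z1 ++ s :: b1) ++ t :: (b2 ++ s :: b3) ++ t :: r5.
  by rewrite E1 E2 E3 E4 E5 -!catA /=.
rewrite (gap_count_edge (@path_matrix1 _ _ n 3 4) (@path_matrixC _ _ n 3 4) H E6 _ E7).
- have : edge mB t s by move: est; rewrite /edge [mB t s]path_matrixC.
  by rewrite /= => ->.
- by rewrite inE eq_sym.
- by rewrite mem_cat inE (eq_sym t) (negPf st) (negPf t2) (negPf t3).
rewrite !count_cat /= (Ct _ t0) (Ct _ t1) (negPf st) !addn0; apply: C FA.
by rewrite !inE eqxx orbT.
Qed.

Lemma mB4 (s t : Btype n) : edge mB s t -> s = uB n \/ t = uB n -> mB s t = 4.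
Proof.
have pu : pos (uB n) = n by [].
rewrite edgeP // => est Hu.
have st : s != t by apply: contraTneq est => ->; rewrite orbb ltn_eqF.
rewrite /cox_B /path_matrix (negPf st) est.
case: Hu est => ->; rewrite pu.
  by case: t {st} => [[b|k]|[]] //= => E; exfalso; clear -n2 E; lia.
by case: s {st} => [[b|k]|[]] //= => E; exfalso; clear -n2 E; lia.
Qed.

Lemma stable_braid_free_B d : stable n d -> braid_free mB (expandB d).
Proof.
move=> St v' H a c s t; have P1 := @path_matrix1 bool unit n 3 4; have PC := @path_matrixC bool unit n 3 4.
split=> [E|mst].
  have [a2 [b2 [c2 [E2 sb _ T]]]] := gap_transfer P1 PC (b := [::]) H E isT.
  by have [] := stable_gap_B St E2 sb; rewrite (count_edge T).
have [Hu|Hu] := boolP ((s == uB n) || (t == uB n)).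
  have Hu' : s = uB n \/ t = uB n by case/orP: Hu => /eqP; auto.
  by rewrite (mB4 mst Hu'); exact: (no_square_B St H mst Hu').
move: Hu; rewrite negb_or => /andP[su tu].
rewrite (mB3 mst su tu) /= => E.
have st : s \notin [:: t] by rewrite inE; apply: contraTneq mst => <-; rewrite /cox_B P1.
have [a2 [b2 [c2 [E2 sb _ T]]]] := gap_transfer P1 PC (b := [:: t]) H E st.
have [_ /(_ su)] := stable_gap_B St E2 sb; rewrite (count_edge T) /=.
case: (edge mB s t) => H2; apply: (notF (H2 _)) => eu; apply/count_memPn.
all: by rewrite (T _ eu) /= (negPf tu).
Qed.

End StableB.

(** * Decorations of the ends of a stable word *)

(** Consecutive entries being opposite determines the list up to its first entry. *)
Lemma alternates_intro (r : seq end_split) :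
  (forall u c c' v, r = u ++ c :: c' :: v -> exists z, c = One z /\ c' = One (~~ z)) ->
  size r <= 1 \/ alternates r.
Proof.
move=> H; have [|r1] := leqP (size r) 1; [by left|right].
have H' k : k.+1 < size r -> exists z, nth Both r k = One z /\ nth Both r k.+1 = One (~~ z).
  move=> kr; apply: (H (take k r) _ _ (drop k.+2 r)).
  by rewrite -drop_nth // -drop_nth ?cat_take_drop // ltnW.
have [b [b0 _]] := H' 0 r1.
exists b; apply: (@eq_from_nth _ Both); rewrite ?size_mkseq // => i ir.
rewrite nth_mkseq //; elim: i ir => [|i IH] ir; first by rewrite b0 addbF.
have [z [z0 ->]] := H' i ir; move: z0; rewrite IH ?(ltnW ir) // => -[<-].
by rewrite /= addbN.
Qed.

Lemma deco_split1 i d u c v : decorations i d = u ++ c :: v -> exists a x b,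
  [/\ d = a ++ x :: b, x.1 = i, x.2 = c, decorations i a = u & decorations i b = v].
Proof.
move=> E; have [f1 [x [f2 [Ef Eu xc Ev]]]] := map_cons_split E.
have [a [d' [Ed Fa Fd]]] := filter_cat_split Ef.
have [b1 [b [Ed' F1 F2 /eqP xi]]] := filter_cons_split Fd.
exists (a ++ b1), x, b; rewrite deco_cat /decorations Fa F1 F2 cats0; split=> //.
by rewrite Ed Ed' -catA.
Qed.

Lemma deco_split2 i d u c c' v : decorations i d = u ++ c :: c' :: v -> exists a x b y e,
  [/\ d = a ++ x :: b ++ y :: e, x.1 = i /\ y.1 = i, avoids i b, x.2 = c & y.2 = c'].
Proof.
move=> /deco_split1[a [x [b [-> xi xc _ E]]]].
have [b' [y [e [-> yi yc Eb _]]]] := deco_split1 (E : decorations i b = [::] ++ c' :: v).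
exists a, x, b', y, e; split=> //.
by rewrite avoids_count_at -size_deco Eb.
Qed.

Section EndRules.
Variable n : nat.
Hypothesis n2 : 2 <= n.
Notation ok := (letter_ok n).
Notation stable := (stable n).
Notation flip := (flip n).
Notation C := (Ctype n).
Notation cpos := (@pos unit unit n).
Notation eC := (edge (@cox_C n)).

Lemma isolated_left_deco j d : isolated_left j d -> decorations 0 d = [:: Both].
Proof. by move=> [L _]; rewrite -(@deco_low n n2 j.+1) // L deco_LPeak. Qed.

(** Alternation leaves a single letter 1 between two consecutive letters 0. *)
Lemma alternates_at_deco d : stable d -> alternates_at 0 d -> size (decorations 0 d) <= 1 \/ alternates (decorations 0 d).
Proof.
move=> [_ G]; rewrite alternates_at_walt => /walt_sep[_ S]; apply: alternates_intro => u c c' v.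
move=> /deco_split2[a [x [b [y [e [Ed [x0 y0] Nb <- <-]]]]]].
have := G _ _ _ _ _ Ed; rewrite x0 y0 => /(_ erefl Nb); rewrite /gap_ok x0 /= => -[b0]; apply.
apply/eqP; rewrite eqn_leq b0 andbT leqNgt; apply/negP => b2.
have : ~~ avoids 1 b by rewrite avoids_count_at -lt0n.
move=> /has_split[b1 [z [b' [Eb z1 N1]]]].
have : ~~ avoids 1 b'.
  rewrite avoids_count_at -lt0n; move: b2 N1; rewrite Eb count_at_cat count_at_cons z1 avoids_count_at.
  by move: (count_at 1 b1) (count_at 1 b') => p q; clear; lia.
move=> /has_split[b2' [z' [b3 [Eb' z1' N2]]]].
have Em : map fst d = map fst (a ++ x :: b1) ++ 1 :: map fst b2' ++ 1 :: map fst (b3 ++ y :: e).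
  by rewrite Ed Eb Eb' !(map_cat, map_cons) z1 z1' -!catA !cat_cons -?catA ?cat_cons -?catA.
have N2' : 1 \notin map fst b2' by rewrite -avoids_mem.
have := S _ _ _ Em N2'; apply/negP; rewrite -avoids_mem.
by move: Nb; rewrite Eb Eb' avoids_cat avoids_cons avoids_cat => /and3P[_ _ /andP[]].
Qed.

(** An interior 0 lies alone between two letters 1, whose gap needs two neighbours. *)
Lemma zigzag_zig_deco d : stable d -> zigzag_deco n d -> zig_deco d 0.
Proof.
move=> St [Z [i [Hi Ci]]] a x b Ed x0 a0 b0.
have Zs : zigzag_path n (map fst d).
  apply: (zigzag_word_zigzag_path n2 Z); apply: leq_trans Ci _; rewrite size_map; exact: count_size.
case/lastP: a a0 Ed => // a p _ Ed; case: b b0 Ed => // q b _ Ed.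
have p1 : p.1 = 1.
  have E1 : map fst d = map fst a ++ p.1 :: x.1 :: map fst (q :: b).
    by rewrite Ed -cats1 !map_cat /= -catA.
  by case: (zigzag_path_step n2 Zs E1); rewrite x0.
have q1 : q.1 = 1.
  have E1 : map fst d = map fst (rcons a p) ++ x.1 :: q.1 :: map fst b.
    by rewrite Ed !map_cat.
  by case: (zigzag_path_step n2 Zs E1); rewrite x0.
have [_ /(_ a p [:: x] q b)] := St.
rewrite Ed cat_rcons q1 p1 avoids_cons x0 => /(_ erefl erefl isT).
by rewrite /gap_ok p1 /= n2 !weight_cons !weight_nil x0 /= /weight1; case: x.2.
Qed.

Lemma zig_deco_flip d : all ok d -> zig_deco (flip d) 0 -> zig_deco d n.
Proof.
move=> Od Z a x b Ed xn a0 b0.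
have := Z (flip a) (flipx n x) (flip b); rewrite Ed flip_cat flip_cons => /(_ erefl) H.
by apply: H; rewrite /= ?xn ?subnn //; [case: (a) a0|case: (b) b0].
Qed.

Lemma zig_deco_rule d (w : seq C) (s : C) : map fst d = map cpos w -> zig_deco d (cpos s) ->
  forall i, i < size (decorations (cpos s) d) ->
    [\/ nth Both (decorations (cpos s) d) i = Both,
        i = 0 /\ (exists w', w = s :: w')
      | i = (size (decorations (cpos s) d)).-1 /\ (exists w', w = rcons w' s)].
Proof.
move=> E Z i ir; set r := decorations _ d in ir *.
have Er : r = take i r ++ nth Both r i :: drop i.+1 r by rewrite -drop_nth // cat_take_drop.
have [a [x [b [Ed xs xc Ea Eb]]]] := deco_split1 Er.
case: a Ed Ea => [|p a] Ed Ea.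
  apply: Or32; split.
    by have := congr1 size Ea; rewrite /= size_take ir.
  case: w E => [|s' w]; rewrite Ed //= xs => -[Es _]; exists w.
  by rewrite (cpos_inj n2 Es).
case/lastP: b Ed Eb => [|b q] Ed Eb.
  apply: Or33; split.
    by have := congr1 size Eb; rewrite /= size_drop; move: ir; clear; lia.
  case/lastP: w E => [|w s']; first by rewrite Ed.
  rewrite Ed map_cat /= cats1 map_rcons -rcons_cons => H.
  have [_ Es] := rcons_inj H; exists w; congr rcons; apply: (cpos_inj n2).
  by rewrite -Es.
apply: Or31; rewrite -xc; apply: (Z _ _ _ Ed xs) => //; by case: (b).
Qed.

Lemma filter_low_flip d : all ok d -> flip (low n (flip d)) = filter (fun x => 0 < x.1) d.
Proof.
elim: d => //= x d IH /andP[Ox Od].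
have /andP[xn _] := Ox; have -> : (n - x.1 < n) = (0 < x.1) by clear -xn n2; lia.
by case: ifP => _; rewrite /= IH // -/(flipx n (flipx n x)) flipxK.
Qed.

(** The positions 0 1 ... n ... 1 0 of the special case of the rules. *)
Definition full_peak : seq nat := 0 :: iota 1 n.-1 ++ n :: rev (iota 1 n.-1) ++ [:: 0].

(** A peak on the right at position 1 leaves room for at most one letter 0 on each side; when both
occur, the word is that of the special case. *)
Lemma isoR1_deco d : stable d -> isolated_right n 1 d ->
  size (decorations 0 d) <= 1 \/ map fst d = full_peak.
Proof.
move=> St I; have Od := stable_ok St.
have n1 : 0 < 1 < n by [].
have F : filter (fun x => 0 < x.1) d = up 1 n.-1 ++ (n, Both) :: rev (up 1 n.-1).
  have [L _] := I; rewrite -filter_low_flip //; have := L.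
  have -> : (n - 1).+1 = n by clear -n2; lia.
  move=> ->; have nn : n - 1 < n by clear -n2; lia.
  rewrite flip_LPeak // (subKn (ltnW n2)) subn1; by [].
have [a [x [b [y [c [Ed [x1 y1] [Na Nc] Nb N0]]]]]] := isolated_right_split n2 n1 Od I.
have U : up 1 n.-1 = (1, One false) :: up 2 n.-2 by case: (n) n2 => [|[]].
have Z u : filter (fun x : letter => 0 < x.1) u = [::] -> all (fun x => x.1 == 0) u.
  by elim: u => //= z u IH; case: posnP => //= _ /IH ->.
have Fa : all (fun x => x.1 == 0) a.
  apply: Z; move: F; rewrite Ed filter_cat U; case Ea: (filter _ a) => [|z f] //= [Ez _].
  have [a1 [a2 [Ea' _ _ _]]] := filter_cons_split Ea.
  by move: Na; rewrite Ea' avoids_cat avoids_cons Ez andbF.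
have Fc : all (fun x => x.1 == 0) c.
  apply: Z; case/lastP Ec: (filter _ c) => [|f z] //.
  have Ez : z = (1, One false).
    move: F; rewrite Ed U rev_cons filter_cat /= x1 filter_cat /= y1 Ec.
    rewrite -!cats1 -[x :: _ in LHS]cat1s -[y :: _ in LHS]cat1s -[_ :: _ in RHS]cat1s.
    rewrite -[(n, Both) :: _]cat1s !catA !cats1 => H.
    by have [_ ->] := rcons_inj H.
  have zc : z.1 \in map fst c.
    have : z.1 \in map fst (rcons f z) by rewrite map_rcons mem_rcons mem_head.
    by rewrite -Ec; elim: (c) => //= q u IH; case: ifP => _ /=;
      rewrite !inE; [case/orP=> [->|/IH ->]|move=> /IH ->]; rewrite ?orbT.
  by move: Nc; rewrite avoids_mem; rewrite Ez /= in zc; rewrite zc.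
have short u : all (fun x : letter => x.1 == 0) u -> (exists p q, d = p ++ u ++ q) -> size u <= 1.
  case: u => [|z [|z' u]] //= /andP[/eqP z0 /andP[/eqP z0' _]] [p [q Eq]].
  have [_ /(_ p z [::] z' (u ++ q))] := St; rewrite z0 z0' => /(_ Eq erefl isT).
  by rewrite /gap_ok z0 => -[].
have Sa : size a <= 1.
  by apply: short => //; exists [::], (x :: b ++ y :: c).
have Sc : size c <= 1.
  by apply: short => //; exists (a ++ x :: b ++ [:: y]), [::]; rewrite cats0 Ed -!catA /= -catA.
have C0 : size (decorations 0 d) <= size a + size c.
  rewrite size_deco Ed !(count_at_cat, count_at_cons) x1 y1.
  move: N0; rewrite avoids_count_at => /eqP ->; rewrite !add0n.
  by apply: leq_add; apply: count_size.
have [C1|C1] := leqP (size a + size c) 1; first by left; exact: leq_trans C0 C1.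
have [z Ez] : exists z, a = [:: z] by case: (a) Sa C1 Sc => [|z [|? ?]] //=; [lia|exists z].
have [z' Ez'] : exists z, c = [:: z] by case: (c) Sc C1 Sa => [|z1 [|? ?]] //=; [lia|exists z1].
rewrite Ez Ez' /= !andbT in Ed Fa Fc; move/eqP: Fa => z0; move/eqP: Fc => z0'; right.
move: F; rewrite Ed /= z0 filter_cat /= x1 y1 z0' => F.
have Fb : filter (fun x : letter => 0 < x.1) b = b.
  by apply/all_filterP; apply: sub_all N0 => q; rewrite lt0n.
have {}F : x :: b ++ [:: y] = up 1 n.-1 ++ (n, Both) :: rev (up 1 n.-1) by rewrite -F Fb.
have -> : [:: 0, 1 & map fst (b ++ [:: y; z'])] = 0 :: map fst (x :: b ++ [:: y]) ++ [:: 0].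
  by rewrite /= !map_cat /= -catA x1 z0'.
by rewrite F /full_peak map_cat /= map_rev !map_up -catA.
Qed.

Lemma mirror_peak d : all ok d -> map fst (flip d) = full_peak ->
  map fst d = n :: rev (iota 1 n.-1) ++ 0 :: iota 1 n.-1 ++ [:: n].
Proof.
move=> Od E; have -> : map fst d = map (subn n) full_peak by rewrite -E -map_fst_flip flipK.
rewrite /full_peak map_cons map_cat map_cons map_cat map_rev subn0 subnn.
have -> : map (subn n) (iota 1 n.-1) = rev (iota 1 n.-1).
  have H : 1 + n.-1 <= n.+1 by clear -n2; lia.
  have := congr1 (map fst) (@flip_up n n2 1 n.-1 H); rewrite map_fst_flip map_rev !map_up => ->.
  by congr (rev (iota _ _)); clear -n2; lia.
by rewrite revK /= subn0.
Qed.

End EndRules.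

Section Rules.
Variable n : nat.
Hypothesis n2 : 2 <= n.
Notation ok := (letter_ok n).
Notation stable := (stable n).
Notation flip := (flip n).
Notation C := (Ctype n).
Notation cpos := (@pos unit unit n).
Notation eC := (edge (@cox_C n)).
Notation full_peak := (full_peak n).

Lemma special_t_word (w : seq C) : map cpos w = full_peak -> w = zigzag n ++ [:: tC n].
Proof.
move=> E; apply: (map_cpos_inj n2); rewrite E map_cat map_zigzag // /full_peak /wzig /=.
by rewrite -catA.
Qed.

Lemma special_u_word (w : seq C) :
  map cpos w = n :: rev (iota 1 n.-1) ++ 0 :: iota 1 n.-1 ++ [:: n] ->
  w = [:: uC n] ++ s_down n ++ [:: tC n] ++ s_up n ++ [:: uC n].
Proof.
by move=> E; apply: (map_cpos_inj n2); rewrite E !map_cat map_rev map_s_up.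
Qed.

Lemma rule_t (w : seq C) d X : stable d -> shape n d X -> map fst d = map cpos w ->
  t_rule X w (decorations 0 d).
Proof.
move=> St Sh E; split; first by rewrite size_deco (count_cpos n2 (tC n) E).
have spread : size (decorations 0 d) <= 1 \/ alternates (decorations 0 d) -> [\/ size (decorations 0 d) <= 1,
    alternates (decorations 0 d)
  | lposet_iso (heap_of_word eC w) (heap_of_word eC (zigzag n ++ [:: tC n]))].
  by case; [exact: Or31|exact: Or32].
case: Sh => [A|Z|j Hj I _|k Hk I A|j k Hj Hk I _ _].
- by apply: spread; apply: (alternates_at_deco St); apply: A; exact: ltnW.
- by apply: (zig_deco_rule n2 (s := tC n) E); exact: (zigzag_zig_deco n2 St Z).
- exact: isolated_left_deco I.
- have [k1|k1] := eqVneq k 1; last first.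
    apply: spread; apply: (alternates_at_deco St); rewrite -(@alternates_at_drop_first 0 k) //; last by rewrite -lt0n; case/andP: Hk.
    by apply: A; case/andP: Hk.
  rewrite k1 in I; have [S1|F] := isoR1_deco n2 St I; first exact: Or31.
  by rewrite E in F; rewrite -(special_t_word F); apply: Or33; exact: iso_refl.
exact: isolated_left_deco I.
Qed.

Lemma rule_u (w : seq C) d X : stable d -> shape n d X -> map fst d = map cpos w ->
  u_rule X w (decorations n d).
Proof.
move=> St Sh E; split; first by rewrite size_deco (count_cpos n2 (uC n) E).
have Od := stable_ok St; have Stf := stable_flip n2 St; have Ef := deco_flip n2 Od.
have spread : size (decorations n d) <= 1 \/ alternates (decorations n d) -> [\/ size (decorations n d) <= 1,
    alternates (decorations n d)
  | lposet_iso (heap_of_word eC w)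
      (heap_of_word eC ([:: uC n] ++ s_down n ++ [:: tC n] ++ s_up n ++ [:: uC n]))].
  by case; [exact: Or31|exact: Or32].
have n1n : n.-1 < n by clear -n2; lia.
have alt u : all ok u -> alternates_at 0 (flip u) = alternates_at n.-1 u.
  by move=> Ou; rewrite alternates_at_flip ?subn1 // ltnW.
case: Sh => [A|Z|j Hj I A|k Hk I A|j k Hj Hk _ I _] /=.
- by apply: spread; rewrite -Ef; apply: (alternates_at_deco Stf); rewrite alt //; exact: A.
- apply: (zig_deco_rule n2 (s := uC n) E); apply: zig_deco_flip => //.
  apply: (zigzag_zig_deco n2 Stf); apply: (zigzag_deco_flip n2); rewrite ?flipK //; exact: ok_flip.
- have [j1|j1] := eqVneq j n.-1; last first.
    apply: spread; rewrite -Ef; apply: (alternates_at_deco Stf); rewrite alt //.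
    rewrite -(@alternates_at_drop_first n.-1 j) //; first by apply: A; clear -Hj n1n; lia.
    by apply/eqP; clear -Hj n2; lia.
  have If : isolated_right n 1 (flip d) by rewrite /isolated_right flipK // subn1 -j1.
  have [S1|F] := isoR1_deco n2 Stf If; first by apply: Or31; rewrite -Ef.
  have := mirror_peak n2 Od F; rewrite E => /special_u_word Ew.
  by apply: Or33; rewrite {1}Ew; exact: iso_refl.
- by rewrite -Ef; exact: isolated_left_deco I.
by rewrite -Ef; exact: isolated_left_deco I.
Qed.

(** The rules only prescribe the decorations of the ends; they assemble to a decorated word. *)
Lemma decorate (u : seq nat) rt ru : all (fun i => i <= n) u ->
  size rt = count_mem 0 u -> size ru = count_mem n u ->
  exists d, [/\ map fst d = u, all ok d, decorations 0 d = rt & decorations n d = ru].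
Proof.
have n0 : (0 == n) = false by clear -n2; lia.
have n0' : (n == 0) = false by rewrite eq_sym.
elim: u rt ru => [|i u IH] rt ru /=.
  by move=> _ /size0nil-> /size0nil->; exists [::].
move=> /andP[i_n un]; have [->|i0] := eqVneq i 0.
  rewrite n0 add0n add1n; case: rt => // c rt [St] Su.
  have [d [Ed Od Et Eu]] := IH rt ru un St Su; exists ((0, c) :: d).
  by rewrite !deco_cons /= n0 Ed Od Et Eu /letter_ok.
have [->|i_n'] := eqVneq i n.
  rewrite add0n add1n; case: ru => // c ru St [Su].
  have [d [Ed Od Et Eu]] := IH rt ru un St Su; exists ((n, c) :: d).
  by rewrite !deco_cons /= n0' eqxx Ed Od Et Eu /letter_ok /= leqnn ltnn andbF.
rewrite !add0n => St Su.
have [d [Ed Od Et Eu]] := IH rt ru un St Su; exists ((i, One false) :: d).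
by rewrite !deco_cons /= (negPf i0) (negPf i_n') Ed Od Et Eu /letter_ok /= i_n implybT.
Qed.

Lemma decorate_word (w : seq C) rt ru :
  size rt = count_mem (tC n) w -> size ru = count_mem (uC n) w ->
  exists d, [/\ map fst d = map cpos w, all ok d, decorations 0 d = rt & decorations n d = ru].
Proof.
have cw s : count_mem s w = count_mem (cpos s) (map cpos w).
  by rewrite count_map; apply: eq_count => v /=; rewrite (inj_eq (cpos_inj n2)).
rewrite !cw => St Su; apply: decorate => //.
by apply/allP => i /mapP[v _ ->]; exact: cpos_le.
Qed.

Lemma substitute_expand (L R : finType) (letter_word : letter -> seq (vertex L R n)) F G (w : seq C) d :
  (forall c, letter_word (0, c) = F c) -> (forall c, letter_word (n, c) = G c) ->
  (forall i : 'I_n.-1, letter_word (i.+1, One false) = [:: sv L R i]) ->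
  map fst d = map cpos w -> all ok d ->
  substitute (map F (decorations 0 d)) (map G (decorations n d)) w = expand letter_word d.
Proof.
move=> E0 En Ei; have n0 : (0 == n) = false by clear -n2; lia.
have n0' : (n == 0) = false by rewrite eq_sym.
elim: w d => [|v w IH] [|[i c] d] //= [Eiv E] /andP[Ox Od].
rewrite expand_cons -(IH d E Od) !deco_cons /=.
case: v Eiv => [[[]|k]|[]] /= Ei'; subst i.
- by rewrite eqxx n0 /= E0.
- have kn : k.+1 < n by have := ltn_ord k; clear; lia.
  have [Ec] : (k.+1, c) = (k.+1, One false) by apply: (letter_okP Ox).
  by rewrite (ltn_eqF kn) /= Ec Ei.
by rewrite n0' eqxx /= En.
Qed.

Lemma word_of d : all ok d -> exists w : seq C, map fst d = map cpos w.
Proof.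
move=> Od; exists (map (vtx n) (map fst d)); rewrite -map_comp -[LHS]map_id.
elim: d Od => //= x d IH /andP[/andP[xn _] Od].
by rewrite (pos_vtx n2) // -IH.
Qed.

(** Type affine B substitutes nothing for u, so stability is tested with an arbitrary admissible
decoration of the right end. *)
Lemma has_u_rule (w : seq C) X (rt : seq end_split) : in_family X (heap_of_word eC w) ->
  size rt = count_mem (tC n) w -> exists ru, u_rule X w ru.
Proof.
move=> F St.
have alt : exists ru : seq end_split, size ru = count_mem (uC n) w /\ alternates ru.
  exists (mkseq (fun i => One (false (+) odd i)) (count_mem (uC n) w)).
  by rewrite size_mkseq; split=> //; exists false; rewrite size_mkseq.
have one k : RP1 (heap_of_word eC w) k -> count_mem (uC n) w = 1.
  have [ru [Su _]] := alt; have [d [E Od _ _]] := decorate_word St Su.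
  move=> /(RP1_word n2 k E Od) R; rewrite (count_cpos n2 (uC n) E).
  have kn := ltn_ord k; have -> : count_at n d = count_at 0 (flip d) by rewrite count_at_flip // subn0.
  rewrite -(@count_at_low 0 (n - k.+1).+1) //.
  have cf u : count_at 0 u = count_mem 0 (map fst u) by rewrite count_map.
  by rewrite cf R -cf count_at_LPeak.
case: X F => /=.
- by move=> _; have [ru [Su A]] := alt; exists ru; split=> //; exact: Or32.
- move=> _; exists (nseq (count_mem (uC n) w) Both); split; first by rewrite size_nseq.
  by move=> i _; apply: Or31; rewrite nth_nseq; case: ifP.
- by move=> _; have [ru [Su A]] := alt; exists ru; split=> //; exact: Or32.
- by move=> [k [R _ _]]; exists [:: Both]; split=> //; rewrite (one k R).
by move=> [j [k [_ _ [R _] _]]]; exists [:: Both]; split=> //; rewrite (one k R).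
Qed.

End Rules.

(** * The two theorems *)

Section Order.
Variables (S : finType) (m : S -> S -> nat) (f : S -> nat).
Hypothesis m1 : forall s, m s s = 1.
Hypothesis mC : forall s t, m s t = m t s.
Hypothesis m234 : forall s t, s != t -> [\/ m s t = 2, m s t = 3 | m s t = 4].
Hypothesis m4 : forall s t, m s t = 4 -> f s != f t.

(** The function f orients the edges with label 4, which are those where the Cartan
matrix is not symmetric. *)
Lemma matrix_order s t k : s != t -> 0 < k < m s t ->
  ~ same_element m (flatten (nseq k [:: s; t])) [::].
Proof.
pose c (s t : S) : int := (if s == t then - 2%:Z else if m s t == 2 then 0
  else if (m s t == 4) && (f t < f s)%N then 2%:Z else 1)%R.
apply: (@coxeter_order S m c) => // [s'|s' t' st]; first by rewrite /c eqxx.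
rewrite /c (eq_sym t') (negPf st) (mC t').
have [E|E|E] := m234 st; rewrite E /=; [exact: Or41|exact: Or42|].
by case: (ltngtP (f s') (f t')) (m4 E) => // _ _; [exact: Or43|exact: Or44].
Qed.

End Order.

Section Main.
Variable n : nat.
Hypothesis n2 : 2 <= n.
Notation C := (Ctype n).
Notation eC := (edge (@cox_C n)).

Definition C_heap (w : seq C) : heap eC := MkHeap (heap_of_wordP w (@eC_sym n)).

Lemma path_order (L R : finType) q s t k : q = 3 \/ q = 4 -> s != t ->
  0 < k < @path_matrix L R n 3 q s t ->
  ~ same_element (@path_matrix L R n 3 q) (flatten (nseq k [:: s; t])) [::].
Proof.
move=> Hq; apply: (@matrix_order _ _ (@pos L R n)).
- exact: path_matrix1.
- exact: path_matrixC.
- move=> {}s {}t st; rewrite /path_matrix (negPf st); case: ifP => _; last exact: Or31.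
  by case: s {st} => [[?|?]|?]; case: t => [[?|?]|?]; try exact: Or32;
    (case: Hq => ->; [exact: Or32|exact: Or33]).
move=> {}s {}t; rewrite /path_matrix; case: eqP => // _; case: ifP => // + _.
by move=> /orP[] /eqP ->; rewrite ?(ltn_eqF (ltnSn _)) // eq_sym ltn_eqF.
Qed.

Lemma fc_braid_free (L R : finType) q (K : lposet (vertex L R n)) : q = 3 \/ q = 4 ->
  fc_heap (@path_matrix L R n 3 q) K <-> exists v, braid_free (@path_matrix L R n 3 q) v /\
     lposet_iso K (heap_of_word (edge (@path_matrix L R n 3 q)) v).
Proof.
move=> Hq; have q2 : 2 < q by case: Hq => ->.
have S v : braid_free (@path_matrix L R n 3 q) v <->
    reduced (@path_matrix L R n 3 q) v /\ fully_commutative (@path_matrix L R n 3 q) v.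
  apply: stembridge.
  - exact: path_matrix1.
  - exact: path_matrixC.
  - move=> s t; case: (eqVneq s t) => [->|st]; first by rewrite path_matrix1.
    by apply: ltnW; apply: path_matrix_neq.
  - move=> s t k; exact: path_order.
  by move=> s t; apply: path_matrix_neq.
split=> [[w [Rw Fw iso]]|[v [/S[Rv Fv] iso]]]; last by exists v.
by exists w; split=> //; apply/S.
Qed.

Lemma fc_iff_family_D (K : heap (edge (@cox_D n))) :
  fc_heap (@cox_D n) K <-> exists X : heap_family, family_D X K.
Proof.
have P1 := @path_matrix1 bool bool n 3 3; have PC := @path_matrixC bool bool n 3 3.
rewrite /cox_D fc_braid_free; last by left.
have Esub (w : seq C) d : map fst d = map (@pos unit unit n) w -> all (letter_ok n) d ->
    substitute (map (split_word (@tD n)) (decorations 0 d)) (map (split_word (@uD n)) (decorations n d)) w =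
    expand (@exD n) d.
  apply: (substitute_expand n2) => [c|c|i] //; first by rewrite /exD /= eqxx; case: (n) n2.
  have Hi : 0 < i.+1 < n by have := ltn_ord i; lia.
  by rewrite exD_mid // mid_sv.
split=> [[v [BF iso]]|[X [H [F [w [rt [ru [isoH Rt Ru isoK]]]]]]]].
  have [d [Od vd [S0 Sn]]] := collapse_D n2 BF.
  have St := braid_free_stable n2 Od S0 Sn (braid_free_commutation BF vd).
  have [X Sh] := stable_shape n2 St; have [w E] := word_of n2 Od.
  exists X, (C_heap w); split; first exact: (shape_family n2 St Sh E).
  exists w, (decorations 0 d), (decorations n d); split; [exact: iso_refl|exact: rule_t|exact: rule_u|].
  rewrite Esub //; apply: iso_trans iso _; exact: commutation_iso vd.
have [d [E Od Et Eu]] := decorate_word n2 Rt.1 Ru.1.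
rewrite -Et -Eu in Rt Ru isoK; rewrite Esub // in isoK.
have St := family_stable n2 (family_iso isoH F) E Od Rt Ru.
by exists (expand (@exD n) d); split=> //; exact: stable_braid_free.
Qed.

Lemma fc_iff_family_B (K : heap (edge (@cox_B n))) :
  fc_heap (@cox_B n) K <-> exists X : heap_family, family_B X K.
Proof.
have P1 := @path_matrix1 bool unit n 3 4; have PC := @path_matrixC bool unit n 3 4.
rewrite /cox_B fc_braid_free; last by right.
have Esub (w : seq C) d : map fst d = map (@pos unit unit n) w -> all (letter_ok n) d ->
    substitute (map (split_word (@tB n)) (decorations 0 d)) (nseq (count_mem (uC n) w) [:: uB n]) w =
    expand (@exB n) d.
  move=> E Od; have -> : nseq (count_mem (uC n) w) [:: uB n] = map (fun=> [:: uB n]) (decorations n d).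
    rewrite (count_cpos n2 (uC n) E) -size_deco.
    by elim: (decorations n d) => //= c r ->.
  apply: (substitute_expand n2) => [c|c|i||] //; first by rewrite exB_n.
  have Hi : 0 < i.+1 < n by have := ltn_ord i; lia.
  by rewrite exB_mid // mid_sv.
split=> [[v [BF iso]]|[X [H [F [w [rt [isoH Rt isoK]]]]]]].
  have [d0 [Od0 vd [S0 Sn]]] := collapse_B n2 BF.
  have [d [Ed St]] := braid_free_stable_B n2 Od0 S0 Sn (braid_free_commutation BF vd).
  have Od := stable_ok St; rewrite -Ed in vd.
  have [X Sh] := stable_shape n2 St; have [w E] := word_of n2 Od.
  exists X, (C_heap w); split; first exact: (shape_family n2 St Sh E).
  exists w, (decorations 0 d); split; [exact: iso_refl|exact: rule_t|].
  rewrite Esub //; apply: iso_trans iso _; exact: commutation_iso vd.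
have F' := family_iso isoH F; have [ru Ru] := has_u_rule n2 F' Rt.1.
have [d [E Od Et Eu]] := decorate_word n2 Rt.1 Ru.1.
rewrite -Et in Rt isoK; rewrite -Eu in Ru; rewrite Esub // in isoK.
have St := family_stable n2 F' E Od Rt Ru.
by exists (expand (@exB n) d); split=> //; exact: stable_braid_free_B.
Qed.

End Main.

Theorem theorem3p10 (n : nat) (n_ge2 : 2 <= n) :
  (forall K : heap (edge (@cox_B n)),
     fc_heap (@cox_B n) K <-> exists X : heap_family, family_B X K) /\
  (forall K : heap (edge (@cox_D n)),
     fc_heap (@cox_D n) K <-> exists X : heap_family, family_D X K).
Proof. by split=> K; [exact: fc_iff_family_B|exact: fc_iff_family_D]. Qed.
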